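(* Let $\Lambda=\{\lambda_n,\mu_n\}_{n=1}^{\infty}$ be a multiplicity sequence in the class $ABC$, and let $-\infty<\gamma<\beta<\infty$. For $p\ge 1$, $n\in\mathbb{N}$ and $k\in\{0,1,\dots,\mu_n-1\}$, let $e_{n,k}(x)=x^ke^{\lambda_n x}$, let $E_{\Lambda_{n,k}}=E_\Lambda\setminus\{e_{n,k}\}$, and let \[ D_{\gamma,\beta,p,n,k}:=\inf_{g\in \overline{\mathrm{span}}(E_{\Lambda_{n,k}})}\|e_{n,k}-g\|_{L^p(\gamma,\beta)}, \] where the closed span is taken in $L^p(\gamma,\beta)$. Then for every $\epsilon>0$ there is a constant $u_\epsilon>0$, independent of $p\ge1$, $n$ and $k$ (depending only on $\Lambda$ and $\beta-\gamma$), such that \[ D_{\gamma,\beta,p,n,k}\ge u_\epsilon e^{(\beta-\epsilon)\Re\lambda_n}\quad\text{for all } p\ge1,\ n\in\mathbb{N},\ k=0,1,\dots,\mu_n-1. \]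
   Context: A multiplicity sequence $\Lambda=\{\lambda_n,\mu_n\}_{n=1}^\infty$ consists of distinct nonzero complex numbers $\lambda_n$ with $|\lambda_n|\to\infty$, $|\lambda_n|\le|\lambda_{n+1}|$, and positive integers $\mu_n$ (the multiplicity of $\lambda_n$). $A^0_{|z|}$ is the space of entire functions $F$ of exponential type zero: for every $\epsilon>0$ there is $M_\epsilon$ with $|F(z)|\le M_\epsilon e^{\epsilon|z|}$ for all $z\in\mathbb{C}$. $\Lambda$ is an interpolating variety for $A^0_{|z|}$ if for every doubly indexed sequence $(a_{n,k})_{n\in\mathbb{N},0\le k\le\mu_n-1}$ of complex numbers with $\sup_n\sum_{k=0}^{\mu_n-1}|a_{n,k}|e^{-\epsilon|\lambda_n|}<\infty$ for every $\epsilon>0$, there is $f\in A^0_{|z|}$ with $f^{(k)}(\lambda_n)/k!=a_{n,k}$ for all $n,k$. $\Lambda$ belongs to the class $ABC$ if (A) $\sum_n\mu_n/|\lambda_n|<\infty$; (B) $\sup_n|\arg\lambda_n|<\pi/2$; (C) $\Lambda$ is an interpolating variety for $A^0_{|z|}$. The exponential system is $E_\Lambda=\{x^ke^{\lambda_n x}: n\in\mathbb{N},\ k=0,1,\dots,\mu_n-1\}$. $L^p(\gamma,\beta)$ is the usual Lebesgue space of complex-valued functions on $(\gamma,\beta)$.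
   Formalization: The constant u_ε may depend on γ and β separately, not only on β−γ: if some μ_n≥2 then e^{λx}−γ^{-1}x e^{λx} shows D_{γ,γ+1,p,n,0}→0 relative to e^{(β−ε)Re λ_n} as γ→∞; for simple λ_n the stronger dependence follows by translation. *)

(* Defs.v *)
From HB Require Import structures.
From mathcomp Require Import all_boot all_order all_algebra.
From mathcomp Require Import all_classical all_reals all_analysis.
From mathcomp Require Import complex.
Set Implicit Arguments. Unset Strict Implicit. Unset Printing Implicit Defensive.
Import Order.TTheory GRing.Theory Num.Theory.
Import numFieldNormedType.Exports.
Local Open Scope classical_set_scope.
Local Open Scope ring_scope.
Local Open Scope complex_scope.

Section Defs.
Variable R : realType.
Local Notation C := R[i].
Local Notation normc := (@Normc.normc R).

Definition cexp (z : C) : C :=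
  Complex (expR (complex.Re z) * cos (complex.Im z))
          (expR (complex.Re z) * sin (complex.Im z)).

Definition carg (z : C) : R :=
  let a := complex.Re z in let b := complex.Im z in
  if 0 < a then atan (b / a)
  else if a < 0 then (if 0 <= b then atan (b / a) + pi else atan (b / a) - pi)
  else if 0 < b then pi / 2 else if b < 0 then - (pi / 2) else 0.

(* multiplicity sequence (indexed from 0) *)
Definition multiplicity_seq (lam : nat -> C) (mu : nat -> nat) : Prop :=
  injective lam /\ (forall n, lam n != 0) /\
  ((fun n => normc (lam n)) @ \oo --> +oo) /\
  (forall n, normc (lam n) <= normc (lam n.+1)) /\
  (forall n, (0 < mu n)%N).

Definition entire (f : C -> C) : Prop := forall z : C, @derivable C C^o C^o f z 1.

Definition exp_type_zero (f : C -> C) : Prop :=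
  forall eps : R, 0 < eps -> exists M : R,
    forall z : C, normc (f z) <= M * expR (eps * normc z).

Definition A0 (f : C -> C) : Prop := entire f /\ exp_type_zero f.

Definition cderiv (k : nat) (f : C -> C) : C -> C := iter k (fun g => @derive1 C C^o g) f.

Definition interpolating_variety (lam : nat -> C) (mu : nat -> nat) : Prop :=
  forall a : nat -> nat -> C,
    (forall eps : R, 0 < eps -> exists M : R, forall n,
        \sum_(k < mu n) normc (a n k) * expR (- (eps * normc (lam n))) <= M) ->
    exists f : C -> C, A0 f /\
      forall n k, (k < mu n)%N -> cderiv k f (lam n) / (k`!)%:R = a n k.

Definition class_ABC (lam : nat -> C) (mu : nat -> nat) : Prop :=
  cvgn (series (fun n => (mu n)%:R / normc (lam n))) /\
  sup [set `|carg (lam n)| | n in [set: nat]] < pi / 2 /\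
  interpolating_variety lam mu.

Definition expo (lam : nat -> C) (n k : nat) (x : R) : C :=
  (x%:C) ^+ k * cexp (lam n * x%:C).

Definition Lpnorm (gam bet p : R) (f : R -> C) : \bar R :=
  ((\int[lebesgue_measure]_(x in `]gam, bet[) ((normc (f x)) `^ p)%:E) `^ p^-1)%E.

Definition inLp (gam bet p : R) (f : R -> C) : Prop :=
  measurable_fun `]gam, bet[ (fun x => complex.Re (f x)) /\
  measurable_fun `]gam, bet[ (fun x => complex.Im (f x)) /\
  (Lpnorm gam bet p f < +oo)%E.

Definition span_minus (lam : nat -> C) (mu : nat -> nat) (n k : nat) : set (R -> C) :=
  [set h | exists (N : nat) (c : nat -> nat -> C),
     h = fun x => \sum_(m < N) \sum_(j < mu m | ((m : nat), (j : nat)) != (n, k))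
                    c m j * expo lam m j x].

Definition closed_span_minus (lam : nat -> C) (mu : nat -> nat) (gam bet p : R)
  (n k : nat) : set (R -> C) :=
  [set g | inLp gam bet p g /\
     forall d : R, 0 < d -> exists h, span_minus lam mu n k h /\
       (Lpnorm gam bet p (fun x => (g x - h x)%R) < d%:E)%E].

Definition Ddist (lam : nat -> C) (mu : nat -> nat) (gam bet p : R) (n k : nat) : \bar R :=
  ereal_inf [set Lpnorm gam bet p (fun x => expo lam n k x - g x)
            | g in closed_span_minus lam mu gam bet p n k].

End Defs.

(* Main.v *)
Require Import Defs.
From HB Require Import structures.
From mathcomp Require Import all_boot all_order all_algebra.
From mathcomp Require Import all_classical all_reals all_analysis.
From mathcomp Require Import measurable_realfun.
From mathcomp Require Import complex.
From mathcomp Require Import ring lra zify.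
Import Order.TTheory GRing.Theory Num.Theory.
Import numFieldNormedType.Exports.
Set Implicit Arguments.
Unset Strict Implicit.
Unset Printing Implicit Defensive.
Local Open Scope classical_set_scope.
Local Open Scope ring_scope.
Local Open Scope complex_scope.
Local Notation Re := complex.Re.
Local Notation Im := complex.Im.

(** The distance is bounded below by testing exponential polynomials P = sum c_{m,j} x^j e^{lam_m x}
    on a short window near the right end of the interval: it suffices that
    |c_{n,k}| <= C e^{eps |lam_n|} e^{- x1 Re lam_n} times the integral of |P| over [x1, x1 + w],
    because the L^1 norm is controlled by the L^p norm uniformly in p.

    Condition (C) enters once. Applied to a 0/1 datum supported on a sparse set of nodes and combined
    with the maximum principle, it shows that the product over m <> n of
    max(1, |lam_n| / (4 |lam_n - lam_m|)) ^ mu_m is at most C e^{eps |lam_n|}. The complex analysis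
    needed (primitives by Goursat's bisection, mean values, division by zeros) is obtained from
    H(w + 2 pi i) - H(w) for a primitive H of f(c + e^w), without path integrals.

    On a grid of step delta, x^j e^{lam_m x} becomes s^j X_m^s with X_m = e^{delta lam_m}, and a
    polynomial A vanishing to order mu_m at every X_m, m <> n, gives a linear functional of the
    samples that sees only the n-th block. Such an A is a product of quadratic killers
    (X - X_m)(X - 1/X_m) and of box averages, whose decay on the unit circle absorbs the growth of
    the killers since sum mu_m / |lam_m| converges; the discrete Fourier transform bounds its
    coefficients. The sector condition keeps X_m away from the unit circle, so that A can be inverted
    modulo (X - X_n)^mu_n with a bound that does not depend on delta, and Newton interpolation
    recovers the coefficient c_{n,k}. Finally delta -> 0. *)

(** * Complex derivatives and entire functions *)

(** Every bound must be independent of [N], because the span contains exponential polynomials of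
    arbitrary length; a loss of e^{eps |lam_n|} is harmless, since the sector condition turns it
    into e^{eps' Re lam_n}. The polynomial A acts as the discrete Laplace transform of a density
    orthogonal to all blocks but the n-th; its degree times delta is the length of the support and
    has to stay below the window length w. A killer pairs the root X_m with 1/X_m because the
    normalised product has modulus at most 1 + |x-1|^2/|kap| on the circle, an excess of second
    order at x = 1, and a squared box decays to the same order: once c0 eta_m |lam_m| >= 3, where
    eta_m is the half-width of the box, a killer times its squared box is bounded by 1, so the tail
    of the product costs nothing. A single root would in general give a first-order excess, which
    boxes cannot compensate near x = 1. The widths in the tail add up to a multiple of the tail of
    sum mu_m / |lam_m|, hence to as little as desired. One more squared box makes the coefficients
    of A of size delta, the weight of a Riemann sum. *)

Section ComplexNorm.
Variable R : realType.
Implicit Types (x : R) (z w : R[i]).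
Local Notation nc := (@Normc.normc R).

Lemma eq_ler (x y : R) : x = y -> x <= y.
Proof. by move->. Qed.

Lemma ncE z : nc z = Num.sqrt (Re z ^+ 2 + Im z ^+ 2).
Proof. by case: z. Qed.

Lemma nc_ge0 z : 0 <= nc z.
Proof. by rewrite ncE sqrtr_ge0. Qed.

Lemma nc0 : nc 0 = 0.
Proof. exact: Normc.normc0. Qed.

Lemma nc1 : nc 1 = 1.
Proof. exact: Normc.normc1. Qed.

Lemma nc_eq0 z : (nc z == 0) = (z == 0).
Proof. by apply/eqP/eqP => [/Normc.eq0_normc //|->]; rewrite nc0. Qed.

Lemma nc_gt0 z : (0 < nc z) = (z != 0).
Proof. by rewrite lt_neqAle nc_ge0 andbT eq_sym nc_eq0. Qed.

Lemma ncM z w : nc (z * w) = nc z * nc w.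
Proof. exact: Normc.normcM. Qed.

Lemma ncV z : nc z^-1 = (nc z)^-1.
Proof. exact: Normc.normcV. Qed.

Lemma ncN z : nc (- z) = nc z.
Proof. by case: z => a b /=; rewrite !sqrrN. Qed.

Lemma ncB z w : nc (z - w) = nc (w - z).
Proof. by rewrite -ncN opprB. Qed.

Lemma ler_ncD z w : nc (z + w) <= nc z + nc w.
Proof. exact: (@le_normcD R z w). Qed.

Lemma ler_ncB z w : nc (z - w) <= nc z + nc w.
Proof. by rewrite -(ncN w) ler_ncD. Qed.

Lemma ler_ncD3 z w v : nc (z - v) <= nc (z - w) + nc (w - v).
Proof. by apply: le_trans (ler_ncD _ _); rewrite addrA subrK. Qed.

Lemma lerB_nc z w : nc z - nc w <= nc (z - w).
Proof. by rewrite lerBlDr -{1}(subrK w z) ler_ncD. Qed.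

Lemma ncX z k : nc (z ^+ k) = nc z ^+ k.
Proof. by elim: k => [|k IH]; rewrite ?expr0 ?nc1 // !exprS ncM IH. Qed.

Lemma ncR x : nc x%:C = `|x|.
Proof. by rewrite ncE /= expr0n /= addr0 sqrtr_sqr. Qed.

Lemma nc_nat k : nc k%:R = k%:R.
Proof. by rewrite -(rmorph_nat (real_complex R)) ncR ger0_norm. Qed.

Lemma nc_sum (I : Type) (r : seq I) (P : pred I) (F : I -> R[i]) :
  nc (\sum_(i <- r | P i) F i) <= \sum_(i <- r | P i) nc (F i).
Proof.
elim/big_rec2 : _ => [|i y1 y2 _ IH]; first by rewrite nc0.
by apply: le_trans (ler_ncD _ _) _; rewrite lerD2l.
Qed.

Lemma nc_prod (I : Type) (r : seq I) (P : pred I) (F : I -> R[i]) :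
  nc (\prod_(i <- r | P i) F i) = \prod_(i <- r | P i) nc (F i).
Proof. by elim/big_rec2 : _ => [|i y1 y2 _ <-]; rewrite ?nc1 // ncM. Qed.

Lemma ler_Re_nc z : `|Re z| <= nc z.
Proof.
by rewrite ncE -sqrtr_sqr ler_sqrt ?addr_ge0 ?sqr_ge0 // lerDl sqr_ge0.
Qed.

Lemma ler_Im_nc z : `|Im z| <= nc z.
Proof.
by rewrite ncE -sqrtr_sqr ler_sqrt ?addr_ge0 ?sqr_ge0 // lerDr sqr_ge0.
Qed.

Lemma nc_le_ReIm z : nc z <= `|Re z| + `|Im z|.
Proof.
rewrite ncE -[leRHS]ger0_norm ?addr_ge0 // -sqrtr_sqr ler_sqrt ?sqr_ge0 //.
rewrite sqrrD !real_normK ?num_real // [leRHS]addrAC lerDl.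
by rewrite mulrn_wge0 // mulr_ge0.
Qed.

Lemma ReD z w : Re (z + w) = Re z + Re w.
Proof. by case: z; case: w. Qed.
Lemma ImD z w : Im (z + w) = Im z + Im w.
Proof. by case: z; case: w. Qed.
Lemma ReN z : Re (- z) = - Re z.
Proof. by case: z. Qed.
Lemma ImN z : Im (- z) = - Im z.
Proof. by case: z. Qed.
Lemma ReM z w : Re (z * w) =
  Re z * Re w - Im z * Im w.
Proof. by case: z; case: w. Qed.
Lemma ImM z w : Im (z * w) =
  Re z * Im w + Im z * Re w.
Proof. by case: z; case: w. Qed.
Lemma eqC z w : Re z = Re w -> Im z = Im w -> z = w.
Proof. by case: z; case: w => a b c d /= -> ->. Qed.

Lemma CnormE z : `|z| = (nc z)%:C.
Proof. by rewrite normc_def ncE. Qed.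

End ComplexNorm.

Section ComplexDerivative.
Variable R : realType.
Implicit Types (z w l : R[i]) (f g : R[i] -> R[i]).
Local Notation nc := (@Normc.normc R).

(** A remainder bound with a real [e] that is non-strict holds at h = 0 too, so no punctured
    neighbourhood appears, and only the real modulus [nc] occurs instead of the complex-valued
    norm. *)
Definition cdiff f z l := forall e : R, 0 < e -> exists2 d : R, 0 < d &
  forall h, nc h < d -> nc (f (z + h) - f z - l * h) <= e * nc h.

Lemma cdiff_cvgP f z l : cdiff f z l <->
  (h^-1 *: (f (h + z) - f z) : R[i]^o) @[h --> (0 : (R[i] : numFieldType))^'] --> (l : R[i]^o).
Proof.
split=> [H|/(@cvgrPdist_le _ _ _ _ _) H].
  apply/(@cvgrPdist_le _ R[i]^o) => eps eps0.
  have re : eps = (Re eps)%:C.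
    by rewrite RRe_real // ger0_real // ltW.
  have r0 : 0 < Re eps by move: eps0; rewrite re ltcR.
  have [d d0 Hd] := H _ r0.
  apply/nbhs_ballP; exists d%:C => /=; first by rewrite ltcR.
  move=> h; rewrite /ball /= sub0r normrN CnormE ltcR => hd hn0.
  rewrite CnormE re lecR.
  have nh : 0 < nc h by rewrite nc_gt0.
  suff : nc (l - h^-1 * (f (h + z) - f z)) <= Re eps by [].
  rewrite -(ler_pM2r nh) -ncM -ncN; apply: le_trans (Hd _ hd).
  by rewrite (_ : - _ = f (z + h) - f z - l * h) // [z + h]addrC; field.
move=> e e0; have e0' : 0 < e%:C :> R[i] by rewrite ltcR.
have /nbhs_ballP[d /= d0 Hd] := H _ e0'.
have rd : d = (Re d)%:C by rewrite RRe_real // ger0_real // ltW.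
exists (Re d); first by move: d0; rewrite rd ltcR.
move=> h hd; have [->|hn0] := eqVneq h 0.
  by rewrite addr0 mulr0 subr0 subrr nc0 mulr0.
have := Hd h; rewrite /ball /= sub0r normrN CnormE [in X in _ < X]rd ltcR.
move=> /(_ hd hn0); rewrite CnormE lecR.
have nh : 0 < nc h by rewrite nc_gt0.
move=> Hh; have {Hh} : nc (l - h^-1 * (f (h + z) - f z)) <= e by [].
rewrite -(ler_pM2r nh) -ncM -ncN; apply: le_trans.
by rewrite (_ : - ((l - _) * h) = f (z + h) - f z - l * h) // [z + h]addrC; field.
Qed.

Lemma cdiff_is_deriveP f z l : cdiff f z l <->
  @is_derive R[i] R[i]^o R[i]^o z 1 f l.
Proof.
have E : (fun h : R[i] => h^-1 *: (f (h + z) - f z) : R[i]^o) =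
   (fun h : R[i] => h^-1 *: ((f \o shift z) (h *: (1 : R[i]^o)) - f z) : R[i]^o).
  by apply/funext => h /=; rewrite [h *: _]mulr1.
split=> [/cdiff_cvgP H|[H <-]].
  rewrite E in H; apply: DeriveDef; last exact: cvg_lim.
  by apply/cvg_ex; exists l.
by apply/cdiff_cvgP; rewrite E; exact: H.
Qed.

Lemma cdiff_derive1 f z l : cdiff f z l -> @derive1 R[i] R[i]^o f z = l.
Proof. by move=> /cdiff_cvgP; exact: cvg_lim. Qed.

Lemma derivable_cdiff f z : @derivable R[i] R[i]^o R[i]^o f z 1 ->
  cdiff f z (@derive1 R[i] R[i]^o f z).
Proof. by move=> H; apply/cdiff_is_deriveP; rewrite derive1E; exact: DeriveDef. Qed.

End ComplexDerivative.

(** * Complex-valued functions of a real variable and the mean value inequality *)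

Section RealVariable.
Variable R : realType.
Local Notation nc := (@Normc.normc R).

Definition rdiff (V : R -> R[i]) (x : R) (l : R[i]) :=
  forall e : R, 0 < e -> exists2 d : R, 0 < d &
  forall h : R, `|h| < d -> nc (V (x + h) - V x - l * h%:C) <= e * `|h|.

Definition rcont (V : R -> R[i]) (x : R) :=
  forall e : R, 0 < e -> exists2 d : R, 0 < d &
  forall h : R, `|h| < d -> nc (V (x + h) - V x) <= e.

Lemma real_diffP (f : R -> R) (x l : R) :
  (forall e : R, 0 < e -> exists2 d : R, 0 < d &
    forall h : R, `|h| < d -> `|f (x + h) - f x - l * h| <= e * `|h|) <->
  derivable f x 1 /\ derive1 f x = l.
Proof.
split=> [H|[df <-]].
  suff H' : h^-1 *: (f (h + x) - f x) @[h --> (0:R)^'] --> l.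
    split; last exact: cvg_lim H'.
    rewrite /derivable; apply/cvg_ex; exists l.
    rewrite (_ : (fun h : R => _) = (fun h => h^-1 *: (f (h + x) - f x))) //.
    by apply/funext => h /=; rewrite [h *: _]mulr1.
  apply/cvgrPdist_le => e e0; have [d d0 Hd] := H _ e0.
  apply/nbhs_ballP; exists d => //= h; rewrite /ball /= sub0r normrN => hd hn0.
  have nh : 0 < `|h| by rewrite normr_gt0.
  suff : `|l - h^-1 * (f (h + x) - f x)| <= e by [].
  rewrite -(ler_pM2r nh) -normrM -normrN; apply: le_trans (Hd _ hd).
  by rewrite (_ : - ((l - _) * h) = f (x + h) - f x - l * h) // [x + h]addrC; field.
move=> e e0; have : h^-1 *: (f (h + x) - f x) @[h --> (0:R)^'] --> derive1 f x.
  move: df; rewrite /derivable /derive1.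
  rewrite (_ : (fun h : R => _) = (fun h => h^-1 *: (f (h + x) - f x))) //.
  by apply/funext => h /=; rewrite [h *: _]mulr1.
move=> /cvgrPdist_le /(_ _ e0) /nbhs_ballP[d /= d0 Hd].
exists d => // h hd; have [->|hn0] := eqVneq h 0.
  by rewrite addr0 mulr0 subr0 subrr normr0 mulr0.
have := Hd h; rewrite /ball /= sub0r normrN => /(_ hd hn0).
have nh : 0 < `|h| by rewrite normr_gt0.
move=> Hh; have {Hh} : `|derive1 f x - h^-1 * (f (h + x) - f x)| <= e by [].
rewrite -(ler_pM2r nh) -normrM -normrN; apply: le_trans.
by rewrite (_ : - ((derive1 f x - _) * h) = f (x + h) - f x - derive1 f x * h) //
  [x + h]addrC; field.
Qed.

Lemma rdiff_is_derive V x l (a b : R) : rdiff V x l ->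
  is_derive x (1 : R) (fun t => a * Re (V t) + b * Im (V t))
    (a * Re l + b * Im l).
Proof.
move=> H.
set g := fun t => _.
have [df <-] : derivable g x 1 /\ derive1 g x = a * Re l + b * Im l.
  apply/real_diffP; rewrite /g.
  move=> e e0; have nab : 0 < 1 + `|a| + `|b|.
    by rewrite -addrA ltr_pwDl // addr_ge0.
  have [d d0 Hd] := H (e / (1 + `|a| + `|b|)) (divr_gt0 e0 nab).
  exists d => // h /Hd; set z := (X in nc X) => hz.
  have -> : (a * Re (V (x + h)) + b * Im (V (x + h))) -
    (a * Re (V x) + b * Im (V x)) -
    (a * Re l + b * Im l) * h = a * Re z + b * Im z.
    rewrite /z !ReD !ImD !ReN !ImN ReM ImM /=; ring.
  apply: le_trans (ler_normD _ _) _; rewrite !normrM.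
  have -> : e * `|h| = (1 + `|a| + `|b|) * (e / (1 + `|a| + `|b|) * `|h|).
    by field; rewrite lt0r_neq0.
  apply: le_trans (ler_wpM2l (ltW nab) hz).
  have := nc_ge0 z; rewrite !mulrDl mul1r => z0.
  rewrite -addrA -[leLHS]add0r lerD // lerD // ler_wpM2l //.
    exact: ler_Re_nc.
  exact: ler_Im_nc.
by split => //; rewrite derive1E.
Qed.

(** With D = V b - V a, the real mean value theorem is applied to Re (conj D * V t): its increment
    is |D|^2 and its derivative is at most |D| |v|. *)
Lemma mean_value_ineq V (v : R -> R[i]) (a b M : R) : a <= b ->
  (forall x, a <= x <= b -> rdiff V x (v x)) ->
  (forall x, a <= x <= b -> nc (v x) <= M) ->
  nc (V b - V a) <= M * (b - a).
Proof.
move=> ab dV vM; set D := V b - V a.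
have M0 : 0 <= M by apply: le_trans (nc_ge0 (v a)) (vM _ _); rewrite lexx.
have [D0|D0] := eqVneq D 0; first by rewrite D0 nc0 mulr_ge0 // subr_ge0.
pose phi t := Re D * Re (V t) + Im D * Im (V t).
pose dphi t := Re D * Re (v t) + Im D * Im (v t).
have dphiE x : a <= x <= b -> is_derive x (1 : R) phi (dphi x).
  by move=> /dV; exact: rdiff_is_derive.
have [||c] := @MVT_segment R phi dphi a b ab.
- by move=> x; rewrite in_itv /= => /andP[ax xb]; apply: dphiE; rewrite !ltW.
- apply: derivable_within_continuous => x; rewrite in_itv /= => /dphiE [].
  by [].
rewrite in_itv /= => /[dup] cab /vM Mc Ec.
have ncD2 : nc D ^+ 2 = Re D ^+ 2 + Im D ^+ 2.
  by rewrite ncE sqr_sqrtr // addr_ge0 ?sqr_ge0.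
have E1 : nc D ^+ 2 = phi b - phi a.
  by rewrite ncD2 /phi {2 4}/D !ReD !ImD !ReN !ImN; ring.
have CS : dphi c <= nc D * nc (v c).
  apply: le_trans (ler_norm _) _.
  have -> : dphi c = Re (D^* * v c) by rewrite /dphi; case: (D) (v c) => [p q] [r s] /=; ring.
  apply: le_trans (ler_Re_nc _) _; rewrite ncM.
  by case: (D) => p q /=; rewrite sqrrN.
have nD : 0 < nc D by rewrite nc_gt0.
rewrite -(ler_pM2l nD) -expr2 E1 Ec mulrA ler_wpM2r ?subr_ge0 //.
by apply: le_trans CS _; rewrite ler_wpM2l // ltW.
Qed.

End RealVariable.

(** * Primitives on the real line *)

Section Primitive.
Variable R : realType.
Local Notation nc := (@Normc.normc R).
Local Notation mu := (@lebesgue_measure R).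

Lemma eq_of_same_derive (f g : R -> R) (a b : R) : a <= b ->
  (forall x, a <= x <= b -> derivable f x 1 /\ derivable g x 1 /\ derive1 f x = derive1 g x) ->
  f b - f a = g b - g a.
Proof.
move=> ab H.
have Hd x : a <= x <= b -> is_derive x (1 : R) (fun t => f t - g t) 0.
  move=> /H[df [dg e]]; have -> : 0 = derive1 f x - derive1 g x by rewrite e subrr.
  by rewrite !derive1E; apply: is_deriveB; exact: DeriveDef.
have [||c _] := @MVT_segment R (fun t => f t - g t) (fun=> 0) a b ab.
- by move=> x; rewrite in_itv /= => /andP[ax xb]; apply: Hd; rewrite !ltW.
- by apply: derivable_within_continuous => x; rewrite in_itv /= => /Hd [].
by rewrite mul0r => e; apply/eqP; rewrite -subr_eq0 -e; apply/eqP; ring.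
Qed.

(** The integral from -M is a primitive to the right of -M. Normalised to vanish at 0, these
    primitives agree on their common domains, so M may vary with the point: M = |x| + 1 at x. *)
Lemma real_primitive (u : R -> R) : continuous u ->
  exists U : R -> R, forall x, derivable U x 1 /\ derive1 U x = u x.
Proof.
move=> cu.
pose F (M x : R) := (\int[mu]_(t in `[(- M)%R, x]) u t)%R.
have dF M x : - M < x -> derivable (F M) x 1 /\ derive1 (F M) x = u x.
  move=> Mx; apply: (@continuous_FTC1_closed _ u (- M) x (x + 1)) => //.
  - by rewrite ltrDl.
  - apply: continuous_compact_integrable; first exact: segment_compact.
    exact: continuous_subspaceT.
  - exact: cu.
clearbody F; pose G M x := F M x - F M 0.
have dG M x : - M < x -> derivable (G M) x 1 /\ derive1 (G M) x = u x.
  move=> /dF /real_diffP H; apply/real_diffP => e /H[d d0 Hd].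
  exists d => // h /Hd; rewrite /G.
  by rewrite (_ : F M (x + h) - F M 0 - (F M x - F M 0) = F M (x + h) - F M x) //; ring.
have GE M M' x : 0 < M -> 0 < M' -> - M < x -> - M' < x -> G M x = G M' x.
  move=> M0 M'0 Mx M'x.
  have E (a b : R) : a <= b -> - M < a -> - M' < a -> G M b - G M a = G M' b - G M' a.
    move=> ab Ma M'a; apply: eq_of_same_derive => // t /andP[at_ tb].
    have [d1 d2] := dG M t (lt_le_trans Ma at_).
    have [d3 d4] := dG M' t (lt_le_trans M'a at_).
    by rewrite d2 d4.
  have G0 L : G L 0 = 0 by rewrite /G subrr.
  have [x0|x0] := leP 0 x.
    by have := E 0 x x0; rewrite !oppr_lt0 !G0 !subr0; apply.
  by have := E x 0 (ltW x0) Mx M'x; rewrite !G0 !sub0r => /oppr_inj.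
exists (fun x => G (`|x| + 1) x) => x; apply/real_diffP => e e0.
have xM : - (`|x| + 2) < x by have := ler_norm (- x); rewrite normrN; lra.
have /real_diffP /(_ e e0) [d d0 Hd] := dG _ _ xM.
exists (Num.min d 1) => [|h]; first by rewrite lt_min d0 ltr01.
rewrite lt_min => /andP[hd h1].
have p1 : 0 < `|x| + 2 by rewrite ltr_wpDl.
have p2 : 0 < `|x| + 1 by rewrite ltr_wpDl.
have p3 : 0 < `|x + h| + 1 by rewrite ltr_wpDl.
have nx := ler_norm (- x); have nxh := ler_norm (- (x + h)).
rewrite !normrN in nx nxh; move: (h1); rewrite ltr_norml => /andP[h1' _].
have q2 : - (`|x| + 1) < x by lra.
have q3 : - (`|x + h| + 1) < x + h by lra.
have q4 : - (`|x| + 2) < x + h by lra.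
by rewrite -(GE _ _ _ p1 p3 q4 q3) -(GE _ _ _ p1 p2 xM q2); exact: Hd.
Qed.

Lemma rcont_Re V x : rcont V x -> {for x, continuous (fun t => Re (V t) : R)}.
Proof.
move=> H; apply/cvgrPdist_le => e e0; have [d d0 Hd] := H _ e0.
apply/nbhs_ballP; exists d => //= y; rewrite /ball /= distrC => /Hd.
rewrite (addrC x) subrK; apply: le_trans.
by apply: le_trans (ler_Re_nc _); rewrite ReD ReN distrC.
Qed.

Lemma rcont_Im V x : rcont V x -> {for x, continuous (fun t => Im (V t) : R)}.
Proof.
move=> H; apply/cvgrPdist_le => e e0; have [d d0 Hd] := H _ e0.
apply/nbhs_ballP; exists d => //= y; rewrite /ball /= distrC => /Hd.
rewrite (addrC x) subrK; apply: le_trans.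
by apply: le_trans (ler_Im_nc _); rewrite ImD ImN distrC.
Qed.

Lemma complex_primitive (v : R -> R[i]) : (forall x, rcont v x) ->
  exists V : R -> R[i], forall x, rdiff V x (v x).
Proof.
move=> cv.
have [A HA] := @real_primitive (fun t => Re (v t)) (fun x => rcont_Re (cv x)).
have [B HB] := @real_primitive (fun t => Im (v t)) (fun x => rcont_Im (cv x)).
exists (fun x => A x +i* B x) => x e e0; have e2 : 0 < e / 2 by rewrite divr_gt0.
have /real_diffP /(_ _ e2) [d1 d10 H1] := HA x.
have /real_diffP /(_ _ e2) [d2 d20 H2] := HB x.
exists (Num.min d1 d2) => [|h]; first by rewrite lt_min d10.
rewrite lt_min => /andP[/H1 h1 /H2 h2].
apply: le_trans (nc_le_ReIm _) _; rewrite !ReD !ImD !ReN !ImN ReM ImM /=.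
rewrite mulr0 subr0 mulr0 add0r.
by apply: le_trans (lerD h1 h2) _; rewrite -mulrDl -splitr.
Qed.

End Primitive.

(** * Bisection of rectangles *)

Section Bisection.
Variable R : realType.
Local Notation nc := (@Normc.normc R).

Lemma nested_segments (a b : nat -> R) : (forall n, a n <= a n.+1) ->
  (forall n, b n.+1 <= b n) -> (forall n, a n <= b n) ->
  exists c, forall n, a n <= c <= b n.
Proof.
move=> ia db ab.
have am n k : a n <= a (n + k)%N.
  by elim: k => [|k IH]; rewrite ?addn0 // addnS (le_trans IH).
have bm n k : b (n + k)%N <= b n.
  by elim: k => [|k IH]; rewrite ?addn0 // addnS (le_trans _ IH).
have abnk n k : a n <= b k.
  apply: le_trans (am n k) _; apply: le_trans (ab _) _.
  by rewrite addnC bm.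
have ub k : ubound (range a) (b k) by move=> _ [n _ <-].
exists (sup (range a)) => n; apply/andP; split.
  by apply: ub_le_sup; [exists (b 0%N); exact: ub | exists n].
by apply: ge_sup; [exists (a 0%N), 0%N | exact: ub].
Qed.

(* Goursat's argument, for an additive function of rectangles. *)
Lemma rectangle_bisection (J : R -> R -> R -> R -> R[i]) :
  (forall x1 x2 x3 y1 y2, J x1 x3 y1 y2 = J x1 x2 y1 y2 + J x2 x3 y1 y2) ->
  (forall x1 x2 y1 y2 y3, J x1 x2 y1 y3 = J x1 x2 y1 y2 + J x1 x2 y2 y3) ->
  (forall a b e : R, 0 < e -> exists2 d : R, 0 < d & forall x1 x2 y1 y2 : R,
     x1 <= a <= x2 -> y1 <= b <= y2 -> x2 - x1 < d -> y2 - y1 < d ->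
     nc (J x1 x2 y1 y2) <= e * (x2 - x1 + (y2 - y1)) ^+ 2) ->
  forall x1 x2 y1 y2, J x1 x2 y1 y2 = 0.
Proof.
move=> Jx Jy Jloc.
(* Additivity makes J vanish on degenerate rectangles and change sign when two endpoints are
   exchanged, so ordered endpoints suffice. *)
suff H x1 x2 y1 y2 : x1 <= x2 -> y1 <= y2 -> J x1 x2 y1 y2 = 0.
  have Jx0 x y1 y2 : J x x y1 y2 = 0.
    by apply: (addrI (J x x y1 y2)); rewrite -Jx addr0.
  have Jy0 x1 x2 y : J x1 x2 y y = 0.
    by apply: (addrI (J x1 x2 y y)); rewrite -Jy addr0.
  have JxN x1 x2 y1 y2 : J x2 x1 y1 y2 = - J x1 x2 y1 y2.
    by apply/eqP; rewrite eq_sym eqr_oppLR -addr_eq0 -Jx Jx0.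
  have JyN x1 x2 y1 y2 : J x1 x2 y2 y1 = - J x1 x2 y1 y2.
    by apply/eqP; rewrite eq_sym eqr_oppLR -addr_eq0 -Jy Jy0.
  move=> x1 x2 y1 y2; have [x12|/ltW x21] := leP x1 x2; have [y12|/ltW y21] := leP y1 y2.
  - exact: H.
  - by rewrite JyN H // oppr0.
  - by rewrite JxN H // oppr0.
  - by rewrite JxN JyN H // oppr0 oppr0.
move=> x12 y12.
pose T := ((R * R) * (R * R))%type.
pose NJ (r : T) := nc (J r.1.1 r.1.2 r.2.1 r.2.2).
pose half (r s : R * R) := s = (r.1, (r.1 + r.2) / 2) \/ s = ((r.1 + r.2) / 2, r.2).
(* One of the four quarters carries at least a quarter of the modulus. *)
have step (r : T) : exists s : T, half r.1 s.1 /\ half r.2 s.2 /\ NJ r / 4 <= NJ s.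
  apply: contrapT => /forallNP N.
  case: r N => [[a b] [c d]] N.
  set m := (a + b) / 2; set k := (c + d) / 2.
  have n1 : NJ ((a, m), (c, k)) < NJ ((a, b), (c, d)) / 4.
    by rewrite ltNge; apply/negP => n1; apply: (N ((a, m), (c, k))); rewrite /half /=; auto.
  have n2 : NJ ((a, m), (k, d)) < NJ ((a, b), (c, d)) / 4.
    by rewrite ltNge; apply/negP => n2; apply: (N ((a, m), (k, d))); rewrite /half /=; auto.
  have n3 : NJ ((m, b), (c, k)) < NJ ((a, b), (c, d)) / 4.
    by rewrite ltNge; apply/negP => n3; apply: (N ((m, b), (c, k))); rewrite /half /=; auto.
  have n4 : NJ ((m, b), (k, d)) < NJ ((a, b), (c, d)) / 4.
    by rewrite ltNge; apply/negP => n4; apply: (N ((m, b), (k, d))); rewrite /half /=; auto.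
  have : NJ ((a, b), (c, d)) <= NJ ((a, m), (c, k)) + NJ ((a, m), (k, d)) +
      (NJ ((m, b), (c, k)) + NJ ((m, b), (k, d))).
    rewrite /NJ /= (Jx a m b c d) (Jy a m c k d) (Jy m b c k d).
    by apply: le_trans (ler_ncD _ _) _; apply: lerD; exact: ler_ncD.
  by lra.
have [nx Hnx] := choice step.
pose r n := iter n nx ((x1, x2), (y1, y2)).
have rS n : r n.+1 = nx (r n) by [].
have hle (p q : R * R) : half p q -> p.1 <= p.2 ->
    [/\ p.1 <= q.1, q.2 <= p.2, q.1 <= q.2 & q.2 - q.1 = (p.2 - p.1) / 2].
  by move=> [] -> /= ?; split; lra.
have rle n : (r n).1.1 <= (r n).1.2 /\ (r n).2.1 <= (r n).2.2.
  elim: n => [|n [IH1 IH2]]; first by [].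
  have [h1 [h2 _]] := Hnx (r n); rewrite rS.
  by have [_ _ ? _] := hle _ _ h1 IH1; have [_ _ ? _] := hle _ _ h2 IH2.
have mon n : [/\ (r n).1.1 <= (r n.+1).1.1, (r n.+1).1.2 <= (r n).1.2,
     (r n).2.1 <= (r n.+1).2.1 & (r n.+1).2.2 <= (r n).2.2].
  have [h1 [h2 _]] := Hnx (r n); rewrite rS; have [r1 r2] := rle n.
  by have [? ? _ _] := hle _ _ h1 r1; have [? ? _ _] := hle _ _ h2 r2.
have len n : (r n).1.2 - (r n).1.1 = (x2 - x1) / 2 ^+ n /\
             (r n).2.2 - (r n).2.1 = (y2 - y1) / 2 ^+ n.
  elim: n => [|n [IH1 IH2]]; first by rewrite expr0 !divr1.
  have [h1 [h2 _]] := Hnx (r n); rewrite rS; have [r1 r2] := rle n.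
  have [_ _ _ ->] := hle _ _ h1 r1; have [_ _ _ ->] := hle _ _ h2 r2.
  have n2 : (2 : R) ^+ n != 0 by rewrite expf_neq0.
  by rewrite IH1 IH2 exprS; split; field.
have big n : NJ (r 0%N) / 4 ^+ n <= NJ (r n).
  elim: n => [|n IH]; first by rewrite expr0 divr1.
  have [_ [_]] := Hnx (r n); rewrite -rS; apply: le_trans.
  by rewrite exprSr invfM mulrA ler_wpM2r // invr_ge0.
have [a Ha] : exists a, forall n, (r n).1.1 <= a <= (r n).1.2.
  by apply: nested_segments => n; [case: (mon n) | case: (mon n) | case: (rle n)].
have [b Hb] : exists b, forall n, (r n).2.1 <= b <= (r n).2.2.
  by apply: nested_segments => n; [case: (mon n) | case: (mon n) | case: (rle n)].
apply/eqP; rewrite -nc_eq0 eq_le nc_ge0 andbT leNgt; apply/negP => c0.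
set c := nc _ in c0.
set S := x2 - x1 + (y2 - y1).
have S0 : 0 <= S by rewrite /S; lra.
(* With this e the n-th rectangle gives c / 4^n <= e S^2 / 4^n, which is absurd because e S^2 <= c /
   2. *)
have e0 : 0 < c / (2 * (S ^+ 2 + 1)).
  by rewrite divr_gt0 // mulr_gt0 // ltr_wpDl ?sqr_ge0.
have [d d0 Hd] := Jloc a b _ e0.
have [n Hn] : exists n, S / 2 ^+ n < d.
  have [n _ Hn] : \forall n \near \oo, S / 2 ^+ n < d.
    have : (fun n => S * (2^-1) ^+ n) @ \oo --> S * 0.
      by apply: cvgM; [exact: cvg_cst | apply: cvg_expr; rewrite ger0_norm; lra].
    rewrite mulr0 => /cvgrPdist_lt /(_ _ d0); apply: filterS => n.
    by rewrite sub0r normrN ger0_norm ?exprVn // mulr_ge0 // invr_ge0 exprn_ge0.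
  by exists n; apply: Hn => /=.
have p2 : 0 < (2 : R) ^+ n by rewrite exprn_gt0.
have ip2 : 0 <= ((2 : R) ^+ n)^-1 by rewrite invr_ge0 ltW.
have [l1 l2] := len n.
have := Hd (r n).1.1 (r n).1.2 (r n).2.1 (r n).2.2 (Ha n) (Hb n).
rewrite l1 l2.
have k1 : (x2 - x1) / 2 ^+ n < d by apply: le_lt_trans Hn; rewrite ler_wpM2r // /S; lra.
have k2 : (y2 - y1) / 2 ^+ n < d by apply: le_lt_trans Hn; rewrite ler_wpM2r // /S; lra.
move=> /(_ k1 k2); rewrite -mulrDl -/S => h; have := le_trans (big n) h.
rewrite {1}/NJ /= -/c expr_div_n -exprM mulnC exprM (_ : 2 ^+ 2 = 4 :> R); last by ring.
rewrite mulrA ler_pM2r ?invr_gt0 ?exprn_gt0 //.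
have S1 : 0 < S ^+ 2 + 1 by rewrite ltr_wpDl ?sqr_ge0.
rewrite mulrAC ler_pdivlMr ?mulr_gt0 // => h'.
have : S ^+ 2 * c >= 0 by rewrite mulr_ge0 ?sqr_ge0 // ltW.
by nra.
Qed.

End Bisection.

(** * Rules for complex derivatives *)

Section ComplexCalculus.
Variable R : realType.
Implicit Types (z w l m : R[i]) (f g : R[i] -> R[i]).
Local Notation nc := (@Normc.normc R).

Definition ccont f z := forall e : R, 0 < e -> exists2 d : R, 0 < d &
  forall h, nc h < d -> nc (f (z + h) - f z) <= e.

Lemma cdiff_ext f g z l : f =1 g -> cdiff f z l -> cdiff g z l.
Proof. by move=> /funext ->. Qed.

Lemma cdiff_val f z l m : l = m -> cdiff f z l -> cdiff f z m.
Proof. by move=> ->. Qed.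

Lemma cdiff_cont f z l : cdiff f z l -> ccont f z.
Proof.
move=> H e e0; have [d d0 Hd] := H _ (@ltr01 R).
have nl : 0 < 1 + nc l by rewrite ltr_pwDl // nc_ge0.
exists (Num.min d (e / (1 + nc l))) => [|h]; first by rewrite lt_min d0 divr_gt0.
rewrite lt_min => /andP[/Hd hd he].
rewrite -(subrK (l * h) (_ - _)); apply: le_trans (ler_ncD _ _) _.
rewrite ncM; apply: le_trans (lerD hd (lexx _)) _.
by rewrite -mulrDl mulrC -ler_pdivlMr // ltW.
Qed.

Lemma cdiff_cst c z : cdiff (fun=> c) z 0.
Proof.
by move=> e e0; exists 1 => // h _; rewrite mul0r subrr subr0 nc0 mulr_ge0 ?nc_ge0 // ltW.
Qed.

Lemma cdiff_id z : cdiff id z 1.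
Proof. by apply/cdiff_is_deriveP; exact: is_derive_id. Qed.

Lemma cdiffD f g z l m : cdiff f z l -> cdiff g z m ->
  cdiff (fun w => f w + g w) z (l + m).
Proof.
by move=> /cdiff_is_deriveP Hf /cdiff_is_deriveP Hg; apply/cdiff_is_deriveP; exact: is_deriveD.
Qed.

Lemma cdiffM f g z l m : cdiff f z l -> cdiff g z m ->
  cdiff (fun w => f w * g w) z (l * g z + f z * m).
Proof.
move=> /cdiff_is_deriveP Hf /cdiff_is_deriveP Hg; apply/cdiff_is_deriveP.
by have := is_deriveM Hf Hg; rewrite [_ *: l]mulrC addrC.
Qed.

Lemma cdiff_comp f g z l m : cdiff f (g z) l -> cdiff g z m ->
  cdiff (fun w => f (g w)) z (l * m).
Proof.
move=> Hf Hg e e0.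
set L := nc l; set M := nc m.
have L0 : 0 <= L by exact: nc_ge0.
have M0 : 0 <= M by exact: nc_ge0.
pose e1 := Num.min 1 (e / (2 * (L + 1))).
have e10 : 0 < e1 by rewrite lt_min ltr01 divr_gt0 // mulr_gt0 // ltr_wpDl.
pose e2 := e / (2 * (M + 1)).
have e20 : 0 < e2 by rewrite divr_gt0 // mulr_gt0 // ltr_wpDl.
have [d1 d10 H1] := Hf _ e20; have [d2 d20 H2] := Hg _ e10.
have M1 : 0 < M + 1 by rewrite ltr_wpDl.
exists (Num.min d2 (d1 / (M + 1))) => [|h]; first by rewrite lt_min d20 divr_gt0.
rewrite lt_min => /andP[/H2 h2 hd1].
set k := g (z + h) - g z; have gE : g (z + h) = g z + k by rewrite /k [RHS]addrC subrK.
set s := g (z + h) - g z - m * h in h2.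
have e11 : e1 <= 1 by rewrite ge_min lexx.
have kb : nc k <= (M + 1) * nc h.
  have -> : k = s + m * h by rewrite /s /k subrK.
  apply: le_trans (ler_ncD _ _) _; rewrite ncM -/M mulrDl mul1r addrC lerD2l.
  by apply: le_trans h2 _; rewrite ler_piMl // nc_ge0.
have /H1 hk : nc k < d1.
  by apply: le_lt_trans kb _; rewrite mulrC -ltr_pdivlMr.
rewrite gE (_ : _ - _ = (f (g z + k) - f (g z) - l * k) + l * s); last by rewrite /s -/k; ring.
apply: le_trans (ler_ncD _ _) _; rewrite ncM -/L.
have a1 : nc (f (g z + k) - f (g z) - l * k) <= e / 2 * nc h.
  apply: le_trans hk _; apply: le_trans (ler_wpM2l (ltW e20) kb) _.
  rewrite mulrA ler_wpM2r ?nc_ge0 // /e2 (_ : e / (2 * (M + 1)) * (M + 1) = e / 2) //.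
  by field; rewrite gt_eqF.
have a2 : L * nc s <= e / 2 * nc h.
  apply: le_trans (ler_wpM2l L0 h2) _; rewrite mulrA ler_wpM2r ?nc_ge0 //.
  have : e1 <= e / (2 * (L + 1)) by rewrite ge_min lexx orbT.
  rewrite invfM mulrA ler_pdivlMr ?ltr_wpDl //; apply: le_trans.
  by rewrite mulrDr mulr1 mulrC lerDl ltW.
by apply: le_trans (lerD a1 a2) _; rewrite -mulrDl -splitr.
Qed.

Lemma cdiffB f g z l m : cdiff f z l -> cdiff g z m ->
  cdiff (fun w => f w - g w) z (l - m).
Proof.
move=> Hf Hg; have Hc := @cdiff_cst (-1) z.
have := cdiffD Hf (cdiffM Hc Hg); rewrite mul0r add0r mulN1r.
by apply: cdiff_ext => w; rewrite mulN1r.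
Qed.

Lemma cdiffZ c f z l : cdiff f z l -> cdiff (fun w => c * f w) z (c * l).
Proof. by move=> H; have := cdiffM (@cdiff_cst c z) H; rewrite mul0r add0r. Qed.

Lemma cdiffX k z : cdiff (fun w => w ^+ k.+1) z (k.+1%:R * z ^+ k).
Proof.
elim: k => [|k IH].
  by rewrite expr0 mulr1; apply: cdiff_ext (@cdiff_id z) => w; rewrite expr1.
have := cdiffM (@cdiff_id z) IH; rewrite mul1r mulrCA -exprS (_ : _ + _ = k.+2%:R * z ^+ k.+1);
  last by rewrite -[k.+2%:R]natr1; ring.
by apply: cdiff_ext => w; rewrite -exprS.
Qed.

Lemma cdiff_inv z : z != 0 -> cdiff (fun w => w^-1) z (- z ^- 2).
Proof.
move=> z0; apply/cdiff_is_deriveP.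
have /cdiff_is_deriveP[d1 d2] := @cdiff_id z.
apply: DeriveDef; first exact: (@derivableV _ _ id).
by rewrite (@deriveV _ _ id) // d2 [_ *: _]mulr1.
Qed.

Lemma cdiff_line f p u (t : R) l : cdiff f (p + t%:C * u) l ->
  rdiff (fun s => f (p + s%:C * u)) t (l * u).
Proof.
move=> H e e0; have u0 : 0 < nc u + 1 by rewrite ltr_wpDl // nc_ge0.
have [d d0 Hd] := H _ (divr_gt0 e0 u0).
exists (d / (nc u + 1)) => [|h]; first by rewrite divr_gt0.
rewrite ltr_pdivlMr // => hd.
have hu : nc (h%:C * u) <= `|h| * (nc u + 1).
  by rewrite ncM ncR ler_wpM2l // lerDl.
have := Hd _ (le_lt_trans hu hd).
have -> : p + t%:C * u + h%:C * u = p + (t + h)%:C * u by rewrite rmorphD /=; ring.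
rewrite -(mulrA l u) (mulrC u) => /le_trans; apply.
apply: le_trans (ler_wpM2l _ hu) _; first by rewrite divr_ge0 // ltW.
by rewrite mulrCA divfK ?gt_eqF // mulrC.
Qed.

Lemma ccont_line f p u (t : R) : ccont f (p + t%:C * u) ->
  rcont (fun s => f (p + s%:C * u)) t.
Proof.
move=> H e e0; have u0 : 0 < nc u + 1 by rewrite ltr_wpDl // nc_ge0.
have [d d0 Hd] := H _ e0.
exists (d / (nc u + 1)) => [|h]; first by rewrite divr_gt0.
rewrite ltr_pdivlMr // => hd.
have hu : nc (h%:C * u) <= `|h| * (nc u + 1).
  by rewrite ncM ncR ler_wpM2l // lerDl.
have := Hd _ (le_lt_trans hu hd).
by have -> : p + t%:C * u + h%:C * u = p + (t + h)%:C * u by rewrite rmorphD /=; ring.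
Qed.

Lemma rdiff_ext (V W : R -> R[i]) t l : V =1 W -> rdiff V t l -> rdiff W t l.
Proof. by move=> /funext ->. Qed.

Lemma segment_ineq f (df : R[i] -> R[i]) p q M :
  (forall t : R, 0 <= t <= 1 -> cdiff f (p + t%:C * (q - p)) (df (p + t%:C * (q - p)))) ->
  (forall t : R, 0 <= t <= 1 -> nc (df (p + t%:C * (q - p))) <= M) ->
  nc (f q - f p) <= M * nc (q - p).
Proof.
move=> H HM.
have := @mean_value_ineq R (fun t => f (p + t%:C * (q - p)))
  (fun t => df (p + t%:C * (q - p)) * (q - p)) 0 1 (M * nc (q - p)) ler01.
rewrite /= mul0r mul1r addr0 [p + (q - p)]addrC subrK subr0 mulr1; apply.
  by move=> t /H; exact: cdiff_line.
by move=> t /HM tM; rewrite ncM ler_wpM2r // nc_ge0.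
Qed.

End ComplexCalculus.

(** * The complex exponential and its derivative *)

Section ComplexExponential.
Variable R : realType.
Implicit Types (z w h : R[i]).
Local Notation nc := (@Normc.normc R).

Lemma cexpD z w : cexp (z + w) = cexp z * cexp w.
Proof.
apply: eqC; rewrite /cexp ?ReM ?ImM /= ?ReD ?ImD expRD ?cosD ?sinD; ring.
Qed.

Lemma cexp0 : cexp (0 : R[i]) = 1.
Proof. by rewrite /cexp /= expR0 cos0 sin0 mul1r mulr0. Qed.

Lemma nc_cexp z : nc (cexp z) = expR (Re z).
Proof.
by rewrite ncE /cexp /= !exprMn -mulrDr cos2Dsin2 mulr1 sqrtr_sqr ger0_norm.
Qed.

Lemma cexp_neq0 z : cexp z != 0.
Proof. by rewrite -nc_gt0 nc_cexp expR_gt0. Qed.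

Lemma cexpMn z k : cexp (k%:R * z) = cexp z ^+ k.
Proof.
elim: k => [|k IH]; first by rewrite mul0r cexp0 expr0.
by rewrite -natr1 mulrDl mul1r cexpD IH exprSr.
Qed.

Lemma rdiff_components (A B : R -> R) x (a b : R) :
  derivable A x 1 /\ derive1 A x = a -> derivable B x 1 /\ derive1 B x = b ->
  rdiff (fun t => A t +i* B t) x (a +i* b).
Proof.
move=> HA HB e e0; have e2 : 0 < e / 2 by rewrite divr_gt0.
have /real_diffP /(_ _ e2) [d1 d10 H1] := HA.
have /real_diffP /(_ _ e2) [d2 d20 H2] := HB.
exists (Num.min d1 d2) => [|h]; first by rewrite lt_min d10.
rewrite lt_min => /andP[/H1 h1 /H2 h2].
apply: le_trans (nc_le_ReIm _) _; rewrite !ReD !ImD !ReN !ImN ReM ImM /=.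
rewrite mulr0 subr0 mulr0 add0r.
by apply: le_trans (lerD h1 h2) _; rewrite -mulrDl -splitr.
Qed.

Lemma rdiff_cexp z (t : R) : rdiff (fun s => cexp (s%:C * z)) t (z * cexp (t%:C * z)).
Proof.
case: z => a b.
apply: (@rdiff_ext _ (fun s => (expR (s * a) * cos (s * b)) +i* (expR (s * a) * sin (s * b)))).
  by move=> s; rewrite /cexp ReM ImM /= !mul0r subr0 addr0.
have -> : (a +i* b) * cexp (t%:C * (a +i* b)) =
   (expR (t * a) * a * cos (t * b) + expR (t * a) * (- sin (t * b) * b)) +i*
   (expR (t * a) * a * sin (t * b) + expR (t * a) * (cos (t * b) * b)).
  apply: eqC; rewrite /cexp ?ReM ?ImM /= ?ReM ?ImM /= !mul0r subr0 addr0; ring.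
apply: rdiff_components.
  have D : is_derive t (1 : R) (fun s => expR (s * a) * cos (s * b))
    (expR (t * a) * a * cos (t * b) + expR (t * a) * (- sin (t * b) * b)).
    by apply: is_derive_eq; rewrite /GRing.scale /=; ring.
  by case: D => D1 D2; split => //; rewrite derive1E.
have D : is_derive t (1 : R) (fun s => expR (s * a) * sin (s * b))
    (expR (t * a) * a * sin (t * b) + expR (t * a) * (cos (t * b) * b)).
  by apply: is_derive_eq; rewrite /GRing.scale /=; ring.
by case: D => D1 D2; split => //; rewrite derive1E.
Qed.

Lemma nc_cexp_le z : nc (cexp z) <= expR (nc z).
Proof. by rewrite nc_cexp ler_expR (le_trans (ler_norm _)) // ler_Re_nc. Qed.

Lemma nc_cexpB1 h : nc (cexp h - 1) <= nc h * expR (nc h).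
Proof.
have := @mean_value_ineq R _ _ 0 1 (nc h * expR (nc h)) ler01 (fun t _ => rdiff_cexp h t).
rewrite mul0r mul1r cexp0 subr0 mulr1; apply => t /andP[t0 t1].
rewrite ncM ler_wpM2l ?nc_ge0 //; apply: le_trans (nc_cexp_le _) _.
by rewrite ler_expR ncM ncR ger0_norm // ler_piMl // nc_ge0.
Qed.

Lemma rdiff_id z (t : R) : rdiff (fun s => s%:C * z) t z.
Proof.
have := @cdiff_line R id 0 z t 1 (@cdiff_id R _); rewrite mul1r.
by apply: rdiff_ext => s /=; rewrite add0r.
Qed.

Lemma rdiffB (V W : R -> R[i]) t l m : rdiff V t l -> rdiff W t m ->
  rdiff (fun s => V s - W s) t (l - m).
Proof.
move=> HA HB e e0; have e2 : 0 < e / 2 by rewrite divr_gt0.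
have [d1 d10 H1] := HA _ e2; have [d2 d20 H2] := HB _ e2.
exists (Num.min d1 d2) => [|h]; first by rewrite lt_min d10.
rewrite lt_min => /andP[/H1 h1 /H2 h2].
rewrite (_ : _ - (l - m) * _ = (V (t + h) - V t - l * h%:C) - (W (t + h) - W t - m * h%:C));
  last by ring.
apply: le_trans (ler_ncB _ _) _.
by apply: le_trans (lerD h1 h2) _; rewrite -mulrDl -splitr.
Qed.

Lemma rdiffZ (V : R -> R[i]) t l c : rdiff V t l -> rdiff (fun s => c * V s) t (c * l).
Proof.
move=> HA e e0; have c0 : 0 < nc c + 1 by rewrite ltr_wpDl // nc_ge0.
have [d d0 H] := HA _ (divr_gt0 e0 c0); exists d => // h /H.
rewrite -mulrBr -mulrA -mulrBr ncM => /(ler_wpM2l (nc_ge0 c)) /le_trans; apply.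
rewrite mulrA ler_wpM2r // mulrCA -[leRHS]mulr1 ler_wpM2l ?(ltW e0) //.
by rewrite ler_pdivrMr // mul1r lerDl.
Qed.

Lemma nc_cexpB1B h : nc (cexp h - 1 - h) <= nc h ^+ 2 * expR (nc h).
Proof.
have := @mean_value_ineq R _ _ 0 1 (nc h ^+ 2 * expR (nc h)) ler01
  (fun t _ => rdiffB (rdiff_cexp h t) (rdiff_id h t)).
rewrite !mul0r !mul1r cexp0 !subr0 mulr1 [_ - h - 1]addrAC.
apply => t /andP[t0 t1].
rewrite -[X in _ - X]mulr1 -mulrBr ncM expr2 -mulrA ler_wpM2l ?nc_ge0 //.
have tn : nc (t%:C * h) <= nc h by rewrite ncM ncR ger0_norm // ler_piMl // nc_ge0.
by apply: le_trans (nc_cexpB1 _) _; rewrite ler_pM ?nc_ge0 ?expR_ge0 // ler_expR.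
Qed.

Lemma expR_half : expR (2^-1 : R) <= 2.
Proof.
have h := @expR_ge1Dx R (- 2^-1); rewrite expRN in h.
have p := expR_gt0 (2^-1 : R).
have : expR 2^-1 * (1 - 2^-1) <= expR (2^-1 : R) * (expR 2^-1)^-1 by rewrite ler_wpM2l // ltW.
by rewrite mulfV ?gt_eqF //; lra.
Qed.

Lemma cdiff_cexp z : cdiff (@cexp R) z (cexp z).
Proof.
move=> e e0; have n0 : 0 < nc (cexp z) by rewrite nc_gt0 cexp_neq0.
exists (Num.min 2^-1 (e / (2 * nc (cexp z)))) => [|h].
  by rewrite lt_min invr_gt0 ltr0n divr_gt0 // mulr_gt0.
rewrite lt_min => /andP[h1 h2].
rewrite cexpD (_ : _ - _ = cexp z * (cexp h - 1 - h)); last by ring.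
rewrite ncM; apply: le_trans (ler_wpM2l (ltW n0) (nc_cexpB1B _)) _.
have e2 : expR (nc h) <= 2 by apply: le_trans expR_half; rewrite ler_expR ltW.
apply: (@le_trans _ _ (nc (cexp z) * (nc h ^+ 2 * 2))).
  by rewrite ler_wpM2l ?(ltW n0) // ler_wpM2l // exprn_ge0 // nc_ge0.
move: h2; rewrite ltr_pdivlMr ?mulr_gt0 // => /ltW /(ler_wpM2r (nc_ge0 h)).
by apply: le_trans; apply: eq_ler; ring.
Qed.

End ComplexExponential.

(** * Existence of primitives of entire functions *)

Section EntirePrimitive.
Variable R : realType.
Implicit Types (z w : R[i]) (f : R[i] -> R[i]).
Local Notation nc := (@Normc.normc R).

Definition centire f := forall z, exists l, cdiff f z l.

Lemma mean_value_ineq_abs (V v : R -> R[i]) (a b M : R) :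
  (forall x, rdiff V x (v x)) ->
  (forall x, `|x - a| <= `|b - a| -> nc (v x) <= M) ->
  nc (V b - V a) <= M * `|b - a|.
Proof.
move=> dV vM; have [ab|/ltW ba] := leP a b.
  rewrite ger0_norm ?subr_ge0 //; apply: mean_value_ineq ab _ _ => // x /andP[ax xb].
  by apply: vM; rewrite (ger0_norm (_ : 0 <= x - a)) ?(ger0_norm (_ : 0 <= b - a)); lra.
rewrite ncB distrC ger0_norm ?subr_ge0 //; apply: mean_value_ineq ba _ _ => // x /andP[bx xa].
by apply: vM; rewrite (ler0_norm (_ : x - a <= 0)) ?(ler0_norm (_ : b - a <= 0)); lra.
Qed.

(** F integrates f from 0 along the real axis to Re z and then vertically to z. Vertical and
    horizontal primitives stand for the integrals; since the increment around any rectangle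
    vanishes, F may also be computed along the other path, which gives both partial derivatives. *)
Lemma entire_primitive f : centire f -> exists F, forall z, cdiff F z (f z).
Proof.
move=> ef.
have ptE1 (x y : R) : y%:C * 'i + x%:C * 1 = x +i* y.
  by apply: eqC; rewrite ?ReD ?ImD ?ReM ?ImM /=; ring.
have ptE2 (x y : R) : x%:C + y%:C * 'i = x +i* y.
  by apply: eqC; rewrite ?ReD ?ImD ?ReM ?ImM /=; ring.
have /choice[X HX] : forall y, exists V : R -> R[i], forall x, rdiff V x (f (x +i* y)).
  move=> y; apply: complex_primitive => x; have [l Hl] := ef (x +i* y).
  have := @ccont_line R f (y%:C * 'i) 1 x; rewrite ptE1 => /(_ (cdiff_cont Hl)).
  move=> H e /H[d d0 Hd]; exists d => // h /Hd.
  by rewrite !ptE1.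
have /choice[Y HY] : forall x, exists V : R -> R[i], forall y, rdiff V y (f (x +i* y)).
  move=> x; apply: complex_primitive => y; have [l Hl] := ef (x +i* y).
  have := @ccont_line R f (x%:C) 'i y; rewrite ptE2 => /(_ (cdiff_cont Hl)).
  move=> H e /H[d d0 Hd]; exists d => // h /Hd.
  by rewrite !ptE2.
(* The integral of f along the boundary of the rectangle, written with primitives on its four sides,
   so that additivity is an identity. *)
pose J x1 x2 y1 y2 := (X y1 x2 - X y1 x1) + 'i * (Y x2 y2 - Y x2 y1)
  - (X y2 x2 - X y2 x1) - 'i * (Y x1 y2 - Y x1 y1).
have i1 : nc 'i = 1 by rewrite ncE /= expr0n /= add0r expr1n sqrtr1.
have J0 : forall x1 x2 y1 y2, J x1 x2 y1 y2 = 0.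
  apply: rectangle_bisection => [x1 x2 x3 y1 y2|x1 x2 y1 y2 y3|a b e e0].
  - by rewrite /J; ring.
  - by rewrite /J; ring.
  set z0 := a +i* b; have [l Hl] := ef z0.
  have e2 : 0 < e / 2 by rewrite divr_gt0.
  have [d d0 Hd] := Hl _ e2.
  exists (d / 2) => [|x1 x2 y1 y2 /andP[x1a ax2] /andP[y1b by2] xd yd]; first by rewrite divr_gt0.
  (* A primitive of the first-order Taylor polynomial of f at z0. Its increments cancel around the
     rectangle, so only the small remainder of f contributes to J. *)
  pose Q w := f z0 * w + l / 2 * (w - z0) ^+ 2.
  have dQ w : cdiff Q w (f z0 + l * (w - z0)).
    have H1 := cdiffZ (f z0) (@cdiff_id R w).
    have H2 := @cdiff_comp R (fun u => u ^+ 2) (fun u => u - z0) w _ _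
      (@cdiffX R 1 (w - z0)) (cdiffB (@cdiff_id R w) (@cdiff_cst R z0 w)).
    have := cdiffD H1 (cdiffZ (l / 2) H2).
    apply: cdiff_val; rewrite expr1 subr0 !mulr1.
    by congr (_ + _); field.
  set S := x2 - x1 + (y2 - y1).
  have bnd x y : x1 <= x <= x2 -> y1 <= y <= y2 ->
      nc (f (x +i* y) - (f z0 + l * (x +i* y - z0))) <= e / 2 * S.
    move=> /andP[x1x xx2] /andP[y1y yy2].
    have hS : nc (x +i* y - z0) <= S.
      apply: le_trans (nc_le_ReIm _) _; rewrite ReD ImD ReN ImN /= /S lerD //.
        by rewrite ler_norml; lra.
      by rewrite ler_norml; lra.
    have hd : nc (x +i* y - z0) < d by apply: le_lt_trans hS _; rewrite /S; lra.
    have := Hd _ hd; rewrite [z0 + _]addrC subrK -addrA -opprD => /le_trans; apply.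
    by rewrite ler_wpM2l // ltW.
  have sideX y : y1 <= y <= y2 ->
      nc (X y x2 - X y x1 - (Q (x2 +i* y) - Q (x1 +i* y))) <= e / 2 * S * (x2 - x1).
    move=> yy.
    have -> : X y x2 - X y x1 - (Q (x2 +i* y) - Q (x1 +i* y)) =
      (X y x2 - Q (x2 +i* y)) - (X y x1 - Q (x1 +i* y)) by ring.
    apply: (@mean_value_ineq R (fun x => X y x - Q (x +i* y))
       (fun x => f (x +i* y) - (f z0 + l * (x +i* y - z0)))).
    - by lra.
    - move=> x xx; apply: rdiffB; first exact: HX.
      have := @cdiff_line R Q (y%:C * 'i) 1 x _ (dQ _).
      by rewrite ptE1 mulr1; apply: rdiff_ext => s; rewrite ptE1.
    - by move=> x xx; apply: bnd.
  have sideY x : x1 <= x <= x2 ->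
      nc ('i * (Y x y2 - Y x y1) - (Q (x +i* y2) - Q (x +i* y1))) <= e / 2 * S * (y2 - y1).
    move=> xx.
    have -> : 'i * (Y x y2 - Y x y1) - (Q (x +i* y2) - Q (x +i* y1)) =
      ('i * Y x y2 - Q (x +i* y2)) - ('i * Y x y1 - Q (x +i* y1)) by ring.
    apply: (@mean_value_ineq R (fun y => 'i * Y x y - Q (x +i* y))
       (fun y => 'i * f (x +i* y) - (f z0 + l * (x +i* y - z0)) * 'i)).
    - by lra.
    - move=> y yy; apply: rdiffB; first by apply: rdiffZ; exact: HY.
      have := @cdiff_line R Q (x%:C) 'i y _ (dQ _).
      by rewrite ptE2; apply: rdiff_ext => s; rewrite ptE2.
    - by move=> y yy; rewrite [X in _ - X]mulrC -mulrBr ncM i1 mul1r; apply: bnd.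
  have hx1 : x1 <= x1 <= x2 by lra.
  have hx2 : x1 <= x2 <= x2 by lra.
  have hy1 : y1 <= y1 <= y2 by lra.
  have hy2 : y1 <= y2 <= y2 by lra.
  have -> : J x1 x2 y1 y2 =
     (X y1 x2 - X y1 x1 - (Q (x2 +i* y1) - Q (x1 +i* y1)))
     + ('i * (Y x2 y2 - Y x2 y1) - (Q (x2 +i* y2) - Q (x2 +i* y1)))
     - (X y2 x2 - X y2 x1 - (Q (x2 +i* y2) - Q (x1 +i* y2)))
     - ('i * (Y x1 y2 - Y x1 y1) - (Q (x1 +i* y2) - Q (x1 +i* y1))) by rewrite /J; ring.
  have b1 := sideX _ hy1; have b2 := sideX _ hy2.
  have b3 := sideY _ hx1; have b4 := sideY _ hx2.
  apply: le_trans (ler_ncB _ _) _; apply: le_trans (lerD (ler_ncB _ _) (lexx _)) _.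
  apply: le_trans (lerD (lerD (ler_ncD _ _) (lexx _)) (lexx _)) _.
  apply: le_trans (lerD (lerD (lerD b1 b4) b2) b3) _.
  by rewrite -/S; apply: eq_ler; rewrite /S; field.
pose F z := X 0 (Re z) + 'i * (Y (Re z) (Im z) - Y (Re z) 0).
exists F => -[x y] e e0; have [l Hl] := ef (x +i* y).
have e2 : 0 < e / 2 by rewrite divr_gt0.
have [d d0 Hd] := cdiff_cont Hl e2.
exists (d / 2) => [|[h k] hd]; first by rewrite divr_gt0.
have hh : `|h| <= nc (h +i* k) := ler_Re_nc (h +i* k).
have hk : `|k| <= nc (h +i* k) := ler_Im_nc (h +i* k).
set n := nc (h +i* k) in hd hh hk *.
have near s t : `|s - x| <= `|h| -> `|t - y| <= `|k| -> nc (f (s +i* t) - f (x +i* y)) <= e / 2.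
  move=> sx ty; have := Hd ((s - x) +i* (t - y)).
  have -> : x +i* y + ((s - x) +i* (t - y)) = s +i* t.
    by apply: eqC; rewrite ?ReD ?ImD /=; ring.
  apply; apply: le_lt_trans (nc_le_ReIm _) _; rewrite /=.
  by apply: le_lt_trans (lerD sx ty) _; lra.
(* The vanishing of J on the rectangle between heights 0 and y moves the horizontal part of the path
   from height 0 to height y. *)
have FE : F (x +i* y + (h +i* k)) - F (x +i* y) =
    (X y (x + h) - X y x) + 'i * (Y (x + h) (y + k) - Y (x + h) y).
  rewrite /F !ReD !ImD /=; have := J0 x (x + h) 0 y; rewrite /J => H.
  by apply/eqP; rewrite -subr_eq0; apply/eqP; rewrite -[RHS]H; ring.
rewrite FE (_ : _ - _ = (X y (x + h) - (x + h)%:C * f (x +i* y) - (X y x - x%:C * f (x +i* y))) +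
   'i * (Y (x + h) (y + k) - (y + k)%:C * f (x +i* y) - (Y (x + h) y - y%:C * f (x +i* y))));
  last first.
  have -> : h +i* k = h%:C + k%:C * 'i by rewrite ptE2.
  by rewrite !rmorphD /=; ring.
have b1 : nc (X y (x + h) - (x + h)%:C * f (x +i* y) - (X y x - x%:C * f (x +i* y)))
    <= e / 2 * `|x + h - x|.
  apply: (@mean_value_ineq_abs (fun s => X y s - s%:C * f (x +i* y))
     (fun s => f (s +i* y) - f (x +i* y))) => s.
    by apply: rdiffB; [exact: HX | exact: rdiff_id].
  move=> sx; apply: near; last by rewrite subrr normr0.
  by rewrite (le_trans sx) // addrAC subrr add0r.
have b2 : nc (Y (x + h) (y + k) - (y + k)%:C * f (x +i* y) - (Y (x + h) y - y%:C * f (x +i* y)))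
    <= e / 2 * `|y + k - y|.
  apply: (@mean_value_ineq_abs (fun s => Y (x + h) s - s%:C * f (x +i* y))
     (fun s => f ((x + h) +i* s) - f (x +i* y))) => s.
    by apply: rdiffB; [exact: HY | exact: rdiff_id].
  move=> sx; apply: near; first by rewrite addrAC subrr add0r.
  by rewrite (le_trans sx) // addrAC subrr add0r.
apply: le_trans (ler_ncD _ _) _; rewrite ncM i1 mul1r.
apply: le_trans (lerD b1 b2) _.
rewrite !(addrAC _ _ (- _)) !subrr !add0r.
by rewrite -mulrDr -mulrA ler_wpM2l ?(ltW e0) // mulrC ler_pdivrMr //; lra.
Qed.

End EntirePrimitive.

(** * Mean values, maximum principle and Cauchy estimates *)

Section CauchyEstimates.
Variable R : realType.
Implicit Types (z w c : R[i]) (f : R[i] -> R[i]).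
Local Notation nc := (@Normc.normc R).
Local Notation tpi := ((2 * pi : R)%:C * 'i).

Lemma nc_i : nc 'i = 1.
Proof. by rewrite ncE /= expr0n /= add0r expr1n sqrtr1. Qed.

Lemma cexp_tpi : cexp tpi = 1 :> R[i].
Proof.
rewrite /cexp ReM ImM /= !(mulr0, mulr1, mul0r, subr0, addr0) expR0 !mul1r.
by rewrite mulr_natl cos2pi sin2pi.
Qed.

Lemma cexpN z : cexp (- z) = (cexp z)^-1.
Proof.
apply: (mulIf (cexp_neq0 z)); rewrite mulVf ?cexp_neq0 // -cexpD addNr.
exact: cexp0.
Qed.

(* The increment of [H] over a period is constant; its value is the limit at [Re w -> -oo]. *)
Lemma periodic_mean (h H : R[i] -> R[i]) (L : R[i]) :
  (forall w, cdiff H w (h w)) -> (forall w, h (w + tpi) = h w) ->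
  (forall e : R, 0 < e -> exists A : R, forall w, Re w <= A -> nc (h w - L) <= e) ->
  forall w, H (w + tpi) - H w = tpi * L.
Proof.
move=> dH hp hL w.
have V w' : H (w + tpi) - H w = H (w' + tpi) - H w'.
  apply/eqP; rewrite -subr_eq0 -nc_eq0 eq_le nc_ge0 andbT.
  have := @segment_ineq R (fun u => H (u + tpi) - H u) (fun=> 0) w' w 0.
  rewrite mul0r; apply => t _; last by rewrite nc0.
  set p := w' + _.
  have := cdiffB (@cdiff_comp R H (fun u => u + tpi) p _ _ (dH _)
     (cdiffD (@cdiff_id R p) (@cdiff_cst R tpi p))) (dH p).
  by rewrite hp addr0 mulr1 subrr.
have p0 : 0 < 2 * pi :> R by rewrite mulr_gt0 // pi_gt0.
have ntp : nc tpi = 2 * pi by rewrite ncM nc_i mulr1 ncR ger0_norm // ltW.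
apply/eqP; rewrite -subr_eq0 -nc_eq0 eq_le nc_ge0 andbT.
apply/ler_addgt0Pl => e e0; rewrite addr0.
have [A HA] := hL (e / (2 * pi)) (divr_gt0 e0 p0).
rewrite (V A%:C).
have := @segment_ineq R (fun u => H u - u * L) (fun u => h u - L) A%:C (A%:C + tpi)
  (e / (2 * pi)).
rewrite [A%:C + tpi - _]addrAC subrr add0r ntp divfK ?gt_eqF //.
rewrite (_ : H (A%:C + tpi) - _ - _ = H (A%:C + tpi) - H A%:C - tpi * L); last by ring.
apply=> t _.
  apply: cdiffB; first exact: dH.
  have := cdiffM (@cdiff_id R (A%:C + t%:C * tpi)) (@cdiff_cst R L _).
  by rewrite mul1r mulr0 addr0.
by apply: HA; rewrite ReD ReM ReM /= !(mulr0, mul0r, subr0, addr0).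
Qed.

Lemma entire_comp_cexp f (df : R[i] -> R[i]) c w : (forall z, cdiff f z (df z)) ->
  cdiff (fun w => f (c + cexp w)) w (df (c + cexp w) * cexp w).
Proof.
move=> Hf; apply: (@cdiff_comp R f (fun w => c + cexp w)); first exact: Hf.
by have := cdiffD (@cdiff_cst R c w) (@cdiff_cexp R w); rewrite add0r.
Qed.

Lemma expR_small (e : R) : 0 < e -> exists A : R, forall a, a <= A -> expR a <= e.
Proof. by move=> e0; exists (ln e) => a; rewrite -ler_expR lnK. Qed.

(** For a primitive H of f(c + e^w) the increment over a period 2 pi i equals 2 pi i f(c). Started
    at ln r, the period segment is mapped by c + e^w onto the circle of radius r, where |f| <= M
    bounds the same increment by 2 pi M. *)
Lemma max_principle f c (r M : R) : centire f -> 0 < r ->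
  (forall z, nc (z - c) = r -> nc (f z) <= M) -> nc (f c) <= M.
Proof.
move=> /choice[df Hf] r0 HM.
have Hh w := @entire_comp_cexp _ _ c w Hf.
have [|H dH] := @entire_primitive R (fun w => f (c + cexp w)).
  by move=> w; eexists; exact: Hh.
have hp w : f (c + cexp (w + tpi)) = f (c + cexp w) by rewrite cexpD cexp_tpi mulr1.
have hL (e : R) : 0 < e -> exists A : R, forall w, Re w <= A -> nc (f (c + cexp w) - f c) <= e.
  move=> e0; have [d d0 Hd] := cdiff_cont (Hf c) e0.
  have d20 : 0 < d / 2 by rewrite divr_gt0.
  have [A HA] := expR_small d20; exists A => w /HA wA.
  by apply: Hd; rewrite nc_cexp; lra.
have HV := periodic_mean dH hp hL (ln r)%:C.
have p0 : 0 < 2 * pi :> R by rewrite mulr_gt0 // pi_gt0.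
have ntp : nc tpi = 2 * pi by rewrite ncM nc_i mulr1 ncR ger0_norm // ltW.
have := @segment_ineq R H (fun w => f (c + cexp w)) (ln r)%:C ((ln r)%:C + tpi) M (fun t _ => dH _).
rewrite HV [_ + tpi - _]addrAC subrr add0r ncM ntp [M * _]mulrC ler_pM2l //.
apply=> t _; apply: HM; rewrite addrAC subrr add0r nc_cexp.
by rewrite ReD ReM ReM /= !(mulr0, mul0r, subr0, addr0) lnK.
Qed.

(** Cauchy's formula for f'(c) on the unit circle, the integral being the increment of [W]. It is
    the periodic mean of (f(c + e^w) - f(c)) e^{-w}, which tends to f'(c) as Re w tends to -oo. *)
Lemma deriv_mean f (df : R[i] -> R[i]) c : (forall z, cdiff f z (df z)) ->
  exists2 W : R -> R[i], forall t, rdiff W t ((f (c + cexp (t%:C * 'i)) - f c) * cexp (- (t%:C * 'i)))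
   & W (2 * pi) - W 0 = (2 * pi)%:C * df c.
Proof.
move=> Hf.
pose h w := (f (c + cexp w) - f c) * cexp (- w).
have dh w : exists l, cdiff h w l.
  eexists; apply: cdiffM.
    by apply: cdiffB; [exact: (entire_comp_cexp c w Hf) | exact: cdiff_cst].
  apply: (@cdiff_comp R (@cexp R) (fun w => - w)); first exact: cdiff_cexp.
  have := cdiffB (@cdiff_cst R 0 w) (@cdiff_id R w); apply: cdiff_ext => u /=.
  by rewrite sub0r.
have [H dH] := entire_primitive dh.
have hp w : h (w + tpi) = h w.
  by rewrite /h opprD !cexpD cexp_tpi [cexp (- tpi)]cexpN cexp_tpi invr1 !mulr1.
have hL (e : R) : 0 < e -> exists A : R, forall w, Re w <= A -> nc (h w - df c) <= e.
  move=> e0; have [d d0 Hd] := Hf c _ e0.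
  have d20 : 0 < d / 2 by rewrite divr_gt0.
  have [A HA] := expR_small d20; exists A => w /HA wA.
  have n0 : 0 < nc (cexp w) by rewrite nc_gt0 cexp_neq0.
  rewrite -(ler_pM2r n0) -ncM /h mulrBl cexpN divfK ?cexp_neq0 //.
  by apply: Hd; rewrite nc_cexp; lra.
have HV := periodic_mean dH hp hL; exists (fun t => (- 'i) * H (0 + t%:C * 'i)) => [t|].
  have := rdiffZ (- 'i) (@cdiff_line R H 0 'i t _ (dH _)).
  rewrite add0r -/(h _); set u := h _.
  by rewrite (_ : - 'i * (u * 'i) = u) //; rewrite mulrCA mulNr -expr2 sqr_i opprK mulr1.
rewrite -mulrBr !add0r -[X in H X - _]add0r mul0r HV.
by rewrite mulrA [X in X * _ = _](_ : _ = (2 * pi)%:C) // mulrCA mulNr -expr2 sqr_i opprK mulr1.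
Qed.

(** Boundedness on discs is the input of the Cauchy estimates; for members of [A0] it is read off
    from the growth condition. *)
Definition lbdd f := forall r : R, exists B : R, forall z, nc z <= r -> nc (f z) <= B.

Lemma nc_unit (t : R) : nc (cexp (t%:C * 'i)) = 1.
Proof. by rewrite nc_cexp ReM /= mulr0 mul0r subr0 expR0. Qed.

Lemma nc_unitN (t : R) : nc (cexp (- (t%:C * 'i))) = 1.
Proof. by rewrite cexpN ncV nc_unit invr1. Qed.

Lemma deriv_bound f (df : R[i] -> R[i]) c (M : R) : (forall z, cdiff f z (df z)) ->
  (forall z, nc z = 1 -> nc (f (c + z) - f c) <= M) -> nc (df c) <= M.
Proof.
move=> Hf HM; have [W dW W2] := deriv_mean c Hf.
have p0 : 0 < 2 * pi :> R by rewrite mulr_gt0 // pi_gt0.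
have := @mean_value_ineq_abs R W _ 0 (2 * pi) M dW.
rewrite W2 subr0 ncM ncR [X in _ <= X]mulrC ler_pM2l ?normr_gt0 ?gt_eqF //.
by apply=> t _; rewrite ncM nc_unitN mulr1; apply: HM; exact: nc_unit.
Qed.

Section SecondDerivative.
Variables (f df : R[i] -> R[i]).
Hypotheses (Hf : forall z, cdiff f z (df z)) (bf : lbdd f).

Lemma lbdd_deriv : lbdd df.
Proof.
move=> r; have [B HB] := bf (r + 1); exists (B + B) => z zr.
apply: (deriv_bound Hf) => w w1; apply: le_trans (ler_ncB _ _) _; apply: lerD.
  by apply: HB; apply: le_trans (ler_ncD _ _) _; rewrite w1 lerD2r.
by apply: HB; apply: le_trans zr _; rewrite lerDl.
Qed.

Lemma nc_segment (p q : R[i]) (t r : R) : 0 <= t <= 1 -> nc p <= r -> nc q <= r ->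
  nc (p + t%:C * (q - p)) <= r.
Proof.
move=> /andP[t0 t1] pr qr.
rewrite (_ : _ + _ = (1 - t)%:C * p + t%:C * q); last by rewrite rmorphB rmorph1; ring.
apply: le_trans (ler_ncD _ _) _; rewrite !ncM !ncR (ger0_norm t0) ger0_norm ?subr_ge0 //.
have : (1 - t) * nc p <= (1 - t) * r by rewrite ler_wpM2l // subr_ge0.
have : t * nc q <= t * r by rewrite ler_wpM2l.
by lra.
Qed.

Lemma lipschitz_ball (r : R) : exists B : R, 0 <= B /\ forall p q, nc p <= r -> nc q <= r ->
  nc (f q - f p) <= B * nc (q - p).
Proof.
have [B HB] := lbdd_deriv r; exists `|B|; split => // p q pr qr.
apply: (@segment_ineq R f df) => t tt; first exact: Hf.
by apply: le_trans (ler_norm B); apply: HB; exact: nc_segment.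
Qed.

(** The Cauchy estimate is applied to the difference z |-> f(z + (q - p)) - f(z), which is O(|q -
    p|) because f is Lipschitz; its derivative at p is df q - df p. *)
Lemma deriv_lipschitz (r : R) : exists B : R, 0 <= B /\ forall p q, nc p <= r -> nc q <= r ->
  nc (df q - df p) <= B * nc (q - p).
Proof.
have [B [B0 HB]] := lipschitz_ball (r + 1); exists (2 * B); split; first by rewrite mulr_ge0.
move=> p q pr qr.
have := @deriv_bound (fun z => f (z + (q - p)) - f z) (fun z => df (z + (q - p)) - df z) p
  (2 * B * nc (q - p)).
rewrite [p + (q - p)]addrC subrK; apply=> [z|z z1].
  apply: cdiffB; last exact: Hf.
  rewrite -[df (z + _)]mulr1; apply: (@cdiff_comp R f (fun u => u + (q - p))); first exact: Hf.
  by have := cdiffD (@cdiff_id R z) (@cdiff_cst R (q - p) z); rewrite addr0.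
have -> : p + z + (q - p) = q + z by ring.
apply: le_trans (ler_ncB _ _) _; rewrite -mulrA mulr_natl mulr2n; apply: lerD.
  have := HB (p + z) (q + z); rewrite (_ : q + z - (p + z) = q - p); last by ring.
  by apply; apply: le_trans (ler_ncD _ _) _; rewrite z1 lerD2r.
by apply: HB; [apply: le_trans pr _ | apply: le_trans qr _]; rewrite lerDl.
Qed.

Lemma deriv_quadratic (r : R) : exists B : R, 0 <= B /\ forall p q, nc p <= r -> nc q <= r ->
  nc (f q - f p - df p * (q - p)) <= B * nc (q - p) ^+ 2.
Proof.
have [B [B0 HB]] := deriv_lipschitz r; exists B; split => // p q pr qr.
have := @segment_ineq R (fun z => f z - df p * z) (fun z => df z - df p) p q (B * nc (q - p)).
rewrite -mulrA -expr2 (_ : f q - df p * q - _ = f q - f p - df p * (q - p)); last by ring.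
apply=> t tt.
  apply: cdiffB; first exact: Hf.
  by have := cdiffZ (df p) (@cdiff_id R (p + t%:C * (q - p))); rewrite mulr1.
apply: le_trans (HB _ _ pr (nc_segment tt pr qr)) _.
rewrite addrAC subrr add0r ncM ncR ler_wpM2l // ler_piMl ?nc_ge0 //.
by case/andP: tt => t0 t1; rewrite ger0_norm.
Qed.

(** Cauchy's formula for df is differentiated under the integral sign: the candidate for f''(c) is
    the mean of df(c + e^{it}) e^{-it}, and the quadratic Taylor remainder of f, uniform on the
    circle, controls the error. *)
Lemma deriv_entire : centire df.
Proof.
move=> c.
have dfc z : ccont df z.
  have [B [B0 HB]] := deriv_lipschitz (nc z + 1).
  have B1 : 0 < B + 1 by rewrite ltr_wpDl.
  move=> e e0; exists (Num.min 1 (e / (B + 1))) => [|h]; first by rewrite lt_min ltr01 divr_gt0.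
  rewrite lt_min => /andP[h1]; rewrite ltr_pdivlMr // => h2.
  have := HB z (z + h); rewrite addrAC subrr add0r => /(_ _ _)/le_trans; apply.
  - by rewrite lerDl.
  - by apply: le_trans (ler_ncD _ _) _; rewrite lerD2l ltW.
  by apply: le_trans (ltW h2); rewrite mulrC ler_wpM2l ?nc_ge0 // lerDl.
have [W HW] : exists W : R -> R[i], forall t,
    rdiff W t (df (c + cexp (t%:C * 'i)) * cexp (- (t%:C * 'i))).
  apply: complex_primitive => t.
  have C1 : ccont (fun w => df (c + cexp w) * cexp (- w)) (0 + t%:C * 'i).
    move=> e e0.
    have C2 := cdiff_cont (@entire_comp_cexp id (fun=> 1) c (0 + t%:C * 'i) (@cdiff_id R)).
    have d3 : cdiff (fun w => cexp (- w)) (0 + t%:C * 'i) (cexp (- (0 + t%:C * 'i)) * -1).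
      apply: (@cdiff_comp R (@cexp R) (fun w => - w)); first exact: cdiff_cexp.
      have := cdiffB (@cdiff_cst R 0 (0 + t%:C * 'i)) (@cdiff_id R _).
      by rewrite sub0r; apply: cdiff_ext => u /=; rewrite sub0r.
    have C3 := cdiff_cont d3.
    set w0 := 0 + _ in C2 C3 *; set z0 := c + cexp w0 in C2.
    have D0 : 0 < nc (df z0) + 1 by rewrite ltr_wpDl // nc_ge0.
    have [d1 d10 H1] := dfc z0 (Num.min 1 (e / 4)) ltac:(by rewrite lt_min ltr01 divr_gt0).
    have d12 : 0 < d1 / 2 by rewrite divr_gt0.
    have [d2 d20 H2] := C2 _ d12.
    have [d4 d40 H4] := C3 (Num.min 1 (e / (4 * (nc (df z0) + 1))))
       ltac:(by rewrite lt_min ltr01 divr_gt0 // mulr_gt0).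
    exists (Num.min d2 d4) => [|h]; first by rewrite lt_min d20.
    rewrite lt_min => /andP[/H2 h2 /H4 h4].
    have hlt : d1 / 2 < d1 by lra.
    have h1 := H1 (c + cexp (w0 + h) - z0) (le_lt_trans h2 hlt).
    rewrite [z0 + _]addrC subrK in h1.
    move: h1 h4; rewrite !le_min => /andP[h1 h1'] /andP[h4 h4'].
    have n1 : nc (cexp (- w0)) = 1 by rewrite /w0 add0r nc_unitN.
    set A := df (c + cexp (w0 + h)) in h1 h1' *; set B := cexp (- (w0 + h)) in h4 h4' *.
    rewrite -/z0 (_ : A * B - df z0 * cexp (- w0) =
       (A - df z0) * (B - cexp (- w0)) + (A - df z0) * cexp (- w0) + df z0 * (B - cexp (- w0)));
      last by ring.
    apply: le_trans (ler_ncD _ _) _; apply: le_trans (lerD (ler_ncD _ _) (lexx _)) _.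
    rewrite !ncM n1 mulr1.
    have t1 : nc (A - df z0) * nc (B - cexp (- w0)) <= e / 4.
      by apply: le_trans h1'; rewrite ler_piMr // nc_ge0.
    have t2 : nc (df z0) * nc (B - cexp (- w0)) <= e / 4.
      apply: le_trans (ler_wpM2l (nc_ge0 _) h4') _.
      rewrite [e / (4 * _)](_ : _ = e / 4 / (nc (df z0) + 1)); last by field; rewrite gt_eqF.
      rewrite mulrCA -[leRHS]mulr1 ler_wpM2l ?divr_ge0 ?(ltW e0) //.
      by rewrite ler_pdivrMr // mul1r lerDl.
    by apply: le_trans (lerD (lerD t1 h1') t2) _; lra.
  have := ccont_line C1; move=> C1' e /C1'[d d0 Hd]; exists d => // h /Hd.
  by rewrite !add0r.
have p0 : 0 < 2 * pi :> R by rewrite mulr_gt0 // pi_gt0.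
exists ((W (2 * pi) - W 0) / (2 * pi)%:C) => e e0.
(* The radius leaves room for a point of the unit circle around c and for an increment h with |h| <
   1. *)
have [B [B0 HB]] := deriv_quadratic (nc c + 2).
have B1 : 0 < 2 * B + 1 by rewrite ltr_wpDl // mulr_ge0.
exists (Num.min 1 (e / (2 * B + 1))) => [|h]; first by rewrite lt_min ltr01 divr_gt0.
rewrite lt_min => /andP[h1]; rewrite ltr_pdivlMr // => h2.
have [W1 HW1 E1] := deriv_mean c Hf; have [W2 HW2 E2] := deriv_mean (c + h) Hf.
have tp : (2 * pi : R)%:C != 0 by rewrite (inj_eq (@complexI R)) gt_eqF.
(* A primitive of e^{-it} with equal values at 0 and 2 pi: it inserts the constant f(c + h) - f(c)
   into the integrand without changing the integral. *)
pose E (t : R) : R[i] := 'i * cexp (t%:C * (- 'i)).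
have dE t : rdiff E t (cexp (- (t%:C * 'i))).
  have := rdiffZ ('i : R[i]) (@rdiff_cexp R (- 'i) t); rewrite mulrA mulrN -expr2 sqr_i opprK mul1r.
  by rewrite mulrN.
have EE : E (2 * pi) = E 0.
  by rewrite /E mul0r cexp0 mulrN cexpN cexp_tpi invr1.
pose V t := W2 t - (W1 t - (f (c + h) - f c) * E t) - h * W t.
have VE : (df (c + h) - df c - (W (2 * pi) - W 0) / (2 * pi)%:C * h) * (2 * pi)%:C =
    V (2 * pi) - V 0.
  rewrite /V EE [RHS](_ : _ = (W2 (2 * pi) - W2 0) - (W1 (2 * pi) - W1 0)
     - h * (W (2 * pi) - W 0)); last by ring.
  by rewrite E1 E2; move: tp; move: ((2 * pi)%:C) => T tp; field.
have n0 : 0 < nc (2 * pi : R)%:C by rewrite nc_gt0.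
rewrite -(ler_pM2r n0) -ncM VE -[(2 * pi)%R in leRHS]subr0 ncR.
apply: (@mean_value_ineq_abs R V (fun t =>
   (f (c + h + cexp (t%:C * 'i)) - f (c + h)) * cexp (- (t%:C * 'i)) -
   ((f (c + cexp (t%:C * 'i)) - f c) * cexp (- (t%:C * 'i)) -
    (f (c + h) - f c) * cexp (- (t%:C * 'i))) -
   h * (df (c + cexp (t%:C * 'i)) * cexp (- (t%:C * 'i))))) => [t|t _].
  apply: rdiffB; last by apply: rdiffZ; exact: HW.
  by apply: rdiffB; [exact: HW2 | apply: rdiffB; [exact: HW1 | apply: rdiffZ; exact: dE]].
set z := cexp (t%:C * 'i); set zi := cexp _.
rewrite (_ : _ - _ = (f (c + z + h) - f (c + z) - df (c + z) * h) * zi); last first.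
  by rewrite [c + z + h]addrAC; ring.
rewrite ncM nc_unitN mulr1.
have nz : nc z = 1 := nc_unit t.
have := HB (c + z) (c + z + h); rewrite [c + z + h - _]addrAC subrr add0r => /(_ _ _)/le_trans; apply.
- by apply: le_trans (ler_ncD _ _) _; rewrite nz lerD2l ler1n.
- apply: le_trans (ler_ncD _ _) _; apply: le_trans (lerD (ler_ncD _ _) (lexx _)) _.
  by rewrite nz; lra.
rewrite expr2 mulrA ler_wpM2r ?nc_ge0 //; have := nc_ge0 h.
by move: (nc h) h2 => x hx x0; nra.
Qed.

End SecondDerivative.

End CauchyEstimates.

(** * Division of entire functions by their zeros *)

Section Division.
Variable R : realType.
Implicit Types (z w a : R[i]) (f g : R[i] -> R[i]).
Local Notation nc := (@Normc.normc R).

Definition eb f := centire f /\ lbdd f.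

Lemma cdiff_local f g z l (d : R) : 0 < d -> (forall h, nc h < d -> f (z + h) = g (z + h)) ->
  cdiff f z l -> cdiff g z l.
Proof.
move=> d0 fg H e /H[d1 d10 Hd]; exists (Num.min d d1) => [|h]; first by rewrite lt_min d0.
rewrite lt_min => /andP[/fg hd /Hd].
by have := fg 0; rewrite nc0 addr0 hd => ->.
Qed.

Lemma eb_cdiff f : centire f -> forall z, cdiff f z (@derive1 R[i] R[i]^o f z).
Proof. by move=> cf z; have [l Hl] := cf z; rewrite (cdiff_derive1 Hl). Qed.

Lemma eb_deriv f : eb f -> eb (@derive1 R[i] R[i]^o f).
Proof.
by move=> [cf bf]; have H := eb_cdiff cf; split; [exact: (deriv_entire H bf) | exact: (lbdd_deriv H bf)].
Qed.

Lemma eb_ccont f z : eb f -> ccont f z.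
Proof. by move=> [cf _]; have [l Hl] := cf z; exact: cdiff_cont Hl. Qed.

Lemma ccont_eq f g a : ccont f a -> ccont g a -> (forall z, z != a -> f z = g z) -> f a = g a.
Proof.
move=> cf cg fg; apply/eqP; rewrite -subr_eq0 -nc_eq0 eq_le nc_ge0 andbT.
apply/ler_addgt0Pl => e e0; rewrite addr0; have e2 : 0 < e / 2 by rewrite divr_gt0.
have [d1 d10 H1] := cf _ e2; have [d2 d20 H2] := cg _ e2.
pose h := (Num.min d1 d2 / 2)%:C.
have m0 : 0 < Num.min d1 d2 by rewrite lt_min d10.
have nh : nc h = Num.min d1 d2 / 2 by rewrite ncR ger0_norm // divr_ge0 // ltW.
have h0 : a + h != a.
  by rewrite -subr_eq0 addrAC subrr add0r -nc_gt0 nh divr_gt0.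
have hm : nc h < Num.min d1 d2 by rewrite nh; lra.
move: (hm); rewrite lt_min => /andP[/H1 h1 /H2 h2].
rewrite (_ : f a - g a = (g (a + h) - g a) - (f (a + h) - f a)); last by rewrite (fg _ h0); ring.
by apply: le_trans (ler_ncB _ _) _; lra.
Qed.

Lemma ccontM f g z : ccont f z -> ccont g z -> ccont (fun w => f w * g w) z.
Proof.
move=> cf cg e e0.
set A := nc (f z); set B := nc (g z).
have A0 : 0 < A + B + 1 by rewrite ltr_wpDl // addr_ge0 // nc_ge0.
pose e1 := Num.min 1 (e / (A + B + 1)).
have e10 : 0 < e1 by rewrite lt_min ltr01 divr_gt0.
have [d1 d10 H1] := cf _ e10; have [d2 d20 H2] := cg _ e10.
exists (Num.min d1 d2) => [|h]; first by rewrite lt_min d10.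
rewrite lt_min => /andP[/H1 h1 /H2 h2].
rewrite (_ : _ - _ = (f (z + h) - f z) * (g (z + h) - g z) + (f (z + h) - f z) * g z
   + f z * (g (z + h) - g z)); last by ring.
apply: le_trans (ler_ncD _ _) _; apply: le_trans (lerD (ler_ncD _ _) (lexx _)) _.
rewrite !ncM -/A -/B.
have e11 : e1 <= 1 by rewrite ge_min lexx.
have e1e : e1 * (A + B + 1) <= e by rewrite -ler_pdivlMr // ge_min lexx orbT.
have := nc_ge0 (f (z + h) - f z); have := nc_ge0 (g (z + h) - g z).
have a0 : 0 <= A := nc_ge0 _; have b0 : 0 <= B := nc_ge0 _.
move: (nc (f (z + h) - f z)) (nc (g (z + h) - g z)) h1 h2 => u v hu hv v0 u0.
have t1 : u * v <= e1 by apply: le_trans hv; rewrite ler_piMl // (le_trans hu).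
have t2 : u * B <= e1 * B by rewrite ler_wpM2r.
have t3 : A * v <= A * e1 by rewrite ler_wpM2l.
by lra.
Qed.

(** The quotient is extended by f'(a) at a, where its derivative is f''(a) / 2: the mean value
    inequality for f(z) - f'(a) z - f''(a) (z - a)^2 / 2 gives the expansion. Local boundedness of
    the quotient is the Lipschitz bound of f. *)
Lemma eb_div f a : eb f -> f a = 0 -> exists2 g, eb g & forall z, f z = (z - a) * g z.
Proof.
move=> [cf bf] fa0; have Hf := eb_cdiff cf; set df := derive1 _ in Hf.
pose g z := if z == a then df a else f z / (z - a).
have ga : g a = df a by rewrite /g eqxx.
have gz z : z != a -> g z = f z / (z - a) by rewrite /g => /negbTE ->.
exists g => [|z]; last first.
  have [->|za] := eqVneq z a; first by rewrite fa0 subrr mul0r.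
  by rewrite gz // mulrC divfK // subr_eq0.
split=> [z|r].
  have [->{z}|za] := eqVneq z a; last first.
    have za' : z - a != 0 by rewrite subr_eq0.
    have d1 := cdiffM (Hf z) (@cdiff_comp R (fun w => w^-1) (fun w => w - a) z _ _
      (cdiff_inv za') (cdiffB (@cdiff_id R z) (@cdiff_cst R a z))).
    eexists; apply: (@cdiff_local _ _ z _ (nc (z - a)) _ _ d1); first by rewrite nc_gt0.
    move=> h hz; rewrite gz //; apply/eqP => zh.
    by move: hz; rewrite -zh opprD addrA subrr add0r ncN ltxx.
  have [m Hm] := deriv_entire Hf bf a.
  exists (m / 2) => e e0; have [d d0 Hd] := Hm _ e0; exists d => // h hd.
  have [->|h0] := eqVneq h 0; first by rewrite addr0 subrr mulr0 subr0 nc0 mulr0.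
  have aha : a + h - a = h by ring.
  have ah : a + h != a by rewrite -subr_eq0 aha.
  rewrite ga gz // aha.
  have nh : 0 < nc h by rewrite nc_gt0.
  rewrite -(ler_pM2r nh) -ncM (_ : (_ - _) * h = f (a + h) - f a - df a * h - m / 2 * h ^+ 2);
    last by rewrite fa0; field.
  have := @segment_ineq R (fun z => f z - df a * z - m / 2 * (z - a) ^+ 2)
    (fun z => df z - df a - m * (z - a)) a (a + h) (e * nc h).
  rewrite aha (_ : _ - _ - (_ - _ - _) = f (a + h) - f a - df a * h - m / 2 * h ^+ 2); last by ring.
  apply=> t /andP[t0 t1].
    set p := a + _; apply: cdiffB.
      apply: cdiffB; first exact: Hf.
      by have := cdiffZ (df a) (@cdiff_id R p); rewrite mulr1.
    have H2 := @cdiff_comp R (fun u => u ^+ 2) (fun u => u - a) p _ _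
      (@cdiffX R 1 (p - a)) (cdiffB (@cdiff_id R p) (@cdiff_cst R a p)).
    have := cdiffZ (m / 2) H2; apply: cdiff_val; rewrite expr1 subr0 !mulr1.
    by field.
  rewrite (_ : a + t%:C * h - a = t%:C * h); last by ring.
  have th : nc (t%:C * h) <= nc h.
    by rewrite ncM ncR ger0_norm // ler_piMl // nc_ge0.
  by apply: le_trans (Hd _ (le_lt_trans th hd)) _; rewrite ler_wpM2l // ltW.
have [B [B0 HB]] := lipschitz_ball Hf bf (Num.max r (nc a)).
exists (Num.max B (nc (df a))) => z zr; have [->|za] := eqVneq z a.
  by rewrite ga le_max lexx orbT.
rewrite gz // le_max; apply/orP; left.
have := HB a z; rewrite !le_max zr lexx orbT fa0 subr0 => /(_ isT isT).
by rewrite ncM ncV -ler_pdivrMr // nc_gt0 subr_eq0.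
Qed.

(** Leibniz' rule for a linear factor. At z = a it turns the vanishing of the derivatives of (z - a)
    g into that of the derivatives of g, one order lower. *)
Lemma cderiv_mulX g a n z : eb g ->
  cderiv n.+1 (fun z => (z - a) * g z) z = (z - a) * cderiv n.+1 g z + n.+1%:R * cderiv n g z.
Proof.
move=> ebg.
have ebn k : eb (cderiv k g) by elim: k => [|k IH]; [exact: ebg | exact: eb_deriv].
have dn k w : cdiff (cderiv k g) w (cderiv k.+1 g w).
  by have [ck _] := ebn k; exact: eb_cdiff.
have da w : cdiff (fun z => z - a) w 1.
  by have := cdiffB (@cdiff_id R w) (@cdiff_cst R a w); rewrite subr0.
suff H : forall n, cderiv n.+1 (fun z => (z - a) * g z) =
   fun z => (z - a) * cderiv n.+1 g z + n.+1%:R * cderiv n g z by rewrite H.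
elim=> [|{}n IH].
  apply/funext => w; rewrite /= mul1r addrC.
  by have := cdiffM (da w) (dn 0%N w); rewrite mul1r => /cdiff_derive1.
rewrite [LHS](_ : _ = @derive1 R[i] R[i]^o (cderiv n.+1 (fun z => (z - a) * g z))) // IH.
apply/funext => w.
have := cdiffD (cdiffM (da w) (dn n.+1 w)) (cdiffZ n.+1%:R (dn n w)).
move=> /cdiff_derive1 ->; rewrite -[n.+2%:R]natr1.
by move: (cderiv n.+2 g w) (cderiv n.+1 g w) => u v; ring.
Qed.

Lemma eb_div_mult f a k : eb f -> (forall j, (j < k)%N -> cderiv j f a = 0) ->
  exists2 g, eb g & forall z, f z = (z - a) ^+ k * g z.
Proof.
elim: k f => [|k IH] f ebf H; first by exists f => // z; rewrite expr0 mul1r.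
have [g ebg fg] := eb_div ebf (H 0%N isT).
have [j jk|h ebh gh] := IH g ebg.
  have := H j.+1 jk; rewrite (_ : f = fun z => (z - a) * g z); last exact/funext.
  by rewrite cderiv_mulX // subrr mul0r add0r => /eqP; rewrite mulf_eq0 pnatr_eq0 /= => /eqP.
by exists h => // z; rewrite fg gh exprS mulrA.
Qed.

(** One factor z - a is removed at a time. After cancellation the identity holds for z <> a, and at
    a by continuity. In the product over the nodes, p collects the factors already split off. *)
Lemma eb_div_coprime p g h a k : (forall z, ccont p z) -> p a != 0 -> eb h -> eb g ->
  (forall z, p z * h z = (z - a) ^+ k * g z) ->
  exists2 h', eb h' & forall z, h z = (z - a) ^+ k * h' z.
Proof.
move=> cp pa; elim: k h => [|k IH] h ebh ebg E; first by exists h => // z; rewrite expr0 mul1r.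
have ha : h a = 0.
  by have /eqP := E a; rewrite subrr expr0n /= mul0r mulf_eq0 (negbTE pa) /= => /eqP.
have [h1 ebh1 hh1] := eb_div ebh ha.
have [z|h2 ebh2 hh2] := IH h1 ebh1 ebg.
  have off w : w != a -> p w * h1 w = (w - a) ^+ k * g w.
    move=> wa; have wa' : w - a != 0 by rewrite subr_eq0.
    by apply: (mulfI wa'); rewrite mulrCA -hh1 E exprS mulrA.
  have [->|za] := eqVneq z a; last exact: off.
  apply: (@ccont_eq (fun w => p w * h1 w) (fun w => (w - a) ^+ k * g w)) off.
    by apply: ccontM; [exact: cp | exact: eb_ccont].
  apply: ccontM; last exact: eb_ccont.
  elim: k {IH E} => [|k IHk].
    by apply: (@cdiff_cont R _ _ 0); apply: cdiff_ext (@cdiff_cst R 1 a) => w; rewrite expr0.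
  have ca : ccont (fun w => w - a) a.
    by apply: cdiff_cont (cdiffB (@cdiff_id R a) (@cdiff_cst R a a)).
  have := ccontM ca IHk; move=> C e /C[d d0 Hd]; exists d => // w /Hd.
  by rewrite !exprS.
by exists h2 => // z; rewrite hh1 hh2 exprS mulrA.
Qed.

Lemma eb_div_prod f (lam : nat -> R[i]) (mu : nat -> nat) (P : pred nat) N :
  eb f -> injective lam ->
  (forall m, P m -> forall j, (j < mu m)%N -> cderiv j f (lam m) = 0) ->
  exists2 g, eb g & forall z, f z = (\prod_(m < N | P m) (z - lam m) ^+ mu m) * g z.
Proof.
move=> ebf il H; elim: N => [|N [h ebh fh]].
  by exists f => // z; rewrite big_ord0 mul1r.
have [PN|nPN] := boolP (P N); last first.
  by exists h => // z; rewrite big_mkcond big_ord_recr /= (negbTE nPN) mulr1 -big_mkcond fh.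
have [g ebg fg] := eb_div_mult ebf (H _ PN).
have [|||h' ebh' hh'] := @eb_div_coprime
   (fun z => \prod_(m < N | P m) (z - lam m) ^+ mu m) g h (lam N) (mu N) _ _ ebh ebg.
- move=> z; elim: N {h ebh fh PN g ebg fg} => [|N IH].
    apply: (@cdiff_cont R _ _ 0); apply: cdiff_ext (@cdiff_cst R 1 z) => w.
    by rewrite big_ord0.
  have cX : ccont (fun w => if P N then (w - lam N) ^+ mu N else 1) z.
    case: (P N); last exact: (cdiff_cont (@cdiff_cst R 1 z)).
    case: (mu N) => [|k].
      by apply: (@cdiff_cont R _ _ 0); apply: cdiff_ext (@cdiff_cst R 1 z) => w; rewrite expr0.
    exact: (cdiff_cont (@cdiff_comp R (fun u => u ^+ k.+1) (fun u => u - lam N) z _ _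
      (@cdiffX R k (z - lam N)) (cdiffB (@cdiff_id R z) (@cdiff_cst R (lam N) z)))).
  have := ccontM IH cX; move=> C e /C[d d0 Hd]; exists d => // w /Hd.
  by rewrite !(big_mkcond (fun m : 'I_N.+1 => P m)) /= !big_ord_recr /= -!big_mkcond.
- apply/prodf_neq0 => m _; rewrite expf_neq0 // subr_eq0; apply/eqP => /il e.
  by have := ltn_ord m; rewrite -e ltnn.
- by move=> z; rewrite -fh fg.
exists h' => // z; rewrite big_mkcond big_ord_recr /= PN -big_mkcond /= fh hh'.
by rewrite mulrA.
Qed.

Lemma A0_eb f : A0 f -> eb f.
Proof.
move=> [ef gf]; split=> [z|r].
  by exists (@derive1 R[i] R[i]^o f z); exact: derivable_cdiff.
have [M HM] := gf 1 ltr01; exists (`|M| * expR r) => z zr.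
apply: le_trans (HM z) _; apply: (@le_trans _ _ (`|M| * expR (1 * nc z))).
  by rewrite ler_wpM2r ?expR_ge0 // ler_norm.
by rewrite ler_wpM2l // ler_expR mul1r.
Qed.

End Division.

(** * Separation of the nodes *)

Section ClosePoints.
Variables (R : realType) (lam : nat -> R[i]) (mu : nat -> nat).
Local Notation nc := (@Normc.normc R).
Local Notation L n := (nc (lam n)).

(** The ratio exceeds 1 only for nodes within |lam_n| / 4 of lam_n, so the product measures how
    densely, with multiplicity, the nodes crowd around lam_n. The factor 4 is explained by the
    circle of radius |lam_n| / 2, which stays at distance at least |lam_n| / 4 from these nodes. *)
Definition closeness n m := Num.max 1 (L n / (4 * nc (lam n - lam m))).

Definition close_prod n N := \prod_(m < N | (m : nat) != n) closeness n m ^+ mu m.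

Lemma closeness_ge1 n m : 1 <= closeness n m.
Proof. by rewrite /closeness le_max lexx. Qed.

Lemma close_prodS n N : close_prod n N.+1 =
  close_prod n N * (if N != n then closeness n N ^+ mu N else 1).
Proof.
by rewrite /close_prod big_mkcond big_ord_recr /= -big_mkcond.
Qed.

Lemma close_prod_ge0 n N : 0 <= close_prod n N.
Proof.
apply: prodr_ge0 => m _; apply: exprn_ge0.
exact: le_trans ler01 (closeness_ge1 _ _).
Qed.

(** An inequality of Jensen type: f is divided by its zeros at the close nodes, and the maximum
    principle on |z - lam_n| = |lam_n| / 2 bounds the quotient at lam_n, where f has modulus 1. *)
Lemma close_prod_le (f : R[i] -> R[i]) n N (M : R) :
  eb f -> injective lam -> lam n != 0 -> nc (f (lam n)) = 1 ->
  (forall m, m != n -> 4 * nc (lam n - lam m) < L n ->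
     forall j, (j < mu m)%N -> cderiv j f (lam m) = 0) ->
  (forall z, nc (z - lam n) = L n / 2 -> nc (f z) <= M) ->
  close_prod n N <= M.
Proof.
move=> ebf il l0 f1 Hz HM.
have Ln : 0 < L n by rewrite nc_gt0.
pose P m := (m != n) && (4 * nc (lam n - lam m) < L n).
have [g ebg fg] : exists2 g, eb g &
    forall z, f z = (\prod_(m < N | P m) (z - lam m) ^+ mu m) * g z.
  by apply: eb_div_prod => // m /andP[mn ml]; exact: Hz.
pose Q := \prod_(m < N | P m) (L n / 4) ^+ mu m.
have Q0 : 0 < Q by apply: prodr_gt0 => m _; rewrite exprn_gt0 // divr_gt0.
have gM : nc (g (lam n)) <= M / Q.
  apply: (@max_principle _ _ _ (L n / 2)); first by case: ebg.
    by rewrite divr_gt0.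
  move=> z zl; rewrite ler_pdivlMr //; apply: le_trans (HM z zl).
  rewrite fg ncM mulrC ler_wpM2r ?nc_ge0 // nc_prod.
  apply: ler_prod => m /andP[_ ml]; rewrite exprn_ge0 ?divr_ge0 ?nc_ge0 //= ncX.
  apply: lerXn2r; rewrite ?nnegrE ?divr_ge0 ?nc_ge0 //.
  by have := ler_ncD3 z (lam m) (lam n); rewrite zl [nc (lam m - _)]ncB; lra.
have dn (m : 'I_N) : P m -> 0 < nc (lam n - lam m).
  move=> /andP[mn _]; rewrite nc_gt0 subr_eq0; apply/eqP => /il e.
  by rewrite e eqxx in mn.
have E : close_prod n N = \prod_(m < N | P m) (L n / (4 * nc (lam n - lam m))) ^+ mu m.
  rewrite /close_prod /P [RHS]big_mkcondr /=; apply: eq_bigr => m mn.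
  have dm : 0 < nc (lam n - lam m).
    rewrite nc_gt0 subr_eq0; apply/eqP => /il e.
    by rewrite e eqxx in mn.
  rewrite /closeness; case: ltP => h.
    by rewrite max_r // ler_pdivlMr ?mulr_gt0 // mul1r ltW.
  by rewrite max_l ?expr1n // ler_pdivrMr ?mulr_gt0 // mul1r.
have f1' : \prod_(m < N | P m) nc (lam n - lam m) ^+ mu m * nc (g (lam n)) = 1.
  rewrite -[RHS]f1 fg ncM nc_prod; congr (_ * _); apply: eq_bigr => m _.
  by rewrite ncX.
have EQ : close_prod n N * \prod_(m < N | P m) nc (lam n - lam m) ^+ mu m = Q.
  rewrite E -big_split /=; apply: eq_bigr => m /dn d0; rewrite -exprMn.
  by congr (_ ^+ _); field; rewrite gt_eqF.
rewrite ler_pdivlMr // in gM; apply: le_trans gM.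
by rewrite -EQ mulrCA [nc _ * _]mulrC f1' mulr1.
Qed.

(** Once |lam_m| > 2 |lam_n| the factor of m is 1, so the product is eventually constant in [N]. The
    bound depends on n and only serves to discard finitely many n in the next argument. *)
Lemma close_prod_bounded n :
  (fun n => L n) @ \oo --> +oo -> exists B, forall N, close_prod n N <= B.
Proof.
move=> /cvgryPgt /(_ (2 * L n)) [m1 _ H]; exists (close_prod n m1).
have fac1 N : (m1 <= N)%N -> (if N != n then closeness n N ^+ mu N else 1) = 1.
  move=> /H /= h; case: ifP => // Nn; rewrite /closeness max_l ?expr1n //.
  have : L n <= nc (lam n - lam N).
    by have := lerB_nc (lam N) (lam n); rewrite [nc (lam N - _)]ncB; lra.
  have := nc_ge0 (lam n) => l0 h2.
  have [->|d0] := eqVneq (nc (lam n - lam N)) 0; first by rewrite mulr0 invr0 mulr0.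
  have dp : 0 < nc (lam n - lam N) by rewrite lt_neqAle eq_sym d0 nc_ge0.
  by rewrite ler_pdivrMr ?mulr_gt0 // mul1r; lra.
have mon N : close_prod n N <= close_prod n N.+1.
  rewrite close_prodS ler_peMr ?close_prod_ge0 //; case: ifP => // _.
  by rewrite exprn_ege1 // closeness_ge1.
move=> N; have [Nm|mN] := leqP N m1.
  rewrite -(subnKC Nm); elim: (m1 - N)%N => [|k IH]; rewrite ?addn0 // addnS.
  exact: le_trans IH (mon _).
rewrite -(subnKC (ltnW mN)); elim: (N - m1)%N => [|k IH]; rewrite ?addn0 // addnS.
by rewrite close_prodS fac1 ?leq_addr // mulr1.
Qed.

(** If the bound failed, it would fail along nodes [s i] whose moduli more than double, with
    constants tending to infinity. Interpolating 1 at these nodes and 0 elsewhere gives a single f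
    of exponential type zero: no other chosen node is close to [s i], so f vanishes to full order at
    all nodes close to it, and the growth of f contradicts [close_prod_le]. *)
Lemma close_prod_subexp : multiplicity_seq lam mu -> interpolating_variety lam mu ->
  forall eps : R, 0 < eps -> exists C : R, forall n N, close_prod n N <= C * expR (eps * L n).
Proof.
move=> [il [l0 [Linf [Lmon mu0]]]] IV eps eps0.
apply: contrapT => /forallNP HC.
(* The failure can be placed beyond any modulus: the enlarged constant C' exceeds the individual
   bounds of the finitely many small n. *)
have big (AC : R * R) : exists n, AC.1 < L n /\ exists N, AC.2 * expR (eps * L n) < close_prod n N.
  case: AC => A C /=.
  have [n0 _ Hn0] : \forall n \near \oo, A < L n by move/cvgryPgt : Linf; exact.
  have /choice[B HB] := fun n => close_prod_bounded n Linf.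
  pose C' := Num.max C 0 + \sum_(n < n0) `|B n|.
  have /existsNP[n /existsNP[N /negP]] := HC C'; rewrite -ltNge => h; exists n.
  have e1 : 1 <= expR (eps * L n) by rewrite -expR0 ler_expR mulr_ge0 ?nc_ge0 // ltW.
  have s0 : 0 <= \sum_(n < n0) `|B n| by apply: sumr_ge0.
  have c0 : 0 <= Num.max C 0 by rewrite le_max lexx orbT.
  split.
    apply: Hn0; rewrite /= leqNgt; apply/negP => nn0.
    have : close_prod n N <= C' * expR (eps * L n).
      apply: (@le_trans _ _ C'); last by rewrite ler_peMr // addr_ge0.
      apply: le_trans (HB n N) _; apply: le_trans (ler_norm _) _.
      rewrite /C' (bigD1 (Ordinal nn0)) //= addrCA lerDl addr_ge0 //.
      by apply: sumr_ge0.
    by rewrite leNgt h.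
  exists N; apply: le_lt_trans h; rewrite ler_wpM2r ?expR_ge0 // /C'.
  by apply: (@le_trans _ _ (Num.max C 0)); rewrite ?le_max ?lexx // lerDl.
have /choice[nn Hnn] := big.
pose s := fix s i := if i is i'.+1 then nn (2 * L (s i'), i%:R) else nn (0, 0).
have sS i : 2 * L (s i) < L (s i.+1) by have [] := Hnn (2 * L (s i), i.+1%:R).
have Lpos n : 0 < L n by rewrite nc_gt0.
have smon i j : (i < j)%N -> 2 * L (s i) < L (s j).
  elim: j => // j IH; rewrite ltnS leq_eqVlt => /predU1P[->|/IH h]; first exact: sS.
  by apply: lt_trans h _; apply: le_lt_trans (sS j); rewrite ler_peMl ?nc_ge0 // ler1n.
pose a m j : R[i] := if (j == 0%N) && `[< exists i, s i = m >] then 1 else 0.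
have [|f [A0f Hf]] := IV a.
  move=> e e0; exists 1 => n; rewrite (bigD1 (Ordinal (mu0 n))) //= big1 ?addr0.
    have : expR (- (e * L n)) <= 1.
      by rewrite -expR0 ler_expR oppr_le0 mulr_ge0 ?nc_ge0 // ltW.
    by rewrite /a; case: ifP => _; rewrite ?nc1 ?nc0 ?mul1r ?mul0r.
  move=> k; rewrite -val_eqE /= => /negbTE k0; by rewrite /a k0 andFb nc0 mul0r.
have ebf := A0_eb A0f.
(* Half of eps suffices because the circle around lam_n lies in |z| <= 2 |lam_n|. *)
case: A0f => _ /(_ (eps / 2)) []; first by rewrite divr_gt0.
move=> M HM; have [i iM] : exists i : nat, `|M| < i.+1%:R.
  by exists (Num.truncn `|M|); apply: truncnS_gt.
set n := s i.+1.
have [_ [N]] := Hnn (2 * L (s i), i.+1%:R); rewrite /= -/(s i.+1) -/n.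
apply/negP; rewrite -leNgt; apply: (@le_trans _ _ (`|M| * expR (eps * L n))); last first.
  by rewrite ler_wpM2r ?expR_ge0 // ltW.
apply: (@close_prod_le f) => //.
- have := Hf n 0%N (mu0 n); rewrite /= fact0 divr1 => ->.
  by rewrite /a eqxx /= (_ : `[< _ >] = true) ?nc1 //; apply/asboolP; exists i.+1.
- move=> m mn close j jm; have /eqP := Hf m j jm.
  rewrite [a m j](_ : _ = 0); last first.
    rewrite /a; case: ifP => // /andP[_ /asboolP[k sk]]; exfalso.
    have kn : k != i.+1 by apply: contra_neq mn => ke; rewrite -sk ke.
    have := lerB_nc (lam n) (lam m); have := lerB_nc (lam m) (lam n).
    rewrite [nc (lam m - _)]ncB; have := Lpos n; have := Lpos m.
    have := nc_ge0 (lam n - lam m).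
    move: kn; rewrite neq_ltn => /orP[] /smon; rewrite -/n sk; lra.
  by rewrite mulf_eq0 invr_eq0 pnatr_eq0 gtn_eqF ?fact_gt0 // orbF => /eqP.
- move=> z zl; apply: le_trans (HM z) _.
  apply: (@le_trans _ _ (`|M| * expR (eps / 2 * nc z))).
    by rewrite ler_wpM2r ?expR_ge0 // ler_norm.
  rewrite ler_wpM2l // ler_expR.
  have : nc z <= 2 * L n.
    have := ler_ncD (z - lam n) (lam n); rewrite subrK zl; have := Lpos n; lra.
  by move=> /(ler_wpM2l (ltW eps0)); lra.
Qed.

End ClosePoints.

(** * Density of the nodes and their separation *)

Section Density.
Variables (R : realType) (lam : nat -> R[i]) (mu : nat -> nat).
Local Notation nc := (@Normc.normc R).
Local Notation L n := (nc (lam n)).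
Hypothesis lam0 : forall n, lam n != 0.

Lemma Lpos n : 0 < L n. Proof. by rewrite nc_gt0. Qed.

Hypothesis cvgA : cvgn (series (fun n => (mu n)%:R / L n)).

Lemma density_tail (e : R) : 0 < e -> exists M : nat, forall N,
  \sum_(m < N | (M <= m)%N) (mu m)%:R / L m <= e.
Proof.
move=> e0; set a := fun n => (mu n)%:R / L n.
have a0 n : 0 <= a n by rewrite /a divr_ge0 // nc_ge0.
have /cvgrPdist_lt /(_ _ e0) [M _ HM] := cvgA.
exists M => N; have [NM|MN] := leqP N M.
  rewrite big1 ?ltW // => m Mm; move: (leq_trans NM Mm).
  by rewrite leqNgt ltn_ord.
have sle : series a N <= limn (series a).
  apply: (nondecreasing_cvgn_le _ cvgA); apply/nondecreasing_seqP => k.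
  by rewrite /series /= big_nat_recr //= lerDl a0.
have /= hM := HM M (leqnn M).
have E : series a N = series a M + \sum_(m < N | (M <= m)%N) a m.
  rewrite /series /= !big_mkord (bigID (fun m : 'I_N => (m < M)%N)) /=; congr (_ + _).
    by rewrite (big_ord_widen N a (ltnW MN)).
  by apply: eq_bigl => m; rewrite -leqNgt.
have := ler_norm (limn (series a) - series a M).
by rewrite -/a; move: hM; rewrite -/a; lra.
Qed.

(** From the rank where the tail of sum mu_m / |lam_m| drops below e, the quotients r / |lam_m| are
    summed; before it the minimum is replaced by 1, which leaves a constant. *)
Lemma density_sum (e : R) : 0 < e -> exists C : R, forall N r, 0 < r ->
  \sum_(m < N) (mu m)%:R * Num.min 1 (r / L m) <= e * r + C.
Proof.
move=> /density_tail[M HM]; exists (\sum_(m < M) (mu m)%:R) => N r r0.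
rewrite (bigID (fun m : 'I_N => (m < M)%N)) /= addrC; apply: lerD.
  under eq_bigl do rewrite -leqNgt.
  apply: (@le_trans _ _ (r * \sum_(m < N | (M <= m)%N) (mu m)%:R / L m)); last first.
    by rewrite mulrC ler_wpM2r ?(ltW r0) ?HM.
  rewrite mulr_sumr; apply: ler_sum => m _.
  rewrite mulrCA ler_wpM2l // ge_min lexx orbT //.
apply: (@le_trans _ _ (\sum_(m < N | (m < M)%N) (mu m)%:R)).
  by apply: ler_sum => m _; rewrite ler_piMr // ge_min lexx.
have -> : \sum_(m < N | (m < M)%N) (mu m)%:R = \sum_(m < minn N M) (mu m)%:R :> R.
  elim: N => [|N IH]; first by rewrite min0n !big_ord0.
  have [NM|NM] := ltnP N M.
    rewrite (minn_idPl (ltnW NM)) in IH; rewrite (minn_idPl NM).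
    by rewrite big_mkcond big_ord_recr -big_mkcond /= IH NM big_ord_recr.
  rewrite (minn_idPr NM) in IH; rewrite (minn_idPr (leqW NM)).
  by rewrite big_mkcond big_ord_recr -big_mkcond /= IH ltnNge NM addr0.
have E k j : \sum_(m < k) (mu m)%:R <= \sum_(m < k + j) (mu m)%:R :> R.
  by rewrite big_split_ord /= lerDl sumr_ge0.
by have := E (minn N M) (M - minn N M)%N; rewrite subnKC ?geq_minr.
Qed.

Lemma mu_small (e : R) : 0 < e -> exists C : R, forall n, (mu n)%:R <= e * L n + C.
Proof.
move=> /density_sum[C HC]; exists C => n.
apply: le_trans (HC n.+1 (L n) (Lpos n)).
rewrite big_ord_recr /= divff ?gt_eqF ?Lpos // minxx mulr1 lerDr.
by apply: sumr_ge0 => m _; rewrite mulr_ge0 // le_min ler01 divr_ge0 // nc_ge0.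
Qed.

(** Since mu_n = o(|lam_n|), any constant raised to the power mu_n is subexponential; this is why
    constants per unit of multiplicity are harmless later on. *)
Lemma expn_mu_subexp (x e : R) : 0 < e -> 0 <= x -> exists C : R, 0 < C /\
  forall n, x ^+ mu n <= C * expR (e * L n).
Proof.
move=> e0 x0; have [C HC] := mu_small (divr_gt0 e0 (ltr_wpDl x0 ltr01)).
exists (expR ((x + 1) * C)); split; first exact: expR_gt0.
move=> n; rewrite -expRD; apply: (@le_trans _ _ (expR (x + 1) ^+ mu n)).
  apply: lerXn2r; rewrite ?nnegrE ?expR_ge0 //.
  by apply: le_trans (expR_ge1Dx _); lra.
rewrite -expRM_natl ler_expR; apply: le_trans (ler_wpM2r _ (HC n)) _.
  by rewrite addr_ge0.
rewrite mulrDl addrC [C * _]mulrC lerD2l.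
have : x + 1 != 0 by rewrite gt_eqF // ltr_wpDl.
by move=> h; apply: eq_ler; field.
Qed.

Hypothesis lam_inj : injective lam.
Hypothesis mu0 : forall n, (0 < mu n)%N.
Hypothesis cps : forall eps : R, 0 < eps -> exists C : R, forall n N,
  close_prod lam mu n N <= C * expR (eps * L n).

(** B is the mu_n-th root of a subexponential quantity. The power mu_n is obtained by exchanging
    roles: in the product centred at m, the node n contributes its closeness to the power mu_n, and
    only nodes m with |lam_m| comparable to |lam_n| matter. *)
Lemma separation (e : R) : 0 < e -> exists C : R, 0 < C /\ forall n, exists B : R,
  [/\ 1 <= B, forall m, m != n -> L n <= B * nc (lam n - lam m) & B ^+ mu n <= C * expR (e * L n)].
Proof.
move=> e0; have e4 : 0 < e / 4 by rewrite divr_gt0.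
have [C1 HC1] := cps e4; have [C2 [C20 HC2]] := expn_mu_subexp e4 (ler0n _ 16).
pose C3 := Num.max C1 1.
have C30 : 0 < C3 by rewrite lt_max ltr01 orbT.
exists (C2 * C3); split; first exact: mulr_gt0.
(* A close node m has |lam_m| <= 2 |lam_n|, whence the exponent; 16 absorbs the 4 in [closeness] and
   the ratio |lam_n| / |lam_m|, and it also covers the nodes that are not close. *)
move=> n; pose K := 16 ^+ mu n * C3 * expR (e / 4 * (2 * L n)).
have L0 := Lpos n.
have ex1 : 1 <= expR (e / 4 * (2 * L n)).
  by rewrite -expR0 ler_expR !mulr_ge0 // ltW.
have p16 : 1 <= 16 ^+ mu n :> R by rewrite exprn_ege1 // ler1n.
have c31 : 1 <= C3 by rewrite le_max lexx orbT.
have K1 : 16 ^+ mu n <= K.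
  by rewrite /K -mulrA ler_peMr ?exprn_ge0 // mulr_ege1.
have K0 : 0 <= K by apply: le_trans K1; rewrite exprn_ge0.
pose B := K `^ ((mu n)%:R)^-1.
have mun : (mu n)%:R != 0 :> R by rewrite pnatr_eq0 -lt0n.
have B0 : 0 <= B by exact: powR_ge0.
have BK : B ^+ mu n = K.
  by rewrite -powR_mulrn // /B -powRrM mulVf // powRr1.
have Bge x : 0 <= x -> x ^+ mu n <= K -> x <= B.
  move=> x0; rewrite -BK; rewrite leNgt => h; rewrite leNgt; apply/negP => Bx.
  by move/negP: h; apply; rewrite ltr_pXn2r.
exists B; split; last first.
- rewrite BK /K -mulrA [leRHS](_ : _ = C2 * expR (e / 4 * L n) * (C3 * expR (e / 4 * (3 * L n)))).
    apply: ler_pM; rewrite ?exprn_ge0 ?mulr_ge0 ?expR_ge0 ?(ltW C30) //.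
    rewrite ler_wpM2l ?(ltW C30) // ler_expR; nra.
  rewrite [e * L n](_ : _ = e / 4 * L n + e / 4 * (3 * L n)); last by field.
  by rewrite expRD; ring.
- move=> m mn; have dge0 := nc_ge0 (lam n - lam m).
  have [h|h] := leP (L n) (4 * nc (lam n - lam m)).
    apply: le_trans h _; rewrite ler_wpM2r // Bge //.
    by apply: le_trans K1; apply: lerXn2r; rewrite ?nnegrE // ler_nat.
  have := lerB_nc (lam n) (lam m); have := lerB_nc (lam m) (lam n).
  rewrite [nc (lam m - _)]ncB => h1 h2.
  have := HC1 m n.+1; rewrite close_prodS eq_sym mn => h3.
  have cp1 : 1 <= close_prod lam mu m n.
    rewrite /close_prod; apply: (big_ind (fun x => 1 <= x)) => // [x y|i _].
      by move=> x1 y1; rewrite mulr_ege1.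
    by rewrite exprn_ege1 // closeness_ge1.
  have h4 : closeness lam m n ^+ mu n <= C3 * expR (e / 4 * (2 * L n)).
    apply: (@le_trans _ _ (close_prod lam mu m n * closeness lam m n ^+ mu n)).
      rewrite ler_peMl // exprn_ge0 // (le_trans ler01) //; exact: closeness_ge1.
    apply: le_trans h3 _; apply: (@le_trans _ _ (C3 * expR (e / 4 * L m))).
      by rewrite ler_wpM2r ?expR_ge0 // le_max lexx.
    by rewrite ler_wpM2l ?(ltW C30) // ler_expR ler_wpM2l ?(ltW e4) //; lra.
  have dp : 0 < nc (lam n - lam m).
    by rewrite nc_gt0 subr_eq0; apply/eqP => /lam_inj e1; rewrite e1 eqxx in mn.
  rewrite -ler_pdivrMr // Bge ?divr_ge0 ?(ltW L0) //.
  apply: (@le_trans _ _ ((16 * closeness lam m n) ^+ mu n)).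
    apply: lerXn2r; rewrite ?nnegrE ?divr_ge0 ?(ltW L0) //.
      by rewrite mulr_ge0 // (le_trans ler01) // closeness_ge1.
    rewrite ler_pdivrMr //; apply: (@le_trans _ _ (16 * (L m / (4 * nc (lam m - lam n))) * nc (lam n - lam m))).
      by rewrite [nc (lam m - _)]ncB [leRHS](_ : _ = 4 * L m); [lra | field; rewrite gt_eqF].
    by rewrite ler_wpM2r // ler_wpM2l // le_max lexx orbT.
  by rewrite exprMn /K -mulrA ler_wpM2l // exprn_ge0.
- rewrite Bge // expr1n; apply: le_trans K1; exact: p16.
Qed.

End Density.

(** * Polynomials on the unit circle and modulo a power *)

Section CircleKernel.
Variable R : realType.
Implicit Types (x z : R[i]) (A B : {poly R[i]}).
Local Notation nc := (@Normc.normc R).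

Lemma nc2C z : (nc z ^+ 2)%:C = z * z^*.
Proof.
case: z => a b; rewrite ncE /= sqr_sqrtr ?addr_ge0 ?sqr_ge0 //.
by apply: eqC; rewrite ?ReM ?ImM /=; ring.
Qed.

Lemma unity_root_exists K : (0 < K)%N -> exists zeta : R[i],
  [/\ nc zeta = 1, zeta ^+ K = 1 & forall t, (0 < t < K)%N -> zeta ^+ t != 1].
Proof.
move=> K0; have Kp : 0 < K%:R :> R by rewrite ltr0n.
have p0 : 0 < pi :> R by exact: pi_gt0.
pose th := 2 * pi / K%:R : R.
have zX t : cexp (th%:C * 'i) ^+ t = cexp ((th * t%:R)%:C * 'i).
  have E : t%:R * th%:C = (th * t%:R)%:C :> R[i].
    rewrite -(rmorph_nat (real_complex R) t) mulrC.
    by apply: eqC; rewrite ?ReM ?ImM /=; ring.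
  by rewrite -cexpMn mulrA E.
exists (cexp (th%:C * 'i)); split; first exact: nc_unit.
  by rewrite zX /th divfK ?gt_eqF // cexp_tpi.
move=> t /andP[t0 tK]; rewrite zX; apply/eqP => /(congr1 (@complex.Re R)).
rewrite /cexp ReM ImM /= !(mulr0, mulr1, mul0r, subr0, addr0) expR0 mul1r => cos1.
pose u := pi * (t%:R / K%:R) : R.
have u0 : 0 < u by rewrite mulr_gt0 // divr_gt0 // ltr0n.
have upi : u < pi.
  by rewrite /u -[ltRHS]mulr1 ltr_pM2l // ltr_pdivrMr // mul1r ltr_nat.
have su : 0 < sin u by apply: sin_gt0_pi; rewrite u0.
have : cos (th * t%:R) = 1 - sin u ^+ 2 *+ 2.
  rewrite (_ : th * t%:R = u *+ 2); first by rewrite cos_mulr2n cos2sin2; ring.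
  by rewrite /th /u; field; rewrite gt_eqF.
by rewrite cos1; nra.
Qed.

(** Generating polynomial of the uniform distribution on H consecutive grid points; products of
    boxes correspond to convolutions. *)
Definition box H : {poly R[i]} := (H%:R)^-1 *: \sum_(i < H) 'X^i.

Lemma box_eval H x : (box H).[x] = (H%:R)^-1 * \sum_(i < H) x ^+ i.
Proof. by rewrite hornerZ horner_sum; under eq_bigr do rewrite hornerXn. Qed.

Lemma boxX H : (0 < H)%N -> ('X - 1) * box H = (H%:R)^-1 *: ('X^H - 1).
Proof.
by move=> H0; rewrite /box -scalerAr subrX1.
Qed.

Lemma nc_box_le1 H x : (0 < H)%N -> nc x = 1 -> nc (box H).[x] <= 1.
Proof.
move=> H0 x1; rewrite box_eval ncM ncV nc_nat ler_pdivrMl ?ltr0n // mulr1.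
apply: le_trans (nc_sum _ _ _) _; under eq_bigr do rewrite ncX x1 expr1n.
by rewrite sumr_const card_ord.
Qed.

Lemma box_double h x : (0 < h)%N -> (box (h + h)).[x] = (box h).[x] * ((1 + x ^+ h) / 2).
Proof.
move=> h0; rewrite !box_eval big_split_ord /=.
under [X in _ + X]eq_bigr do rewrite exprD.
rewrite -mulr_sumr natrD; have : h%:R != 0 :> R[i] by rewrite pnatr_eq0 -lt0n.
move: (\sum_(i < h) _) (h%:R : R[i]) => S k k0.
have kk : k + k != 0 by rewrite -mulr2n mulrn_eq0.
by field; rewrite kk k0.
Qed.

Lemma parallelogram_unit x : nc x = 1 -> nc (1 + x) ^+ 2 + nc (x - 1) ^+ 2 = 4.
Proof.
move=> x1; have : nc x ^+ 2 = 1 by rewrite x1 expr1n.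
case: x {x1} => a b; rewrite !ncE !sqr_sqrtr ?addr_ge0 ?sqr_ge0 //=.
by move=> h; rewrite [RHS](_ : _ = 2 + 2 * (a ^+ 2 + b ^+ 2)); [ring | rewrite h; ring].
Qed.

(* With t = |box h|^2 <= 1 and S = h^2 |x-1|^2 one has |box (2h)|^2 = t (1 - t S / 4). *)
Lemma nc_box_decay h x : (0 < h)%N -> nc x = 1 ->
  nc (box (h + h)).[x] ^+ 2 * (1 + h%:R ^+ 2 * nc (x - 1) ^+ 2 / 4) <= 1.
Proof.
move=> h0 x1.
have hn : h%:R != 0 :> R[i] by rewrite pnatr_eq0 -lt0n.
have E : nc (x ^+ h - 1) = h%:R * nc (x - 1) * nc (box h).[x].
  rewrite -nc_nat -!ncM; congr nc.
  rewrite box_eval subrX1; move: (\sum_(i < h) _) (h%:R : R[i]) hn => S k hn.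
  by field.
have P := @parallelogram_unit (x ^+ h); rewrite ncX x1 expr1n in P.
have {}P := P erefl.
rewrite box_double // ncM exprMn ncM ncV nc_nat.
have b0 := nc_ge0 (box h).[x]; have b1 := nc_box_le1 h0 x1.
set t := nc (box h).[x] ^+ 2; set S := h%:R ^+ 2 * nc (x - 1) ^+ 2.
have tS : nc (1 + x ^+ h) ^+ 2 = 4 - t * S.
  by move: P; rewrite E /t /S !exprMn => <-; ring.
have t0 : 0 <= t by rewrite sqr_ge0.
have t1 : t <= 1 by rewrite exprn_ile1.
have S0 : 0 <= S by rewrite mulr_ge0 ?sqr_ge0.
have tS4 : 0 <= 4 - t * S by rewrite -tS sqr_ge0.
rewrite exprMn tS exprVn.
have -> : t * ((4 - t * S) / 2 ^+ 2) * (1 + S / 4) = t * (1 - t * S / 4) * (1 + S / 4) by field.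
set q := t * (1 - t * S / 4).
have q0 : 0 <= q by rewrite mulr_ge0 //; lra.
(* For S <= 2, q increases with t on [0,1], so q <= 1 - S/4. For larger S, S q = tS - (tS)^2/4 <= 1
   gives q <= 1/2 and q S/4 <= 1/4. *)
have [S2|S2] := leP S 2.
  have St : S * (1 + t) <= 2 * 2 by rewrite ler_pM //; lra.
  have : 0 <= (1 - t) * (4 - S * (1 + t)) by rewrite mulr_ge0 //; lra.
  have : q <= 1 - S / 4 -> q * (1 + S / 4) <= (1 - S / 4) * (1 + S / 4).
    by move=> qS; rewrite ler_wpM2r //; lra.
  have := sqr_ge0 S; rewrite /q; lra.
have Sq : S * q <= 1 by have := sqr_ge0 (S * t / 2 - 1); rewrite /q; lra.
have : 2 * q <= S * q by rewrite ler_wpM2r // ltW.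
by lra.
Qed.

Section DFT.
Variables (K : nat) (zeta : R[i]).
Hypotheses (K0 : (0 < K)%N) (z1 : nc zeta = 1) (zK : zeta ^+ K = 1)
  (zt : forall t, (0 < t < K)%N -> zeta ^+ t != 1).

Lemma unity_sum i j : (i < K)%N -> (j < K)%N ->
  \sum_(l < K) (zeta ^+ l) ^+ (i + (K - j)) = if i == j then K%:R else 0.
Proof.
move=> iK jK; set t := (i + (K - j))%N.
have E : \sum_(l < K) (zeta ^+ l) ^+ t = \sum_(l < K) (zeta ^+ t) ^+ l.
  by apply: eq_bigr => l _; rewrite exprAC.
rewrite E; case: eqP => [ij|/eqP ij].
  have -> : t = K by rewrite /t ij subnKC // ltnW.
  by rewrite zK; under eq_bigr do rewrite expr1n; rewrite sumr_const card_ord.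
have x1 : zeta ^+ t != 1.
  have [tK|tK] := ltnP t K; first by rewrite zt // tK andbT /t addn_gt0 subn_gt0 jK orbT.
  rewrite -(subnK tK) exprD zK mulr1 zt //; apply/andP; split.
    rewrite subn_gt0 ltn_neqAle tK andbT; apply/eqP => e.
    by move/negP: ij; apply; rewrite -(eqn_add2r (K - j)) -/t -e subnKC // ltnW.
  by rewrite ltn_subLR // /t; have := ltn_add2r (K - j) i K; rewrite iK => /idP h;
     apply: leq_trans h _; rewrite leq_add2l leq_subr.
have : (zeta ^+ t - 1) * \sum_(l < K) (zeta ^+ t) ^+ l = 0.
  have := subrX1 (zeta ^+ t) K; rewrite -exprM mulnC exprM zK expr1n subrr.
  by move=> h; rewrite [RHS]h.
by move=> /eqP; rewrite mulf_eq0 subr_eq0 (negbTE x1) /= => /eqP.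
Qed.

(** Fourier inversion on the K-th roots of unity; the negative power zeta^{-ls} is written
    (zeta^l)^{K-s}. *)
Lemma DFT_coef A s : (size A <= K)%N -> (s < K)%N ->
  K%:R * nc A`_s <= \sum_(l < K) nc A.[zeta ^+ l].
Proof.
move=> sA sK.
have E : K%:R * A`_s = \sum_(l < K) A.[zeta ^+ l] * (zeta ^+ l) ^+ (K - s).
  under eq_bigr => l _ do rewrite (horner_coef_wide _ sA) mulr_suml.
  rewrite exchange_big /=; under eq_bigr => j _.
    under eq_bigr => l _ do rewrite -mulrA -exprD.
    rewrite -mulr_sumr unity_sum //; over.
  rewrite (bigD1 (Ordinal sK)) //= eqxx big1 ?addr0 1?mulrC // => j js.
  by rewrite (negbTE (_ : (j : nat) != s)) ?mulr0.
rewrite -nc_nat -ncM E; apply: le_trans (nc_sum _ _ _) _.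
by apply: ler_sum => l _; rewrite ncM !ncX z1 !expr1n mulr1.
Qed.

(** Parseval's identity. Conjugates of powers of zeta are again nonnegative powers, and H <= K
    excludes aliasing between distinct exponents. *)
Lemma box_parseval H : (0 < H <= K)%N ->
  \sum_(l < K) nc (box H).[zeta ^+ l] ^+ 2 = K%:R / H%:R.
Proof.
move=> /andP[H0 HK]; apply: (@complexI R).
rewrite rmorph_sum /=.
have cz (l : nat) j : (j < K)%N -> ((zeta ^+ l)^*) ^+ j = (zeta ^+ l) ^+ (K - j).
  move=> jK; have zz : zeta ^+ l * (zeta ^+ l)^* = 1.
    by rewrite -nc2C ncX z1 expr1n expr1n.
  have zl : (zeta ^+ l) ^+ j != 0.
    by rewrite -nc_gt0 !ncX z1 !expr1n.
  apply: (mulfI zl); rewrite -exprMn zz expr1n -exprD subnKC ?(ltnW jK) //.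
  by rewrite exprAC zK expr1n.
have E (l : 'I_K) : (nc (box H).[zeta ^+ l] ^+ 2)%:C =
    H%:R ^- 2 * \sum_(i < H) \sum_(j < H) (zeta ^+ l) ^+ (i + (K - j)).
  rewrite nc2C !box_eval rmorphM fmorphV rmorph_nat rmorph_sum /=.
  rewrite mulrACA -expr2 exprVn; congr (_ * _); rewrite mulr_suml; apply: eq_bigr => i _.
  rewrite mulr_sumr; apply: eq_bigr => j _.
  by rewrite rmorphXn /= cz ?exprD // (leq_trans (ltn_ord j)).
under eq_bigr => l _ do rewrite E.
rewrite -mulr_sumr exchange_big /=.
under eq_bigr => i _.
  rewrite exchange_big /=; under eq_bigr => j _.
    rewrite unity_sum; [over | exact: leq_trans (ltn_ord i) HK | exact: leq_trans (ltn_ord j) HK].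
  rewrite (bigD1 i) //= eqxx big1 ?addr0; last first.
    by move=> j ji; rewrite eq_sym (negbTE (_ : (j : nat) != i)).
  over.
rewrite sumr_const card_ord -mulr_natl rmorphM fmorphV !rmorph_nat.
by field; rewrite pnatr_eq0 -lt0n.
Qed.

End DFT.

(** By Fourier inversion a coefficient is at most the mean of |A| over the K-th roots of unity: |B|
    is bounded by M and the squared box has mean 1 / H by Parseval. This is the reason for squaring
    the box. *)
Lemma coef_bound A B H (M : R) : (0 < H)%N -> A = box H ^+ 2 * B ->
  (forall x, nc x = 1 -> nc B.[x] <= M) -> forall s, nc A`_s <= M / H%:R.
Proof.
move=> H0 AE HM s.
have M0 : 0 <= M by apply: le_trans (nc_ge0 _) (HM 1 (nc1 R)).
pose K := maxn (size A) (maxn H s.+1).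
have K0 : (0 < K)%N by rewrite /K !leq_max H0 orbT.
have [zeta [z1 zK zt]] := unity_root_exists K0.
have sA : (size A <= K)%N by rewrite leq_max leqnn.
have sK : (s < K)%N by rewrite /K !leq_max leqnn !orbT.
have HK : (0 < H <= K)%N by rewrite H0 /K !leq_max leqnn orbT.
have Kp : 0 < K%:R :> R by rewrite ltr0n.
have := DFT_coef z1 zK zt sA sK.
rewrite -ler_pdivlMl // => /le_trans; apply.
rewrite ler_pdivrMl //; apply: (@le_trans _ _ (M * (K%:R / H%:R))); last first.
  by rewrite mulrCA.
rewrite -(box_parseval z1 zK zt HK) mulr_sumr; apply: ler_sum => l _.
by rewrite AE hornerM horner_exp ncM ncX mulrC ler_wpM2r ?exprn_ge0 ?nc_ge0 // HM // ncX z1 expr1n.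
Qed.

End CircleKernel.

(** * Weighted l^1 norms of polynomials *)

Section PolyNorm.
Variable R : realType.
Implicit Types (p q : {poly R[i]}) (t : R).
Local Notation nc := (@Normc.normc R).

Definition pabs p : {poly R} := \poly_(i < size p) nc p`_i.

Lemma coef_pabs p i : (pabs p)`_i = nc p`_i.
Proof.
rewrite coef_poly; case: ltnP => // h.
by rewrite nth_default // nc0.
Qed.

(** The norm sum |p_i| t^i. It is submultiplicative, so Neumann series converge in it; applied to
    polynomials in the local variable, t is the radius of a disc around the node. *)
Definition pnorm t p := (pabs p).[t].

Lemma horner_le (p q : {poly R}) t : 0 <= t -> (forall i, p`_i <= q`_i) -> p.[t] <= q.[t].
Proof.
move=> t0 pq; pose n := maxn (size p) (size q).
rewrite (@horner_coef_wide _ n p) ?leq_maxl // (@horner_coef_wide _ n q) ?leq_maxr //.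
by apply: ler_sum => i _; rewrite ler_wpM2r // exprn_ge0.
Qed.

Variable t : R.
Hypothesis t0 : 0 <= t.
Local Notation N := (pnorm t).

Lemma pnorm_ge0 p : 0 <= N p.
Proof.
by rewrite -(horner0 t); apply: horner_le => // i; rewrite coef0 coef_pabs nc_ge0.
Qed.

Lemma coef_pnorm p i : nc p`_i * t ^+ i <= N p.
Proof.
have -> : nc p`_i * t ^+ i = (nc p`_i *: 'X^i).[t] by rewrite hornerZ hornerXn.
apply: horner_le => // j; rewrite coefZ coefXn coef_pabs; case: eqP => [->|_].
  by rewrite mulr1.
by rewrite mulr0 nc_ge0.
Qed.

Lemma pnormD p q : N (p + q) <= N p + N q.
Proof.
rewrite /pnorm -hornerD; apply: horner_le => // i.
by rewrite coefD !coef_pabs coefD ler_ncD.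
Qed.

Lemma pnormM p q : N (p * q) <= N p * N q.
Proof.
rewrite /pnorm -hornerM; apply: horner_le => // i.
rewrite coef_pabs !coefM; apply: le_trans (nc_sum _ _ _) _.
by apply: ler_sum => j _; rewrite ncM !coef_pabs.
Qed.

Lemma pnormZ c p : N (c *: p) = nc c * N p.
Proof.
rewrite /pnorm -hornerZ; congr (_.[t]); apply/polyP => i.
by rewrite coefZ !coef_pabs coefZ ncM.
Qed.

Lemma pnormN p : N (- p) = N p.
Proof. by rewrite -scaleN1r pnormZ ncN nc1 mul1r. Qed.

Lemma pnormC c : N c%:P = nc c.
Proof.
rewrite /pnorm (_ : pabs _ = (nc c)%:P) ?hornerC //; apply/polyP => i.
by rewrite coef_pabs !coefC; case: ifP => // _; rewrite nc0.
Qed.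

Lemma pnorm1 : N 1 = 1.
Proof. by rewrite -polyC1 pnormC nc1. Qed.

Lemma pnormX : N 'X = t.
Proof.
rewrite /pnorm (_ : pabs _ = 'X) ?hornerX //; apply/polyP => i.
by rewrite coef_pabs !coefX; case: eqP => _; rewrite ?nc1 ?nc0.
Qed.

Lemma pnorm_exp p k : N (p ^+ k) <= N p ^+ k.
Proof.
elim: k => [|k IH]; first by rewrite !expr0 pnorm1.
rewrite !exprS; apply: le_trans (pnormM _ _) _.
by rewrite ler_wpM2l // pnorm_ge0.
Qed.

Lemma pnorm_sum (I : Type) (r : seq I) (P : pred I) (F : I -> {poly R[i]}) :
  N (\sum_(i <- r | P i) F i) <= \sum_(i <- r | P i) N (F i).
Proof.
elim/big_rec2 : _ => [|i y1 y2 _ IH]; first by rewrite -(scale0r 1) pnormZ nc0 mul0r.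
by apply: le_trans (pnormD _ _) _; rewrite lerD2l.
Qed.

Lemma pnorm_sub0 p : N (p - (p`_0)%:P) = N p - nc p`_0.
Proof.
have E : pabs (p - (p`_0)%:P) = pabs p - (nc p`_0)%:P.
  apply/polyP => i; rewrite coefB !coef_pabs coefB !coefC.
  by case: i => [|i] /=; rewrite ?subrr ?nc0 ?subr0 ?subrr.
by rewrite /pnorm E !hornerE.
Qed.

Lemma pnorm_expB1 p k : N (p ^+ k - 1) <= (1 + N (p - 1)) ^+ k - 1.
Proof.
elim: k => [|k IH]; first by rewrite !expr0 !subrr -(scale0r 1) pnormZ nc0 mul0r.
rewrite (_ : p ^+ k.+1 - 1 = (p - 1) + (p ^+ k - 1) + (p - 1) * (p ^+ k - 1)); last first.
  by rewrite exprS; ring.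
apply: le_trans (pnormD _ _) _; apply: le_trans (lerD (pnormD _ _) (pnormM _ _)) _.
have b0 := pnorm_ge0 (p - 1); rewrite exprS.
have : N (p - 1) * N (p ^+ k - 1) <= N (p - 1) * ((1 + N (p - 1)) ^+ k - 1) by rewrite ler_wpM2l.
by lra.
Qed.

End PolyNorm.

(** * Inversion modulo a power of the local variable *)

Section LocalInverse.
Variable R : realType.
Variables (a : R[i]) (mu : nat) (t : R).
Hypotheses (a0 : a != 0) (t0 : 0 <= t).
Implicit Types (U V F : {poly R[i]}).
Local Notation nc := (@Normc.normc R).
Local Notation N := (pnorm t).

(** The local coordinate at a, scaled so that 'X = a (1 + Y): powers of 'X then expand by the
    binomial theorem. *)
Definition locvar : {poly R[i]} := a^-1 *: 'X - 1.
Local Notation Y := locvar.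

Lemma comp_polyX_exp (p q : {poly R[i]}) k : (p ^+ k) \Po q = (p \Po q) ^+ k.
Proof. by elim: k => [|k IH]; rewrite ?expr0 ?comp_polyC ?polyC1 // -?polyC1 ?comp_polyC // !exprS comp_polyM IH. Qed.

(* [U] is invertible modulo [Y ^+ mu], with an inverse of norm at most [E]. *)
Definition invb U (E : R) := exists2 V, Y ^+ mu %| U * (V \Po Y) - 1 & N V <= E.

Lemma invb_le U E E' : E <= E' -> invb U E -> invb U E'.
Proof. by move=> EE [V HV NV]; exists V => //; exact: le_trans EE. Qed.

Lemma invb1 : invb 1 1.
Proof. by exists 1; rewrite ?pnorm1 // comp_polyC polyC1 mul1r subrr dvdp0. Qed.

Lemma invbM U1 U2 E1 E2 : invb U1 E1 -> invb U2 E2 -> invb (U1 * U2) (E1 * E2).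
Proof.
move=> [V1 d1 n1] [V2 d2 n2]; exists (V1 * V2).
  rewrite comp_polyM (_ : _ - 1 = (U1 * (V1 \Po Y) - 1) * (U2 * (V2 \Po Y)) + (U2 * (V2 \Po Y) - 1)).
    by rewrite dvdp_add // dvdp_mulr.
  by ring.
by apply: le_trans (pnormM t0 _ _) _; rewrite ler_pM ?pnorm_ge0.
Qed.

Lemma invbX U E k : invb U E -> invb (U ^+ k) (E ^+ k).
Proof.
move=> H; elim: k => [|k IH]; first by rewrite !expr0; exact: invb1.
by rewrite !exprS; exact: invbM.
Qed.

Lemma invb_prod (I : Type) (r : seq I) (P : pred I) (F : I -> {poly R[i]}) (E : I -> R) :
  (forall i, P i -> invb (F i) (E i)) -> invb (\prod_(i <- r | P i) F i) (\prod_(i <- r | P i) E i).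
Proof. by move=> H; elim/big_rec2 : _ => [|i U e Pi]; [exact: invb1 | exact: invbM (H i Pi)]. Qed.

Lemma invb_factor U1 U3 F E : U1 * (F \Po Y) = U3 -> invb U3 E -> invb U1 (N F * E).
Proof.
move=> UF [V d n]; exists (F * V); first by rewrite comp_polyM mulrA UF.
by apply: le_trans (pnormM t0 _ _) _; rewrite ler_wpM2l ?pnorm_ge0.
Qed.

Lemma geometric_le (x : R) k : 0 <= x < 1 -> \sum_(i < k) x ^+ i <= (1 - x)^-1.
Proof.
move=> /andP[x0 x1]; rewrite -[leRHS]mul1r ler_pdivlMr ?subr_gt0 //.
have := subrX1 x k; set S := \sum_(i < k) _ => e.
have xk : 0 <= x ^+ k by rewrite exprn_ge0.
rewrite (_ : S * (1 - x) = - ((x - 1) * S)); last by ring.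
by rewrite -e; lra.
Qed.

(** F = F_0 (1 - S) where S has no constant term, so the Neumann series cut off at [mu] inverts F
    exactly modulo the [mu]-th power, and its norm is at most that of a geometric series. *)
Lemma invb_base F : N (F - (F`_0)%:P) < nc F`_0 ->
  invb (F \Po Y) (nc F`_0 - N (F - (F`_0)%:P))^-1.
Proof.
set b := F`_0; set s := N _ => sb.
have s0 : 0 <= s by exact: pnorm_ge0.
have nb : 0 < nc b by exact: le_lt_trans sb.
have b0 : b != 0 by rewrite -nc_gt0.
pose S := - (b^-1 *: (F - b%:P)).
have SF : F = b *: (1 - S).
  by rewrite /S opprK scalerDr scalerA mulfV // scale1r -mul_polyC mulr1 addrC subrK.
have NS : N S = s / nc b by rewrite /S pnormN pnormZ ncV mulrC.
have XS : 'X %| S.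
  rewrite /S dvdpNr dvdpZr ?invr_eq0 //.
  by rewrite -['X]subr0 -polyC0 dvdp_XsubCl /root !hornerE horner_coef0 subrr.
exists (b^-1 *: \sum_(i < mu) S ^+ i).
  have -> : (F \Po Y) * ((b^-1 *: \sum_(i < mu) S ^+ i) \Po Y) - 1 = - ((S ^+ mu) \Po Y).
    rewrite -comp_polyM {1}SF -scalerAl -scalerAr scalerA mulfV // scale1r.
    have -> : (1 - S) * \sum_(i < mu) S ^+ i = 1 - S ^+ mu.
      by rewrite -[1 - S]opprB mulNr -subrX1 opprB.
    by rewrite comp_polyB comp_polyC polyC1 addrAC subrr add0r.
  rewrite dvdpNr comp_polyX_exp; apply: dvdp_exp2r.
  have /dvdpP[G ->] := XS; rewrite comp_polyM comp_polyX.
  by rewrite dvdp_mull.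
rewrite pnormZ ncV; apply: le_trans (ler_wpM2l _ (pnorm_sum t0 _ _ _)) _.
  by rewrite invr_ge0 nc_ge0.
apply: (@le_trans _ _ ((nc b)^-1 * \sum_(i < mu) (s / nc b) ^+ i)).
  rewrite ler_wpM2l ?invr_ge0 ?nc_ge0 //; apply: ler_sum => i _.
  by rewrite -NS pnorm_exp.
apply: le_trans (ler_wpM2l _ (geometric_le _ _)) _; first by rewrite invr_ge0 nc_ge0.
  by rewrite divr_ge0 ?nc_ge0 // ltr_pdivrMr // mul1r.
rewrite -invfM (_ : nc b * (1 - s / nc b) = nc b - s) //.
by field; rewrite gt_eqF.
Qed.

Lemma invb_near1 F s : N (F - 1) <= s -> s < 1 -> invb (F \Po Y) (1 - s)^-1.
Proof.
move=> Fs s1; set S := F - 1 in Fs.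
have b1 : 1 - nc S`_0 <= nc F`_0.
  have -> : F`_0 = 1 - (- S`_0) by rewrite /S coefB coef1 /=; ring.
  by have := lerB_nc 1 (- S`_0); rewrite nc1 ncN.
have E : F - (F`_0)%:P = S - (S`_0)%:P.
  by rewrite /S coefB coef1 /= polyCB polyC1; ring.
have h := pnorm_sub0 t S.
have hs : 1 - s <= nc F`_0 - N (F - (F`_0)%:P).
  by rewrite E h; clear -b1 Fs; move: (nc F`_0) (nc S`_0) (N S) b1 Fs => x y z; lra.
have s0 : 0 < 1 - s by rewrite subr_gt0.
have sb : N (F - (F`_0)%:P) < nc F`_0 by rewrite -subr_gt0 (lt_le_trans s0).
apply: invb_le (invb_base sb).
by rewrite lef_pV2 ?posrE // (lt_le_trans s0).
Qed.

Definition shiftvar : {poly R[i]} := a *: ('X + 1).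
Local Notation Z := shiftvar.

Lemma shiftvarY : Z \Po Y = 'X.
Proof.
rewrite /Z /Y comp_polyZ comp_polyD comp_polyX comp_polyC polyC1 subrK scalerA.
by rewrite mulfV // scale1r.
Qed.

Lemma comp_shiftvar U : (U \Po Z) \Po Y = U.
Proof. by rewrite -comp_polyA shiftvarY comp_polyXr. Qed.

Lemma invb_affine b : nc a * t < nc (a - b) -> invb ('X - b%:P) (nc (a - b) - nc a * t)^-1.
Proof.
move=> h; have := @invb_base (('X - b%:P) \Po Z); rewrite comp_shiftvar.
have E : ('X - b%:P) \Po Z = a *: 'X + (a - b)%:P.
  rewrite comp_polyB comp_polyX comp_polyC /Z scalerDr polyCB -addrA; congr (_ + (_ - _)).
  by rewrite -mul_polyC mulr1.
rewrite E; have c0 : (a *: 'X + (a - b)%:P)`_0 = a - b.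
  by rewrite coefD coefZ coefX mulr0 add0r coefC.
by rewrite c0 addrK pnormZ pnormX; apply.
Qed.

Lemma pnorm_shiftB1 : N (Z - 1) <= nc (a - 1) + nc a * t.
Proof.
have -> : Z - 1 = a *: 'X + (a - 1)%:P.
  by rewrite /Z scalerDr polyCB polyC1 -addrA; congr (_ + (_ - _)); rewrite -mul_polyC mulr1.
by apply: le_trans (pnormD t0 _ _) _; rewrite pnormZ pnormX pnormC addrC.
Qed.

Lemma pow1D_le (x : R) k : 0 <= x -> k%:R * x <= 2^-1 -> (1 + x) ^+ k <= 1 + 2 * (k%:R * x).
Proof.
move=> x0; elim: k => [|k IH]; first by rewrite expr0 mul0r mulr0 addr0.
rewrite -natr1 mulrDl mul1r => h; have kx : 0 <= k%:R * x by rewrite mulr_ge0.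
have hk : k%:R * x <= 2^-1 by lra.
rewrite exprSr; apply: le_trans (ler_wpM2r _ (IH hk)) _; first by lra.
have : k%:R * x * x <= 2^-1 * x by rewrite ler_wpM2r.
by lra.
Qed.

(** In this range all powers a^i, i < H, stay close to 1, hence so does their mean, and the box is a
    small perturbation of 1. *)
Lemma invb_box_small H (u : R) : (0 < H)%N -> nc (a - 1) + nc a * t <= u ->
  H%:R * u <= 4^-1 -> invb (box R H) (expR (4 * (H%:R * u))).
Proof.
move=> H0 tu Hu.
have u0 : 0 <= u by apply: le_trans tu; rewrite addr_ge0 ?mulr_ge0 ?nc_ge0.
have Hu0 : 0 <= H%:R * u by rewrite mulr_ge0.
have Hn : 0 < H%:R :> R by rewrite ltr0n.
have Hc : (H%:R : R[i]) != 0 by rewrite pnatr_eq0 -lt0n.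
have NB : N (box R H \Po Z - 1) <= 2 * (H%:R * u).
  have -> : box R H \Po Z - 1 = H%:R^-1 *: \sum_(i < H) (Z ^+ i - 1).
    rewrite sumrB sumr_const card_ord scalerBr; congr (_ - _).
      rewrite /box comp_polyZ rmorph_sum /=; congr (_ *: _); apply: eq_bigr => i _.
      by rewrite comp_polyX_exp comp_polyX.
    by rewrite -[X in _ *: X]scaler_nat scalerA mulVf // scale1r.
  rewrite pnormZ ncV nc_nat ler_pdivrMl //; apply: le_trans (pnorm_sum t0 _ _ _) _.
  apply: (@le_trans _ _ (\sum_(i < H) 2 * (H%:R * u))); last first.
    by rewrite sumr_const card_ord -[leLHS]mulr_natl.
  apply: ler_sum => i _; apply: le_trans (pnorm_expB1 t0 _ _) _.
  have q1 : 1 + N (Z - 1) <= 1 + u by rewrite lerD2l (le_trans pnorm_shiftB1).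
  apply: (@le_trans _ _ ((1 + u) ^+ i - 1)).
    by rewrite lerD2r; apply: lerXn2r; rewrite ?nnegrE ?addr_ge0 ?pnorm_ge0.
  have iH : i%:R * u <= H%:R * u by rewrite ler_wpM2r // ler_nat ltnW.
  rewrite lerBlDl; apply: le_trans (pow1D_le u0 _) _; first by lra.
  by rewrite lerD2l ler_wpM2l.
have := invb_near1 NB; rewrite comp_shiftvar => /(_ _)/invb_le; apply; last by lra.
set x := 2 * (H%:R * u); have x1 : 0 < 1 - x by rewrite /x; lra.
rewrite -[leLHS]mul1r ler_pdivrMr //.
apply: (@le_trans _ _ ((1 + 4 * (H%:R * u)) * (1 - x))).
  have x0 : 0 <= x by rewrite /x; lra.
  have xh : x <= 2^-1 by rewrite /x; lra.
  have -> : 4 * (H%:R * u) = 2 * x by rewrite /x; ring.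
  have := ler_wpM2r x0 xh; lra.
by rewrite ler_wpM2r ?(ltW x1) // expR_ge1Dx.
Qed.

Lemma bernoulli (x : R) k : 0 <= x -> 1 + k%:R * x <= (1 + x) ^+ k.
Proof.
move=> x0; elim: k => [|k IH]; first by rewrite expr0 mul0r addr0.
rewrite exprSr; apply: le_trans (ler_wpM2r _ IH); last by lra.
have : 0 <= k%:R * x * x by rewrite !mulr_ge0.
by rewrite -natr1; lra.
Qed.

(** Here |a| exceeds 1 by a margin, so 1/'X has norm below 1 and 'X^H - 1 is inverted through it.
    The box being ('X^H - 1) / (H ('X - 1)), its inverse carries a factor H, cancelled by (1 + q)^H
    - 1 >= H q. *)
Lemma invb_box_large H (u q : R) : (0 < H)%N -> nc (a - 1) + nc a * t <= u ->
  0 < q -> 1 + q <= nc a - nc a * t -> invb (box R H) (u / q).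
Proof.
move=> H0 tu q0 aq.
have u0 : 0 <= u by apply: le_trans tu; rewrite addr_ge0 ?mulr_ge0 ?nc_ge0.
have Hn : 0 < H%:R :> R by rewrite ltr0n.
have Hc : (H%:R : R[i]) != 0 by rewrite pnatr_eq0 -lt0n.
have [I dI NI] : invb 'X (1 + q)^-1.
  have := @invb_affine 0; rewrite subr0 polyC0 subr0 => /(_ _)/invb_le; apply; last by lra.
  by rewrite lef_pV2 ?posrE //; lra.
set r := (1 + q)^-1 in NI; have r0 : 0 < r by rewrite invr_gt0; lra.
have r1 : r < 1 by rewrite invf_lt1; lra.
have rH1 : r ^+ H < 1 by rewrite exprn_ilt1 ?(ltW r0) // -lt0n.
have NIH : N (I ^+ H) <= r ^+ H.
  apply: le_trans (pnorm_exp t0 _ _) _; apply: lerXn2r; rewrite ?nnegrE ?pnorm_ge0 //.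
  exact: ltW.
have NF : N ((1 - I ^+ H) - 1) <= r ^+ H by rewrite addrAC subrr add0r pnormN.
have [V2 d2 N2] := invb_near1 NF rH1.
have dIH : Y ^+ mu %| 'X^H * (I ^+ H \Po Y) - 1.
  by rewrite comp_polyX_exp -exprMn subrX1 dvdp_mulr.
have inv3 : invb ('X^H - 1) (r ^+ H / (1 - r ^+ H)).
  exists (I ^+ H * V2).
    rewrite comp_polyM.
    rewrite (_ : _ - 1 = ('X^H * (I ^+ H \Po Y) - 1) * (V2 \Po Y) +
       (((1 - I ^+ H) \Po Y) * (V2 \Po Y) - 1)).
      by rewrite dvdp_add // dvdp_mulr.
    by rewrite comp_polyB comp_polyC polyC1; ring.
  apply: le_trans (pnormM t0 _ _) _; rewrite ler_pM ?pnorm_ge0 //.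
have E3 : box R H * ((H%:R *: (Z - 1)) \Po Y) = 'X^H - 1.
  rewrite comp_polyZ comp_polyB shiftvarY comp_polyC polyC1 -scalerAr mulrC boxX // scalerA.
  by rewrite mulfV // scale1r.
apply: invb_le (invb_factor E3 inv3).
rewrite pnormZ nc_nat.
have rHE : r ^+ H / (1 - r ^+ H) <= (H%:R * q)^-1.
  rewrite -[leRHS]mul1r ler_pdivlMr ?mulr_gt0 // mulrAC ler_pdivrMr ?subr_gt0 // mul1r.
  have p := bernoulli H (ltW q0).
  have : r ^+ H * (1 + H%:R * q) <= 1.
    rewrite /r exprVn ler_pdivrMl ?exprn_gt0 ?mulr1 //; lra.
  lra.
apply: (@le_trans _ _ (H%:R * u * (H%:R * q)^-1)).
  apply: ler_pM => //; rewrite ?mulr_ge0 ?pnorm_ge0 ?invr_ge0 ?exprn_ge0 ?subr_ge0 ?(ltW r0) ?(ltW rH1) //.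
  by rewrite ler_wpM2l // (le_trans pnorm_shiftB1).
apply: eq_ler; field.
by rewrite !gt_eqF.
Qed.

End LocalInverse.

(** * The discrete functional *)

Section SampleFunctional.
Variable R : realType.
Variables (x1 de : R[i]).
Implicit Types (A B U V : {poly R[i]}) (a : R[i]).
Local Notation nc := (@Normc.normc R).

(** The operator x1 + de X d/dX, which multiplies the s-th coefficient by the grid point x1 + de s;
    its iterates reproduce the monomials x^j on the grid, at the price of one order of vanishing
    each. *)
Definition Theta A : {poly R[i]} := x1 *: A + de *: ('X * A^`()).

Lemma coef_Theta A s : (Theta A)`_s = (x1 + de * s%:R) * A`_s.
Proof.
rewrite coefD !coefZ coefXM; case: s => [|s] /=; first by rewrite !mulr0 !addr0.
by rewrite coef_deriv -[A`_s.+1 *+ _]mulr_natr; ring.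
Qed.

Lemma coef_iter_Theta A j s : (iter j Theta A)`_s = (x1 + de * s%:R) ^+ j * A`_s.
Proof.
by elim: j => [|j IH] /=; rewrite ?expr0 ?mul1r // coef_Theta IH exprS mulrA.
Qed.

Lemma iter_Theta_eval A K j a : (size A <= K)%N ->
  \sum_(s < K) A`_s * ((x1 + de * s%:R) ^+ j * a ^+ s) = (iter j Theta A).[a].
Proof.
move=> sA; rewrite (@horner_coef_wide _ K).
  by apply: eq_bigr => s _; rewrite coef_iter_Theta; ring.
apply/leq_sizeP => s Ks; rewrite coef_iter_Theta nth_default ?mulr0 //.
exact: leq_trans Ks.
Qed.

Lemma iter_ThetaD A B j : iter j Theta (A + B) = iter j Theta A + iter j Theta B.
Proof. by apply/polyP => s; rewrite coefD !coef_iter_Theta coefD mulrDr. Qed.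

Lemma iter_ThetaZ c A j : iter j Theta (c *: A) = c *: iter j Theta A.
Proof. by apply/polyP => s; rewrite coefZ !coef_iter_Theta coefZ mulrCA. Qed.

Lemma iter_ThetaXn s j : iter j Theta 'X^s = (x1 + de * s%:R) ^+ j *: 'X^s.
Proof.
apply/polyP => i; rewrite coefZ !coef_iter_Theta coefXn.
by case: eqP => [->//|_]; rewrite !mulr0.
Qed.

Lemma dvdp_Theta A a i : ('X - a%:P) ^+ i.+1 %| A -> ('X - a%:P) ^+ i %| Theta A.
Proof.
move=> /dvdpP[B ->]; apply/dvdpP.
exists (x1%:P * B * ('X - a%:P) + de%:P * 'X * (B^`() * ('X - a%:P) + B *+ i.+1)).
rewrite /Theta derivM deriv_exp derivXsubC mul1r /= -!mul_polyC exprS.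
by rewrite -[_ ^+ i *+ _]mulr_natr -[B *+ _]mulr_natr; ring.
Qed.

Lemma iter_Theta_root A a k j : ('X - a%:P) ^+ k %| A -> (j < k)%N -> (iter j Theta A).[a] = 0.
Proof.
move=> H jk; have : ('X - a%:P) ^+ (k - j) %| iter j Theta A.
  elim: j jk => [|j IH] jk; first by rewrite subn0.
  by rewrite iterS; apply: dvdp_Theta; rewrite -subSn ?IH // ltnW.
rewrite -(subnSK jk) exprS => /dvdpP[B ->].
by rewrite mulrCA hornerM hornerXsubC subrr mul0r.
Qed.

End SampleFunctional.

(** * Recovery of one coefficient by Newton interpolation *)

Section CoefficientRecovery.
Variable R : realType.
Variables (x1 de a : R[i]) (mu : nat) (c : nat -> R[i]).
Hypotheses (a0 : a != 0) (de0 : de != 0).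
Implicit Types (A B U V : {poly R[i]}).
Local Notation nc := (@Normc.normc R).
Local Notation Th := (Theta x1 de).
Local Notation Y := (locvar a).

(** The pairing of the coefficients A_s with the samples a^s * sum_j c_j (x1 + de s)^j of a single
    block. It vanishes on multiples of (X - a)^mu. *)
Definition Lam A := \sum_(j < mu) c j * (iter j Th A).[a].

Lemma LamD A B : Lam (A + B) = Lam A + Lam B.
Proof.
by rewrite -big_split /=; apply: eq_bigr => j _; rewrite iter_ThetaD hornerD mulrDr.
Qed.

Lemma LamZ k A : Lam (k *: A) = k * Lam A.
Proof.
by rewrite mulr_sumr; apply: eq_bigr => j _; rewrite iter_ThetaZ hornerZ mulrCA.
Qed.

Lemma Lam_sum (I : Type) (r : seq I) (P : pred I) (F : I -> {poly R[i]}) :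
  Lam (\sum_(i <- r | P i) F i) = \sum_(i <- r | P i) Lam (F i).
Proof.
elim/big_rec2 : _ => [|i y1 y2 _ <-]; last by rewrite LamD.
by rewrite -(scale0r 0) LamZ mul0r.
Qed.

Lemma Lam_kill A : Y ^+ mu %| A -> Lam A = 0.
Proof.
have -> : Y = a^-1 *: ('X - a%:P).
  by rewrite scalerBr -[X in _ = _ - X]mul_polyC -polyCM mulVf // polyC1.
rewrite exprZn dvdpZl ?expf_neq0 ?invr_eq0 // => H.
by apply: big1 => j _; rewrite (iter_Theta_root _ _ H) ?mulr0.
Qed.

(* Up to the factor [a ^+ s], [Lam 'X^s] is a sample of [cpoly], so [ndiff i] is its i-th finite
   difference at [x1]. *)
Definition ndiff i := Lam (Y ^+ i).

Definition cpoly : {poly R[i]} := \poly_(j < mu) c j.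

Lemma Lam_Xn s : Lam 'X^s = a ^+ s * cpoly.[x1 + de * s%:R].
Proof.
rewrite horner_poly mulr_sumr; apply: eq_bigr => j _.
by rewrite iter_ThetaXn hornerZ hornerXn; ring.
Qed.

(** Expand 'X^s = a^s (1 + Y)^s by the binomial theorem and apply [Lam]. *)
Lemma newton_value s : cpoly.[x1 + de * s%:R] = \sum_(i < s.+1) ndiff i *+ 'C(s, i).
Proof.
have as0 : a ^+ s != 0 by rewrite expf_neq0.
apply: (mulfI as0); rewrite -Lam_Xn.
have -> : 'X^s = a ^+ s *: \sum_(i < s.+1) (Y ^+ i *+ 'C(s, i)) :> {poly R[i]}.
  have -> : 'X = a *: (1 + Y) :> {poly R[i]}.
    by rewrite addrC subrK scalerA mulfV // scale1r.
  rewrite exprZn exprDn; congr (_ *: _); apply: eq_bigr => i _.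
  by rewrite expr1n mul1r.
rewrite LamZ Lam_sum; congr (_ * _); apply: eq_bigr => i _.
by rewrite -scaler_nat LamZ mulr_natl.
Qed.

Definition newton i : {poly R[i]} := \prod_(l < i) ('X - (x1 + de * l%:R)%:P).

Lemma newton_eval i s : (newton i).[x1 + de * s%:R] = de ^+ i * (s ^_ i)%:R.
Proof.
elim: i => [|i IH]; first by rewrite /newton big_ord0 hornerC expr0 ffactn0 mulr1.
rewrite /newton big_ord_recr -/(newton i) /= hornerM IH hornerXsubC ffactnSr exprSr natrM.
have [si|si] := leqP i s; first by rewrite natrB //; ring.
by rewrite ffact_small // !(mulr0, mul0r).
Qed.

Lemma size_newton i : (size (newton i) <= i.+1)%N.
Proof.
by rewrite /newton size_prod_XsubC /index_enum -enumT size_enum_ord.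
Qed.

(** Both sides have degree below [mu] and agree at the [mu] distinct grid points x1 + de s, s <
    mu. *)
Lemma newton_expansion :
  cpoly = \sum_(i < mu) (ndiff i / (i`!%:R * de ^+ i)) *: newton i.
Proof.
apply/eqP; rewrite -subr_eq0; apply/eqP.
apply: (@roots_geq_poly_eq0 _ _ [seq x1 + de * s%:R | s <- iota 0 mu]).
- apply/allP => x /mapP[s]; rewrite mem_iota add0n => /andP[_ smu] ->.
  apply/rootP; rewrite hornerD hornerN horner_sum newton_value; apply/eqP; rewrite subr_eq0.
  apply/eqP; rewrite (big_ord_widen mu (fun i => ndiff i *+ 'C(s, i)) smu) big_mkcond /=.
  apply: eq_bigr => i _; rewrite hornerZ newton_eval.
  have fi : (i`!)%:R != 0 :> R[i] by rewrite pnatr_eq0 -lt0n fact_gt0.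
  rewrite ltnS; case: leqP => [si|si].
    rewrite -bin_ffact natrM -mulr_natr; field.
    by rewrite fi expf_neq0.
  by rewrite ffact_small // !mulr0.
- rewrite map_inj_uniq ?iota_uniq // => s s' /addrI /(mulfI de0) /eqP.
  by rewrite eqr_nat => /eqP.
- rewrite size_map size_iota; apply: leq_trans (size_polyD _ _) _.
  rewrite geq_max size_poly size_polyN; apply: leq_trans (size_sum _ _ _) _.
  apply/bigmax_leqP => i _; apply: leq_trans (size_scale_leq _ _) _.
  by apply: leq_trans (size_newton _) _.
Qed.

Lemma coef_newton i k (W : R) : (forall l, (l < i)%N -> 1 + nc (x1 + de * l%:R) <= W) ->
  nc (newton i)`_k <= W ^+ i.
Proof.
move=> HW; have := coef_pnorm ler01 (newton i) k; rewrite expr1n mulr1 => /le_trans; apply.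
elim: i HW => [|i IH] HW; first by rewrite /newton big_ord0 expr0 pnorm1.
rewrite /newton big_ord_recr -/(newton i) /= exprSr.
apply: le_trans (pnormM ler01 _ _) _; apply: ler_pM; rewrite ?pnorm_ge0 //.
  by apply: IH => l li; apply: HW; rewrite ltnS ltnW.
apply: le_trans (pnormD ler01 _ _) _; rewrite pnormN pnormX pnormC.
exact: HW.
Qed.

(** If V inverts U modulo Y^mu, then Lam (Y^i) = Lam (Y^i U V(Y)), since [Lam] kills Y^mu. Expanding
    V, the terms with i + l >= mu vanish; in the others T^l <= (T/t)^mu t^l, and the sum of |V_l|
    t^l is the norm of V. *)
Lemma ndiff_bound U (t E S T : R) : 0 < t -> t <= T -> 0 <= S ->
  invb a mu t U E -> (forall j, (j < mu)%N -> nc (Lam (Y ^+ j * U)) <= S * T ^+ j) ->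
  forall i, nc (ndiff i) <= S * E * (T / t) ^+ mu * T ^+ i.
Proof.
move=> t0 tT S0 [V dV NV] HU i.
have T0 : 0 < T by exact: lt_le_trans tT.
have r1 : 1 <= T / t by rewrite ler_pdivlMr // mul1r.
have -> : ndiff i = \sum_(l < size V) V`_l * Lam (Y ^+ (i + l) * U).
  have -> : ndiff i = Lam (Y ^+ i * (U * (V \Po Y))).
    apply/eqP; rewrite -subr_eq0 -mulN1r -LamZ -LamD scaleN1r; apply/eqP.
    apply: Lam_kill; rewrite -opprB dvdpNr -[X in _ - X]mulr1 -mulrBr.
    by rewrite dvdp_mull.
  rewrite comp_polyE !mulr_sumr Lam_sum; apply: eq_bigr => l _.
  by rewrite -!scalerAr LamZ exprD; congr (_ * Lam _); ring.
apply: le_trans (nc_sum _ _ _) _.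
apply: (@le_trans _ _ (\sum_(l < size V) (nc V`_l * t ^+ l) * (S * (T / t) ^+ mu * T ^+ i))).
  apply: ler_sum => l _; rewrite ncM -mulrA ler_wpM2l ?nc_ge0 //.
  have Tt0 : 0 <= T / t by rewrite divr_ge0 // ltW.
  have [lm|ml] := ltnP (i + l) mu.
    apply: le_trans (HU _ lm) _; rewrite exprD [leRHS](_ : _ = S * (T ^+ i * (t ^+ l * (T / t) ^+ mu))); last by ring.
    rewrite ler_wpM2l // ler_wpM2l ?exprn_ge0 ?(ltW T0) //.
    rewrite -{1}[T](divfK (lt0r_neq0 t0)) exprMn mulrC ler_wpM2l ?exprn_ge0 ?(ltW t0) //.
    by apply: ler_weXn2l => //; apply: leq_trans (ltnW lm); rewrite leq_addl.
  rewrite Lam_kill ?nc0; last by rewrite -(subnKC ml) exprD -mulrA dvdp_mulr.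
  by rewrite !mulr_ge0 ?exprn_ge0 ?(ltW t0) ?(ltW T0).
rewrite -mulr_suml.
have -> : \sum_(l < size V) nc V`_l * t ^+ l = pnorm t V.
  rewrite /pnorm (@horner_coef_wide _ (size V)) ?size_poly //.
  by apply: eq_bigr => l _; rewrite coef_pabs.
apply: (@le_trans _ _ (E * (S * (T / t) ^+ mu * T ^+ i))).
  by rewrite ler_wpM2r // !mulr_ge0 ?exprn_ge0 ?divr_ge0 ?(ltW t0) ?(ltW T0).
by apply: eq_ler; ring.
Qed.

Lemma coefficient_bound U (t E S T W : R) k : 0 < t -> t <= T -> 0 <= S -> 0 <= E ->
  (forall l, (l < mu)%N -> 1 + nc (x1 + de * l%:R) <= W) ->
  invb a mu t U E -> (forall j, (j < mu)%N -> nc (Lam (Y ^+ j * U)) <= S * T ^+ j) ->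
  (k < mu)%N ->
  nc (c k) <= S * E * (T / t) ^+ mu * \sum_(i < mu) (T * W / nc de) ^+ i / i`!%:R.
Proof.
move=> t0 tT S0 E0 HW iU HU kmu.
have nd : 0 < nc de by rewrite nc_gt0.
have W0 : 0 <= W.
  apply: le_trans (HW 0%N _); last by exact: leq_ltn_trans kmu.
  by rewrite addr_ge0 // nc_ge0.
have T0 : 0 < T by exact: lt_le_trans tT.
have -> : c k = cpoly`_k by rewrite coef_poly kmu.
rewrite newton_expansion coef_sum; apply: le_trans (nc_sum _ _ _) _.
rewrite mulr_sumr; apply: ler_sum => i _.
rewrite coefZ ncM; apply: (@le_trans _ _ (nc (ndiff i / (i`!%:R * de ^+ i)) * W ^+ i)).
  by rewrite ler_wpM2l ?nc_ge0 // coef_newton // => l li; apply: HW; apply: ltn_trans li _.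
have fi : 0 < (i`!)%:R :> R by rewrite ltr0n fact_gt0.
rewrite ncM ncV ncM nc_nat ncX.
rewrite [leRHS](_ : _ = S * E * (T / t) ^+ mu * T ^+ i / (i`!%:R * nc de ^+ i) * W ^+ i).
  rewrite ler_wpM2r ?exprn_ge0 // ler_wpM2r ?invr_ge0 ?mulr_ge0 ?exprn_ge0 ?nc_ge0 ?(ltW fi) //.
  exact: (ndiff_bound t0 tT S0 iU HU).
rewrite (_ : (T * W / nc de) ^+ i = T ^+ i * W ^+ i / nc de ^+ i); last by rewrite !exprMn exprVn.
have dn : nc de ^+ i != 0 by rewrite expf_neq0 // gt_eqF.
move: ((T / t) ^+ mu) (T ^+ i) (W ^+ i) (nc de ^+ i) dn => z1 z2 z3 z4 dn.
by field; rewrite dn gt_eqF.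
Qed.

End CoefficientRecovery.

(** * Killers and boxes near a node *)

Section Nodes.
Variables (R : realType) (c0 de : R).
Hypotheses (c00 : 0 < c0) (c01 : c0 <= 1) (de0 : 0 < de).
Local Notation nc := (@Normc.normc R).

Definition node (z : R[i]) := cexp (de%:C * z).

Lemma expR_le2 (x : R) : x <= 2^-1 -> expR x <= 2.
Proof. by move=> h; apply: le_trans (@expR_half R); rewrite ler_expR. Qed.

Section OneNode.
Variable z : R[i].
Hypotheses (sz : c0 * nc z <= Re z) (dz : de * nc z <= 8^-1).

Let ncw : nc (de%:C * z) = de * nc z.
Proof. by rewrite ncM ncR ger0_norm // ltW. Qed.

Lemma nodeB1_le : nc (node z - 1) <= 2 * (de * nc z).
Proof.
apply: le_trans (nc_cexpB1 _) _; rewrite ncw mulrC ler_wpM2r ?mulr_ge0 ?nc_ge0 ?(ltW de0) //.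
by apply: expR_le2; apply: le_trans dz _; lra.
Qed.

Lemma node_le2 : nc (node z) <= 2.
Proof. by apply: le_trans (nc_cexp_le _) _; rewrite ncw; apply: expR_le2; apply: le_trans dz _; lra. Qed.

Lemma node_ge : 1 + c0 * (de * nc z) <= nc (node z).
Proof.
rewrite nc_cexp ReM /= mul0r subr0; apply: le_trans (expR_ge1Dx _).
by rewrite lerD2l mulrCA ler_wpM2l // ltW.
Qed.

Lemma node_ge1 : 1 <= nc (node z).
Proof. by apply: le_trans node_ge; rewrite lerDl !mulr_ge0 ?nc_ge0 // ltW. Qed.

Lemma nodeB1_ge : c0 * (de * nc z) <= nc (node z - 1).
Proof. by have := lerB_nc (node z) 1; have := node_ge; rewrite nc1; lra. Qed.

Lemma node_neq0 : node z != 0.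
Proof. exact: cexp_neq0. Qed.

(** The constant with (X - X_z)(X - 1/X_z) = X (X - 2 + 1/X - kap); the product equals -kap at X =
    1. *)
Definition kap := node z - 2 + (node z)^-1.

Lemma kapE : kap = (node z - 1) ^+ 2 / node z.
Proof. by rewrite /kap; field; exact: node_neq0. Qed.

Lemma nc_kap : nc kap = nc (node z - 1) ^+ 2 / nc (node z).
Proof. by rewrite kapE ncM ncX ncV. Qed.

Lemma kap_ge : (c0 * (de * nc z)) ^+ 2 / 2 <= nc kap.
Proof.
rewrite nc_kap; apply: ler_pM.
- by rewrite exprn_ge0 // !mulr_ge0 ?nc_ge0 // ltW.
- by rewrite invr_ge0.
- by apply: lerXn2r nodeB1_ge; rewrite nnegrE ?nc_ge0 // !mulr_ge0 ?nc_ge0 // ltW.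
- by rewrite lef_pV2 ?posrE ?node_le2 // nc_gt0 node_neq0.
Qed.

(** The reciprocal root makes the quadratic self-reciprocal: on the unit circle it is x (-|x-1|^2 -
    kap), so after division by kap its modulus depends on x only through |x-1|^2 and is 1 at x =
    1. *)
Definition killer : {poly R[i]} := kap^-1 *: (('X - (node z)%:P) * ('X - ((node z)^-1)%:P)).

Lemma killer_dvd : ('X - (node z)%:P) %| killer.
Proof. by rewrite /killer scalerAr dvdp_mulIl. Qed.

Lemma size_killer : (size killer <= 3)%N.
Proof.
apply: leq_trans (size_scale_leq _ _) _.
by rewrite size_mul ?polyXsubC_eq0 // !size_XsubC.
Qed.

Lemma killer_circle x : kap != 0 -> nc x = 1 -> nc killer.[x] <= 1 + nc (x - 1) ^+ 2 / nc kap.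
Proof.
move=> k0 x1; have x0 : x != 0 by rewrite -nc_gt0 x1.
have xx : x^-1 = x^*.
  by apply: (mulfI x0); rewrite mulfV // -nc2C x1 expr1n.
have xE : x - 2 + x^-1 = - (nc (x - 1) ^+ 2)%:C.
  have -> : (nc (x - 1) ^+ 2)%:C = (x - 1) * (x^-1 - 1).
    by rewrite nc2C rmorphB rmorph1 xx.
  by field.
have -> : killer.[x] = x * (- (nc (x - 1) ^+ 2)%:C / kap - 1).
  rewrite /killer hornerZ hornerM !hornerXsubC -xE.
  have -> : (x - node z) * (x - (node z)^-1) = x * (x - 2 + x^-1 - kap).
    by rewrite /kap; field; rewrite node_neq0.
  by move: k0; move: kap => k k0; field; rewrite k0.
rewrite ncM x1 mul1r; apply: le_trans (ler_ncB _ _) _; rewrite nc1 addrC lerD2l ncM ncN ncV ncR.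
by rewrite ger0_norm // sqr_ge0.
Qed.

End OneNode.

Section TwoNodes.
Variables (y z : R[i]) (mu : nat) (B : R).
Hypotheses (sy : c0 * nc y <= Re y) (dy : de * nc y <= 8^-1) (y0 : y != 0) (B1 : 1 <= B).

(** Radius of the local norm at [node y], with [B] the separation constant of y. The 16 makes |X_y|
    tau at most a quarter of |X_y - X_z| and an eighth of c0 de |y|, so no root of a killer comes
    near the disc. *)
Definition tau := de * nc y * c0 / (16 * B).

Let ny0 : 0 < nc y. Proof. by rewrite nc_gt0. Qed.
Let dny0 : 0 < de * nc y. Proof. by rewrite mulr_gt0. Qed.

Lemma tau_gt0 : 0 < tau.
Proof. by rewrite /tau divr_gt0 ?mulr_gt0 // (lt_le_trans ltr01). Qed.

Lemma node_tau_le : nc (node y) * tau <= c0 * (de * nc y) / 8.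
Proof.
have Bp : 0 < B by exact: lt_le_trans B1.
apply: (@le_trans _ _ (2 * tau)); first by rewrite ler_wpM2r ?node_le2 // ltW // tau_gt0.
rewrite /tau (_ : 2 * _ = c0 * (de * nc y) / 8 / B); last by field; rewrite gt_eqF.
by rewrite ler_pdivrMr // ler_peMr // divr_ge0 // mulr_ge0 // ltW.
Qed.

(** The two regimes are separated by H u = 1/4 with u = 3 de |y|. In the second one the inverse has
    norm at most 6 / c0, and H de |y| > 1/12 makes this at most the exponent, which is where 72
    comes from. *)
Lemma box_invb H : (0 < H)%N ->
  invb (node y) mu tau (box R H) (expR (72 / c0 * (H%:R * (de * nc y)))).
Proof.
move=> H0; have t0 := ltW tau_gt0; have nt := node_tau_le.
have cd : c0 * (de * nc y) <= de * nc y by rewrite ler_piMl // ltW.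
set u := 3 * (de * nc y).
have tu : nc (node y - 1) + nc (node y) * tau <= u.
  by have := nodeB1_le dy; rewrite /u; move: dny0; lra.
have Hn : 0 < H%:R :> R by rewrite ltr0n.
have Hd : 0 < H%:R * (de * nc y) by rewrite mulr_gt0.
have c12 : 72 <= 72 / c0 by rewrite ler_pdivlMr // ler_piMr.
have [Hu|Hu] := leP (H%:R * u) 4^-1.
  apply: invb_le (invb_box_small mu (@node_neq0 y) t0 H0 tu Hu).
  rewrite ler_expR /u; apply: (@le_trans _ _ (72 * (H%:R * (de * nc y)))); first by lra.
  by rewrite ler_wpM2r // ltW.
have q0 : 0 < c0 / 2 * (de * nc y) by rewrite mulr_gt0 // divr_gt0.
apply: invb_le (@invb_box_large _ _ mu _ (@node_neq0 y) t0 H u _ H0 tu q0 _); last first.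
  by have := node_ge sy; have := mulr_gt0 c00 dny0; lra.
rewrite /u (_ : 3 * (de * nc y) / (c0 / 2 * (de * nc y)) = 6 / c0); last by field; rewrite !gt_eqF.
apply: le_trans (expR_ge1Dx _); apply: (@le_trans _ _ (72 / c0 * (H%:R * (de * nc y)))); last by lra.
have i0 : 0 < c0^-1 by rewrite invr_gt0.
have : 12^-1 < H%:R * (de * nc y) by move: Hu; rewrite /u; lra.
by move=> /ltW /(ler_wpM2l (ltW i0)); lra.
Qed.

Hypotheses (sz : c0 * nc z <= Re z) (dz : de * nc z <= 8^-1) (z0 : z != 0)
  (yB : nc y <= B * nc (y - z)).

Let nz0 : 0 < nc z. Proof. by rewrite nc_gt0. Qed.
Let dnz0 : 0 < de * nc z. Proof. by rewrite mulr_gt0. Qed.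

Let nyz0 : 0 < nc (y - z).
Proof.
have Bp : 0 < B by exact: lt_le_trans B1.
by rewrite -(pmulr_rgt0 _ Bp); exact: lt_le_trans yB.
Qed.

Lemma node_sep : de * nc (y - z) / 2 <= nc (node y - node z).
Proof.
set w := de%:C * (y - z).
have nw : nc w = de * nc (y - z) by rewrite ncM ncR ger0_norm // ltW.
have -> : node y - node z = node z * (cexp w - 1).
  by rewrite /node /w mulrBr -cexpD mulr1 -mulrDr [z + _]addrC subrK.
have w4 : nc w <= 4^-1.
  rewrite nw; have := ler_wpM2l (ltW de0) (ler_ncB y z); rewrite mulrDr.
  by move: dy dz; lra.
have w0 := nc_ge0 w.
have h : nc w / 2 <= nc (cexp w - 1).
  have h1 := lerB_nc w (w - (cexp w - 1)); rewrite subKr in h1.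
  have h2 := nc_cexpB1B w; rewrite [nc (_ - 1 - w)]ncB in h2.
  have e2 : expR (nc w) <= 2 by apply: expR_le2; lra.
  have h3 : nc w ^+ 2 * expR (nc w) <= nc w * (nc w * 2).
    by rewrite expr2 -mulrA ler_wpM2l // ler_wpM2l.
  have h4 : nc w * (nc w * 2) <= nc w * 2^-1 by rewrite ler_wpM2l //; lra.
  by lra.
rewrite -nw ncM; apply: le_trans h _.
by rewrite ler_peMl ?nc_ge0 // node_ge1.
Qed.

Lemma node_tau_le_sep : nc (node y) * tau <= nc (node y - node z) / 4.
Proof.
have Bp : 0 < B by exact: lt_le_trans B1.
have ns := node_sep.
apply: (@le_trans _ _ (2 * tau)); first by rewrite ler_wpM2r ?node_le2 // ltW // tau_gt0.
apply: (@le_trans _ _ (de * nc (y - z) / 8)); last by lra.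
rewrite /tau (_ : 2 * _ = de * (c0 * nc y / B) / 8); last by field; rewrite gt_eqF.
rewrite ler_wpM2r ?invr_ge0 // ler_wpM2l ?(ltW de0) // ler_pdivrMr // mulrC [leRHS]mulrC.
by apply: le_trans yB; rewrite mulrC ler_piMl // ltW.
Qed.

Let E := nc (kap z) / ((nc (node y - node z) - nc (node y) * tau) *
  (nc (node y - (node z)^-1) - nc (node y) * tau)).

Lemma node_inv_sep : c0 * (de * nc y) <= nc (node y - (node z)^-1).
Proof.
have := lerB_nc (node y) (node z)^-1; rewrite ncV.
have : (nc (node z))^-1 <= 1 by rewrite invf_le1 ?node_ge1 // (lt_le_trans ltr01) // node_ge1.
by have := node_ge sy; lra.
Qed.

Let d1 : 0 < nc (node y - node z) - nc (node y) * tau.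
Proof.
have := node_tau_le_sep; have := node_sep.
have : 0 < de * nc (y - z) by rewrite mulr_gt0.
lra.
Qed.

Let d2 : 0 < nc (node y - (node z)^-1) - nc (node y) * tau.
Proof.
have := node_tau_le; have := node_inv_sep.
have : 0 < c0 * (de * nc y) by rewrite mulr_gt0.
lra.
Qed.

Let kap0 : 0 < nc (kap z).
Proof. by apply: lt_le_trans (kap_ge sz dz); rewrite divr_gt0 // exprn_gt0 // mulr_gt0. Qed.

Lemma killer_invbE : invb (node y) mu tau (killer z) E.
Proof.
have t0 := ltW tau_gt0; have k0 : kap z != 0 by rewrite -nc_gt0.
have H1 : nc (node y) * tau < nc (node y - node z) by rewrite -subr_gt0.
have H2 : nc (node y) * tau < nc (node y - (node z)^-1) by rewrite -subr_gt0.
have [V dV nV] := invbM t0 (invb_affine mu (@node_neq0 y) t0 H1) (invb_affine mu (@node_neq0 y) t0 H2).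
exists (kap z *: V).
  rewrite comp_polyZ /killer -scalerAl -scalerAr scalerA mulVf // scale1r.
  exact: dV.
by rewrite pnormZ /E ler_wpM2l ?nc_ge0 // invfM.
Qed.

(** The sector keeps X_y outside and 1/X_z inside the unit circle, so only the root X_z can be close
    to X_y; that distance is comparable to de |y - z| and produces the closeness factor. *)
Lemma E_near : nc z <= 12 / c0 * nc y ->
  E <= 128 * (12 / c0) ^+ 2 / c0 * Num.max 1 (nc y / (4 * nc (y - z))).
Proof.
move=> near.
have k4 : nc (kap z) <= 4 * (de * nc z) ^+ 2.
  rewrite nc_kap; apply: (@le_trans _ _ (nc (node z - 1) ^+ 2)).
    rewrite ler_pdivrMr ?(lt_le_trans ltr01) ?node_ge1 // ler_peMr ?sqr_ge0 //.
    exact: node_ge1.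
  have -> : 4 * (de * nc z) ^+ 2 = (2 * (de * nc z)) ^+ 2 by ring.
  by apply: lerXn2r (nodeB1_le dz); rewrite nnegrE ?nc_ge0 // mulr_ge0 // ltW.
have dyz : 0 < de * nc (y - z) by rewrite mulr_gt0.
have cd : 0 < c0 * (de * nc y) by rewrite mulr_gt0.
have b1 : de * nc (y - z) / 4 <= nc (node y - node z) - nc (node y) * tau.
  by have := node_tau_le_sep; have := node_sep; lra.
have b2 : c0 * (de * nc y) / 2 <= nc (node y - (node z)^-1) - nc (node y) * tau.
  by have := node_tau_le; have := node_inv_sep; lra.
have i0 : 0 < c0^-1 by rewrite invr_gt0.
apply: (@le_trans _ _ (4 * (de * nc z) ^+ 2 / (de * nc (y - z) / 4 * (c0 * (de * nc y) / 2)))).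
  apply: ler_pM; rewrite ?nc_ge0 ?invr_ge0 ?mulr_ge0 ?(ltW d1) ?(ltW d2) //.
  rewrite lef_pV2 ?posrE ?mulr_gt0 ?divr_gt0 //.
  by apply: ler_pM => //; rewrite divr_ge0 // ltW.
apply: (@le_trans _ _ (128 * (12 / c0) ^+ 2 / c0 * (nc y / (4 * nc (y - z))))); last first.
  by rewrite ler_wpM2l ?le_max ?lexx ?orbT // !mulr_ge0 ?exprn_ge0 ?mulr_ge0 ?(ltW i0).
rewrite (_ : 4 * _ / _ = 32 / (c0 * nc y * nc (y - z)) * nc z ^+ 2); last first.
  by field; rewrite !gt_eqF.
rewrite (_ : 128 * _ / c0 * _ = 32 / (c0 * nc y * nc (y - z)) * (12 / c0 * nc y) ^+ 2); last first.
  by field; rewrite !gt_eqF.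
rewrite ler_wpM2l ?divr_ge0 ?mulr_ge0 ?nc_ge0 ?(ltW c00) //.
by apply: lerXn2r near; rewrite nnegrE ?nc_ge0 // !mulr_ge0 ?(ltW i0) ?(ltW ny0).
Qed.

Lemma inv1B_le_expR (x : R) : 0 <= x <= 2^-1 -> (1 - x)^-1 <= expR (2 * x).
Proof.
move=> /andP[x0 xh]; have x1 : 0 < 1 - x by lra.
rewrite -[leLHS]mul1r ler_pdivrMr //.
apply: (@le_trans _ _ ((1 + 2 * x) * (1 - x))); first by have := ler_wpM2r x0 xh; lra.
by rewrite ler_wpM2r ?(ltW x1) // expR_ge1Dx.
Qed.

(** For z far from y both X_y - X_z and X_y - 1/X_z differ from their values with X_y replaced by 1
    by a relative error O(|y|/|z|), and the product of those values is -kap. The inverse is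
    therefore 1 + O(|y|/|z|), which can be multiplied over infinitely many z. *)
Lemma E_far : 12 / c0 * nc y <= nc z -> E <= expR (24 / c0 * (nc y / nc z)).
Proof.
move=> far; have i0 : 0 < c0^-1 by rewrite invr_gt0.
pose k := 3 * (de * nc y); pose v := nc (node z - 1).
have cd : c0 * (de * nc y) <= de * nc y by rewrite ler_piMl // ltW.
have k0 : 0 < k by rewrite mulr_gt0.
have v1 : c0 * (de * nc z) <= v := nodeB1_ge sz.
have v0 : 0 < v by apply: lt_le_trans v1; rewrite mulr_gt0.
have kb : nc (node y - 1) + nc (node y) * tau <= k.
  by have := nodeB1_le dy; have := node_tau_le; rewrite /k; move: dny0; lra.
pose x := 2 * k / v.
have x0 : 0 <= x by rewrite divr_ge0 ?mulr_ge0 // ltW.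
have xb : x <= 6 / c0 * (nc y / nc z).
  rewrite /x ler_pdivrMr //; apply: le_trans (ler_wpM2l _ v1); last first.
    by rewrite !mulr_ge0 ?invr_ge0 ?(ltW c00) ?nc_ge0.
  apply: eq_ler; rewrite /k; field.
  by rewrite !gt_eqF.
have xh : x <= 2^-1.
  apply: le_trans xb _; rewrite mulrA ler_pdivrMr //.
  by move: far; lra.
have m2 := node_le2 dz; have m1 := node_ge1 sz.
have mp : 0 < nc (node z) by exact: lt_le_trans m1.
have b1 : v * (1 - x) <= nc (node y - node z) - nc (node y) * tau.
  have := ler_ncD3 (node z) (node y) 1; rewrite -/v [nc (node z - node y)]ncB.
  have -> : v * (1 - x) = v - 2 * k by rewrite /x; field; rewrite gt_eqF.
  by lra.
have b2 : v / nc (node z) * (1 - x) <= nc (node y - (node z)^-1) - nc (node y) * tau.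
  have h := ler_ncD3 (node z)^-1 (node y) 1; rewrite [nc (_^-1 - node y)]ncB in h.
  have e1 : nc ((node z)^-1 - 1) = v / nc (node z).
    rewrite (_ : _^-1 - 1 = - ((node z - 1) / node z)); last by field; exact: node_neq0.
    by rewrite ncN ncM ncV.
  rewrite e1 in h.
  have : v / nc (node z) * (1 - x) <= v / nc (node z) - k.
    rewrite mulrBr mulr1 lerD2l lerN2 /x.
    rewrite (_ : v / nc (node z) * (2 * k / v) = k * (2 / nc (node z))); last by field; rewrite !gt_eqF.
    by rewrite ler_peMr ?(ltW k0) // ler_pdivlMr // mul1r.
  by lra.
have x1 : 0 < 1 - x by lra.
apply: (@le_trans _ _ (v ^+ 2 / nc (node z) / (v * (1 - x) * (v / nc (node z) * (1 - x))))).
  rewrite /E nc_kap -/v ler_wpM2l ?divr_ge0 ?sqr_ge0 ?nc_ge0 //.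
  rewrite lef_pV2 ?posrE ?mulr_gt0 ?invr_gt0 //.
  by apply: ler_pM => //; rewrite ?mulr_ge0 ?invr_ge0 ?(ltW v0) ?(ltW x1) ?(ltW mp).
rewrite [leLHS](_ : _ = (1 - x)^-1 * (1 - x)^-1); last by field; rewrite !gt_eqF.
have xx : 0 <= x <= 2^-1 by rewrite x0.
apply: (@le_trans _ _ (expR (2 * x) * expR (2 * x))).
  by apply: ler_pM; rewrite ?invr_ge0 ?(ltW x1) // inv1B_le_expR.
rewrite -expRD ler_expR; lra.
Qed.

(** Both regimes are put in the single form closeness times exp (C min (1, |y|/|z|)), suited to
    [density_sum]: for near z the minimum is at least c0 / 12, so it pays for a constant. *)
Lemma killer_invb : invb (node y) mu tau (killer z)
  (Num.max 1 (nc y / (4 * nc (y - z))) *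
   expR ((128 * (12 / c0) ^+ 2 / c0 * (12 / c0) + 24 / c0) * Num.min 1 (nc y / nc z))).
Proof.
have i0 : 0 < c0^-1 by rewrite invr_gt0.
apply: invb_le killer_invbE; set C1 := 128 * _ / c0.
have C10 : 0 <= C1 by rewrite /C1 !mulr_ge0 ?exprn_ge0 ?mulr_ge0 ?(ltW i0).
have m0 : 0 <= Num.min 1 (nc y / nc z) by rewrite le_min ler01 divr_ge0 ?nc_ge0.
have r0 : 0 < 12 / c0 by rewrite mulr_gt0.
have [near|far] := leP (nc z) (12 / c0 * nc y).
  apply: le_trans (E_near near) _; rewrite -/C1 mulrC ler_wpM2l ?(le_trans ler01) ?le_max ?lexx //.
  apply: le_trans (expR_ge1Dx _); apply: (@le_trans _ _ (C1 * (12 / c0) * Num.min 1 (nc y / nc z))).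
    rewrite -mulrA ler_peMr // mulrC minr_pMl ?(ltW r0) // le_min mul1r; apply/andP; split.
      by rewrite ler_pdivlMr // mul1r (le_trans c01) // ler1n.
    by rewrite mulrAC ler_pdivlMr // mul1r mulrC.
  have : 0 <= 24 / c0 * Num.min 1 (nc y / nc z) by rewrite mulr_ge0 // mulr_ge0 // ltW.
  by rewrite mulrDl; lra.
apply: le_trans (E_far (ltW far)) _.
apply: (@le_trans _ _ (1 * expR ((C1 * (12 / c0) + 24 / c0) * Num.min 1 (nc y / nc z)))); last first.
  by rewrite ler_wpM2r ?expR_ge0 // le_max lexx.
rewrite mul1r ler_expR (_ : Num.min 1 _ = nc y / nc z); last first.
  apply: min_idPr; rewrite ler_pdivrMr // mul1r; apply: le_trans (ltW far).
  by rewrite ler_peMl ?(ltW ny0) // ler_pdivlMr // mul1r (le_trans c01) // ler1n.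
by rewrite ler_wpM2r ?divr_ge0 ?nc_ge0 // lerDr mulr_ge0 // ltW.
Qed.

End TwoNodes.
End Nodes.

(** * Growth on the unit circle against decay of the boxes *)

Section CircleBounds.
Variables (R : realType) (c0 de : R).
Hypotheses (c00 : 0 < c0) (c01 : c0 <= 1) (de0 : 0 < de).
Local Notation nc := (@Normc.normc R).

(** The killer grows like 1 + s^2 / |kap| with s = |x - 1|, and the squared box is at most 1 / (1 +
    h^2 s^2 / 4). As |kap| >= (c0 de |z|)^2 / 2, the ratio of the two coefficients of s^2 is at most
    8 / (c0 h de |z|)^2. *)
Lemma killer_box_circle z h x : c0 * nc z <= Re z -> de * nc z <= 8^-1 -> z != 0 ->
  (0 < h)%N -> nc x = 1 ->
  nc (killer de z * box R (h + h) ^+ 2).[x] <= Num.max 1 (8 / (c0 * (h%:R * de * nc z)) ^+ 2).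
Proof.
move=> sz dz z0 h0 x1; rewrite hornerM horner_exp ncM ncX.
have nz : 0 < nc z by rewrite nc_gt0.
have hp : 0 < h%:R :> R by rewrite ltr0n.
set d := de * nc z; have d0 : 0 < d by rewrite mulr_gt0.
have cd0 : 0 < c0 * d by rewrite mulr_gt0.
have kg := kap_ge c00 de0 sz dz; rewrite -/d in kg.
have kp : 0 < nc (kap de z) by apply: lt_le_trans kg; rewrite divr_gt0 // exprn_gt0.
have k0 : kap de z != 0 by rewrite -nc_gt0.
have := killer_circle k0 x1; set s2 := nc (x - 1) ^+ 2 => kc.
have s20 : 0 <= s2 by rewrite sqr_ge0.
have := nc_box_decay h0 x1; rewrite -/s2; set b := nc _ ^+ 2 => bd.
have b0 : 0 <= b by rewrite sqr_ge0.
set G := Num.max _ _.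
have G1 : 1 <= G by rewrite le_max lexx.
have G2 : 8 / (c0 * (h%:R * de * nc z)) ^+ 2 <= G by rewrite le_max lexx orbT.
have key : 1 + s2 / nc (kap de z) <= G * (1 + h%:R ^+ 2 * s2 / 4).
  rewrite mulrDr mulr1; apply: lerD => //.
  apply: (@le_trans _ _ (8 / (c0 * (h%:R * de * nc z)) ^+ 2 * (h%:R ^+ 2 * s2 / 4))); last first.
    by rewrite ler_wpM2r // divr_ge0 // mulr_ge0 // exprn_ge0 // ltW.
  rewrite (_ : 8 / _ * _ = s2 * ((c0 * d) ^+ 2 / 2)^-1); last first.
    by rewrite /d; field; rewrite !gt_eqF.
  by rewrite ler_wpM2l // lef_pV2 ?posrE // divr_gt0 // exprn_gt0.
apply: (@le_trans _ _ ((1 + s2 / nc (kap de z)) * b)); first by rewrite ler_wpM2r.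
apply: (@le_trans _ _ (G * (1 + h%:R ^+ 2 * s2 / 4) * b)); first by rewrite ler_wpM2r.
rewrite -mulrA ler_piMr ?(le_trans ler01) // mulrC.
exact: bd.
Qed.

(** The linear growth s + 2d, with d = de |y|, is at most 4d (1 + s^2 / (4 d^2)), a quadratic that
    the squared box absorbs. The factor d that remains cancels later the division by [de] in the
    Newton coefficients. *)
Lemma locvar_box_circle y h x : c0 * nc y <= Re y -> de * nc y <= 8^-1 -> y != 0 ->
  (0 < h)%N -> nc x = 1 ->
  nc (locvar (node de y) * box R (h + h) ^+ 2).[x] <=
    4 * (de * nc y) * Num.max 1 ((h%:R * de * nc y) ^- 2).
Proof.
move=> sy dy y0 h0 x1; rewrite hornerM horner_exp ncM ncX.
have ny : 0 < nc y by rewrite nc_gt0.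
have hp : 0 < h%:R :> R by rewrite ltr0n.
set d := de * nc y; have d0 : 0 < d by rewrite mulr_gt0.
have := nc_box_decay h0 x1; set s := nc (x - 1); set b := nc _ ^+ 2 => bd.
have s0 : 0 <= s by exact: nc_ge0.
have b0 : 0 <= b by rewrite sqr_ge0.
set G := Num.max _ _.
have G1 : 1 <= G by rewrite le_max lexx.
have G2 : (h%:R * de * nc y) ^- 2 <= G by rewrite le_max lexx orbT.
have n1 := node_ge1 c00 de0 sy.
have np : 0 < nc (node de y) by exact: lt_le_trans n1.
have Yb : nc (locvar (node de y)).[x] <= s + 2 * d.
  rewrite /locvar hornerD hornerN hornerZ hornerX -polyC1 hornerC.
  rewrite (_ : _ - 1 = (x - node de y) / node de y); last by field; exact: node_neq0.
  rewrite ncM ncV ler_pdivrMr //; apply: (@le_trans _ _ (s + 2 * d)).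
    apply: le_trans (ler_ncD3 _ 1 _) _; rewrite lerD2l ncB.
    exact: nodeB1_le.
  by rewrite ler_peMr // addr_ge0 // mulr_ge0 // ltW.
have key : s + 2 * d <= 4 * d * (G * (1 + h%:R ^+ 2 * s ^+ 2 / 4)).
  apply: (@le_trans _ _ (4 * d * (1 + s ^+ 2 / (4 * d ^+ 2)))).
    rewrite (_ : 4 * d * _ = 4 * d + s ^+ 2 / d); last by field; rewrite gt_eqF.
    rewrite -(ler_pM2r d0) [leRHS]mulrDl divfK ?gt_eqF //.
    by have := sqr_ge0 (s - d / 2); have := mulr_gt0 d0 d0; lra.
  have d40 : 0 <= 4 * d by rewrite mulr_ge0 // ltW.
  apply: ler_wpM2l => //; rewrite (mulrDr G) mulr1; apply: lerD => //.
  apply: (@le_trans _ _ ((h%:R * de * nc y) ^- 2 * (h%:R ^+ 2 * s ^+ 2 / 4))); last first.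
    by rewrite ler_wpM2r // divr_ge0 // mulr_ge0 ?sqr_ge0.
  by apply: eq_ler; rewrite /d; field; rewrite !gt_eqF.
apply: (@le_trans _ _ ((s + 2 * d) * b)); first by rewrite ler_wpM2r.
apply: (@le_trans _ _ (4 * d * (G * (1 + h%:R ^+ 2 * s ^+ 2 / 4)) * b)); first by rewrite ler_wpM2r.
have d40 : 0 <= 4 * d by rewrite mulr_ge0 // ltW.
have Gb : G * (1 + h%:R ^+ 2 * s ^+ 2 / 4) * b <= G.
  by rewrite -mulrA ler_piMr ?(le_trans ler01) // mulrC.
by rewrite -(mulrA (4 * d)) ler_wpM2l.
Qed.

End CircleBounds.

Section Degrees.
Variable F : fieldType.
Implicit Types (p q : {poly F}).

Definition dg p (d : nat) := (size p <= d.+1)%N.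

Lemma dgW p d e : (d <= e)%N -> dg p d -> dg p e.
Proof. by rewrite /dg => de h; apply: leq_trans h _. Qed.

Lemma dgM p q d e : dg p d -> dg q e -> dg (p * q) (d + e).
Proof.
rewrite /dg => hp hq; apply: leq_trans (size_polyMleq _ _) _.
by have := leq_add hp hq; rewrite addSn addnS; case: (size p + size q)%N.
Qed.

Lemma dg1 : dg 1 0. Proof. by rewrite /dg size_poly1. Qed.

Lemma dgX p d k : dg p d -> dg (p ^+ k) (k * d).
Proof.
by move=> h; elim: k => [|k IH]; rewrite ?expr0 ?exprS ?mulSn; [exact: dg1 | exact: dgM].
Qed.

Lemma dg_prod (I : Type) (r : seq I) (P : pred I) (G : I -> {poly F}) (d : I -> nat) :
  (forall i, P i -> dg (G i) (d i)) ->
  dg (\prod_(i <- r | P i) G i) (\sum_(i <- r | P i) d i)%N.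
Proof. by move=> H; elim/big_rec2 : _ => [|i p e Pi]; [exact: dg1 | exact: dgM (H i Pi)]. Qed.

End Degrees.

(** * The test polynomial and the discrete estimate *)

Section Assembly.
Variables (R : realType) (lam : nat -> R[i]) (mu : nat -> nat) (c0 de : R).
Hypotheses (c00 : 0 < c0) (c01 : c0 <= 1) (de0 : 0 < de).
Hypotheses (lam0 : forall m, lam m != 0)
  (sec : forall m, c0 * Normc.normc (lam m) <= Re (lam m)).
Variables (N n : nat) (h : nat -> nat) (hs : nat) (B : R).
Hypotheses (small : forall m, (m < N)%N -> de * Normc.normc (lam m) <= 8^-1)
  (nN : (n < N)%N) (h0 : forall m, (0 < h m)%N) (hs0 : (0 < hs)%N) (B1 : 1 <= B)
  (sepB : forall m, m != n -> Normc.normc (lam n) <= B * Normc.normc (lam n - lam m)).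
Local Notation nc := (@Normc.normc R).
Local Notation L m := (nc (lam m)).
Local Notation X m := (node de (lam m)).
Local Notation Y := (locvar (X n)).
Local Notation bx m := (box R (h m + h m)).
Local Notation kl m := (killer de (lam m)).

(** Each killer comes with its own squared box; mu_n squared boxes at the n-th node are kept in
    reserve, one for each factor of Y^j with j <= mu_n. *)
Definition testU0 : {poly R[i]} :=
  (bx n ^+ 2) ^+ mu n * \prod_(m < N | (m : nat) != n) (kl m * bx m ^+ 2) ^+ mu m.

(** The additional squared box provides the factor 1 / (2 hs), of order [de], in the coefficient
    bound. *)
Definition testU : {poly R[i]} := box R (hs + hs) ^+ 2 * testU0.

(* Bounds on the unit circle of one factor [Y] of the local variable and of the remaining product. *)
Definition circT := 4 * (de * L n) * Num.max 1 (((h n)%:R * de * L n) ^- 2).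

Definition circG :=
  \prod_(m < N | (m : nat) != n) Num.max 1 (8 / (c0 * ((h m)%:R * de * L m)) ^+ 2) ^+ mu m.

Lemma circT_ge0 : 0 <= circT.
Proof. by rewrite !mulr_ge0 ?nc_ge0 ?(ltW de0) // le_max ler01. Qed.

Lemma circG_ge0 : 0 <= circG.
Proof. by apply: prodr_ge0 => m _; rewrite exprn_ge0 // le_max ler01. Qed.

Lemma box_neq0_size k : (0 < k)%N -> dg (box R k) k.
Proof.
move=> k0; rewrite /dg; apply: leq_trans (size_scale_leq _ _) _.
apply: leq_trans (size_sum _ _ _) _; apply/bigmax_leqP => i _.
by rewrite size_polyXn ltnS ltnW.
Qed.

Lemma test_circle j x : (j <= mu n)%N -> nc x = 1 -> nc (Y ^+ j * testU0).[x] <= circG * circT ^+ j.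
Proof.
move=> jm x1.
have -> : Y ^+ j * testU0 = (\prod_(m < N | (m : nat) != n) (kl m * bx m ^+ 2) ^+ mu m) *
    ((Y * bx n ^+ 2) ^+ j * (bx n ^+ 2) ^+ (mu n - j)).
  by rewrite /testU0 -{1}(subnKC jm) exprD [(Y * _) ^+ j]exprMn; ring.
rewrite hornerM ncM; apply: ler_pM; rewrite ?nc_ge0 //.
  rewrite horner_prod nc_prod; apply: ler_prod => m _; rewrite nc_ge0 /= horner_exp ncX.
  apply: lerXn2r; [by rewrite nnegrE nc_ge0 | by rewrite nnegrE le_max ler01 |].
  by apply: killer_box_circle => //; exact: small.
rewrite hornerM ncM !horner_exp !ncX -[leRHS]mulr1; apply: ler_pM; rewrite ?exprn_ge0 ?nc_ge0 //.
  apply: lerXn2r; rewrite ?nnegrE ?nc_ge0 ?circT_ge0 //.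
  by apply: (@locvar_box_circle _ c0) => //; exact: small.
by rewrite exprn_ile1 ?exprn_ge0 ?nc_ge0 // exprn_ile1 ?nc_ge0 // nc_box_le1 // addn_gt0 h0.
Qed.

Lemma test_coef j s : (j <= mu n)%N ->
  nc (Y ^+ j * testU)`_s <= circG * circT ^+ j / (hs + hs)%:R.
Proof.
move=> jm; apply: (@coef_bound _ _ (Y ^+ j * testU0)); first by rewrite addn_gt0 hs0.
  by rewrite /testU mulrCA.
by move=> x x1; exact: test_circle.
Qed.

(** A killer with its squared box has degree at most 2 + 4h <= 6h. At the n-th node only 4h per unit
    of multiplicity is used by boxes, and the slack covers Y^j. *)
Lemma test_degree j : (j <= mu n)%N ->
  dg (Y ^+ j * testU) (4 * hs + \sum_(m < N) 6 * (mu m * h m))%N.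
Proof.
move=> jm.
have dY : dg Y 1.
  rewrite /dg /locvar; apply: leq_trans (size_polyD _ _) _.
  rewrite geq_max size_polyN size_poly1 andbT; apply: leq_trans (size_scale_leq _ _) _.
  by rewrite size_polyX.
have db k : (0 < k)%N -> dg (box R (k + k) ^+ 2) (4 * k)%N.
  move=> k0; have := dgX 2 (@box_neq0_size (k + k) _).
  by rewrite addn_gt0 k0 => /(_ isT); rewrite (_ : (2 * (k + k) = 4 * k)%N) //; lia.
have dp : dg (\prod_(m < N | (m : nat) != n) (kl m * bx m ^+ 2) ^+ mu m)
    (\sum_(m < N | (m : nat) != n) 6 * (mu m * h m))%N.
  apply: dg_prod => m _.
  have dk : dg (kl m) 2 by exact: size_killer.
  by apply: dgW (dgX (mu m) (dgM dk (db _ (h0 m)))); have := h0 m; nia.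
apply: dgW (dgM (dgX j dY) (dgM (db _ hs0) (dgM (dgX (mu n) (db _ (h0 n))) dp))).
have hm : (mu n <= mu n * h n)%N by rewrite leq_pmulr // h0.
rewrite [Q in (_ <= _ + Q)%N](bigD1 (Ordinal nN)) //= muln1 (mulnCA (mu n)).
move: (\sum_(i < N | _) _)%N (mu n * h n)%N hm => Q q hm; lia.
Qed.

Local Notation C2 := (128 * (12 / c0) ^+ 2 / c0 * (12 / c0) + 24 / c0).
Local Notation C3 := (72 / c0).

(** The first sum collects the killers. In the second term the 4 comes from squaring boxes of length
    2h, with [box_invb] applied to each. *)
Definition testE := close_prod lam mu n N *
  expR (C2 * (\sum_(m < N) (mu m)%:R * Num.min 1 (L n / L m)) +
        4 * C3 * (de * L n) * (hs%:R + \sum_(m < N) (mu m)%:R * (h m)%:R)).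

Lemma test_invb : invb (X n) (mu n) (tau c0 de (lam n) B) testU testE.
Proof.
have t0 : 0 <= tau c0 de (lam n) B by rewrite ltW // tau_gt0.
have dn := small nN.
set d := de * L n.
have d0 : 0 < d by rewrite mulr_gt0 // nc_gt0.
have bxi k : (0 < k)%N -> invb (X n) (mu n) (tau c0 de (lam n) B) (box R (k + k) ^+ 2)
    (expR (4 * C3 * d * k%:R)).
  move=> k0; have kk : (0 < k + k)%N by rewrite addn_gt0 k0.
  have := invbX t0 2 (box_invb c00 c01 de0 (mu n) (sec n) dn (lam0 n) B1 kk).
  by rewrite -expRM_natl natrD -/d; apply: invb_le; rewrite ler_expR; lra.
have kli (m : 'I_N) : (m : nat) != n -> invb (X n) (mu n) (tau c0 de (lam n) B)
    ((kl m * bx m ^+ 2) ^+ mu m)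
    (closeness lam n m ^+ mu m *
     expR (C2 * ((mu m)%:R * Num.min 1 (L n / L m)) + 4 * C3 * d * ((mu m)%:R * (h m)%:R))).
  move=> mn.
  have H1 := killer_invb c00 c01 de0 (mu n) (sec n) dn (lam0 n) B1 (sec m) (small (ltn_ord m))
    (lam0 m) (sepB mn).
  apply: invb_le (invbX t0 (mu m) (invbM t0 H1 (bxi _ (h0 m)))).
  rewrite -/(closeness lam n m) -(mulrA (closeness lam n m)) -expRD exprMn -expRM_natl.
  rewrite ler_wpM2l ?exprn_ge0 ?(le_trans ler01) ?closeness_ge1 // ler_expR.
  by apply: eq_ler; ring.
have H := invbM t0 (bxi _ hs0) (invbM t0 (invbX t0 (mu n) (bxi _ (h0 n)))
   (invb_prod t0 (index_enum 'I_N) kli)).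
apply: invb_le H; rewrite big_split /= -/(close_prod lam mu n N) -expR_sum -expRM_natl.
rewrite 2!(mulrCA _ (close_prod lam mu n N)) /testE -/d; apply: ler_wpM2l; first exact: close_prod_ge0.
rewrite -!expRD ler_expR big_split /= -!mulr_sumr.
rewrite [Q in _ <= C2 * Q + _](bigD1 (Ordinal nN)) //= [Q in _ <= _ + _ * (_ + Q)](bigD1 (Ordinal nN)) //=.
have C20 : 0 <= C2 * ((mu n)%:R * Num.min 1 (L n / L n)).
  rewrite mulr_ge0 ?mulr_ge0 // ?le_min ?ler01 ?divr_ge0 ?nc_ge0 //.
  by rewrite addr_ge0 // !mulr_ge0 ?exprn_ge0 ?mulr_ge0 ?invr_ge0 ?(ltW c00).
move: C20.
set s1 := \sum_(m < N | _) _; set s2 := \sum_(m < N | _) _.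
move: (C2) (C3) s1 s2 (Num.min _ _) => k1 k2 s1 s2 mm C20.
by lra.
Qed.

Section Samples.
Variables (x1 : R) (c : nat -> nat -> R[i]) (K : nat).
Hypothesis KU : (4 * hs + \sum_(m < N) 6 * (mu m * h m) < K)%N.

Definition expoly (x : R) : R[i] := \sum_(m < N) \sum_(j < mu m) c m j * expo lam m j x.

Lemma expo_sample m j s : expo lam m j (x1 + de * s%:R) =
  cexp (lam m * x1%:C) * ((x1%:C + de%:C * s%:R) ^+ j * X m ^+ s).
Proof.
rewrite /expo; have -> : (x1 + de * s%:R)%:C = x1%:C + de%:C * s%:R.
  by apply: eqC; rewrite ?ReD ?ImD ?ReM ?ImM -(rmorph_nat (real_complex R) s) /=; ring.
rewrite mulrDr cexpD /node -cexpMn mulrCA; congr (_ * (_ * cexp _)).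
by ring.
Qed.

(** On the grid the block m contributes values at X_m of iterates of [Theta] on A. Fewer than mu_m
    iterates leave a zero at X_m, so every block except the n-th disappears. *)
Lemma sample_functional (A : {poly R[i]}) : (size A <= K)%N ->
  (forall m, (m < N)%N -> m != n -> ('X - (X m)%:P) ^+ mu m %| A) ->
  \sum_(s < K) A`_s * expoly (x1 + de * s%:R) =
  cexp (lam n * x1%:C) * Lam x1%:C de%:C (X n) (mu n) (c n) A.
Proof.
move=> sA dA.
have E : \sum_(s < K) A`_s * expoly (x1 + de * s%:R) =
    \sum_(m < N) cexp (lam m * x1%:C) * Lam x1%:C de%:C (X m) (mu m) (c m) A.
  under eq_bigr => s _ do rewrite /expoly mulr_sumr.
  rewrite exchange_big /=; apply: eq_bigr => m _.
  under eq_bigr => s _ do rewrite mulr_sumr.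
  rewrite exchange_big /= /Lam mulr_sumr; apply: eq_bigr => j _.
  rewrite -(iter_Theta_eval _ _ _ _ sA) !mulr_sumr; apply: eq_bigr => s _.
  by rewrite expo_sample; ring.
rewrite E (bigD1 (Ordinal nN)) //= big1 ?addr0 // => m mn.
rewrite /Lam big1 ?mulr0 // => j _.
by rewrite (iter_Theta_root _ _ (dA m _ _)) ?mulr0.
Qed.

Lemma sample_bound k (W : R) : (k < mu n)%N ->
  (forall l, (l < mu n)%N -> 1 + nc (x1%:C + de%:C * l%:R) <= W) ->
  nc (c n k) <= circG / (hs + hs)%:R * (\sum_(s < K) nc (expoly (x1 + de * s%:R))) *
     expR (- (x1 * Re (lam n))) * testE * (circT / tau c0 de (lam n) B) ^+ mu n *
     \sum_(i < mu n) (circT * W / de) ^+ i / i`!%:R.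
Proof.
move=> km HW; set Sg := \sum_(s < K) nc _.
have tp := tau_gt0 c00 de0 (lam0 n) B1.
have Sg0 : 0 <= Sg by apply: sumr_ge0 => s _; exact: nc_ge0.
have hsp : 0 < (hs + hs)%:R :> R by rewrite ltr0n addn_gt0 hs0.
have G0 := circG_ge0.
have e0 : 0 < nc (cexp (lam n * x1%:C)) by rewrite nc_gt0 cexp_neq0.
have ee : expR (- (x1 * Re (lam n))) = (nc (cexp (lam n * x1%:C)))^-1.
  by rewrite nc_cexp ReM /= mulr0 subr0 expRN mulrC.
have tT : tau c0 de (lam n) B <= circT.
  have d0 : 0 < de * L n by rewrite mulr_gt0 // nc_gt0.
  have Bp : 0 < 16 * B by rewrite mulr_gt0 // (lt_le_trans ltr01).
  rewrite /tau /circT; apply: (@le_trans _ _ (de * L n)).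
    rewrite ler_pdivrMr // ler_wpM2l ?(ltW d0) // (le_trans c01) // (le_trans B1) //.
    by rewrite ler_peMl ?ler1n // (le_trans ler01).
  apply: (@le_trans _ _ (4 * (de * L n))); first by lra.
  by rewrite ler_peMr ?le_max ?lexx // mulr_ge0 // ltW.
have := @coefficient_bound R x1%:C de%:C (X n) (mu n) (c n) (node_neq0 de (lam n)) _
  testU (tau c0 de (lam n) B) testE
  (circG / (hs + hs)%:R * Sg * expR (- (x1 * Re (lam n)))) circT W k tp tT.
rewrite ncR (gtr0_norm de0); apply => //.
- by rewrite (inj_eq (@complexI R)) gt_eqF.
- by rewrite !mulr_ge0 ?expR_ge0 // invr_ge0 ltW.
- by rewrite mulr_ge0 ?expR_ge0 // close_prod_ge0.
- exact: test_invb.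
move=> j jm; rewrite ee.
have sz : (size (Y ^+ j * testU)%R <= K)%N.
  by apply: leq_trans KU; exact: test_degree (ltnW jm).
have dv m : (m < N)%N -> m != n -> ('X - (X m)%:P) ^+ mu m %| Y ^+ j * testU.
  move=> mN mn; rewrite /testU /testU0 mulrCA dvdp_mull // mulrCA dvdp_mull // dvdp_mull //.
  rewrite (bigD1 (Ordinal mN)) //= dvdp_mulr //; apply: dvdp_exp2r.
  by rewrite dvdp_mulr // killer_dvd.
have := sample_functional sz dv => /(congr1 nc); rewrite ncM => E.
rewrite -(ler_pM2l e0) -E.
rewrite [leRHS](_ : _ = circG * circT ^+ j / (hs + hs)%:R * Sg); last first.
  move: ((hs + hs)%:R : R) hsp (nc (cexp (lam n * x1%:C))) e0 (circT ^+ j) => u u0 v v0 w.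
  by field; rewrite !gt_eqF.
apply: le_trans (nc_sum _ _ _) _; rewrite mulr_sumr; apply: ler_sum => s _.
by rewrite ncM ler_wpM2r ?nc_ge0 // test_coef // ltnW.
Qed.

End Samples.
End Assembly.

(** * Choice of the parameters and uniformity in the step *)

Section UniformEstimate.
Variable R : realType.
Local Notation nc := (@Normc.normc R).

Lemma pow_fact_le (y : R) i : 0 <= y -> y ^+ i / i`!%:R <= expR y.
Proof.
move=> y0; case: i => [|i]; first by rewrite expr0 fact0 divr1 -expR0 ler_expR.
by apply: le_trans (expR_ge1Dxn i y0); rewrite lerDr.
Qed.

(** Writing y = r^{-1} (r y) trades the exponential of y for that of r y at the price of (2/r)^k,
    where k <= 2^k counts the terms. With k = mu_n and y of order |lam_n|, both factors become
    subexponential. *)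
Lemma exp_sum_le (y r : R) k : 0 <= y -> 0 < r <= 1 ->
  \sum_(i < k) y ^+ i / i`!%:R <= (2 / r) ^+ k * expR (r * y).
Proof.
move=> y0 /andP[r0 r1]; have ir : 1 <= r^-1 by rewrite invf_ge1.
apply: (@le_trans _ _ (\sum_(i < k) (r^-1) ^+ k * expR (r * y))).
  apply: ler_sum => i _; apply: (@le_trans _ _ ((r^-1) ^+ i * expR (r * y))).
    rewrite (_ : y ^+ i / _ = (r^-1) ^+ i * ((r * y) ^+ i / i`!%:R)); last first.
      rewrite exprMn exprVn mulrA mulrA mulVf ?mul1r // expf_neq0 // gt_eqF //.
    rewrite ler_wpM2l ?exprn_ge0 ?invr_ge0 ?(ltW r0) // pow_fact_le //.
    by rewrite mulr_ge0 // ltW.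
  by rewrite ler_wpM2r ?expR_ge0 // ler_weXn2l // ltnW.
rewrite sumr_const card_ord -[leLHS]mulr_natl mulrA exprMn; apply: ler_wpM2r; first exact: expR_ge0.
apply: ler_wpM2r; first by rewrite exprn_ge0 // invr_ge0 ltW.
by rewrite -natrX ler_nat ltnW // ltn_expl.
Qed.

Lemma big_ord_lt (T : Type) (idx : T) (op : Monoid.law idx) (F : nat -> T) N M :
  \big[op/idx]_(m < N | (m < M)%N) F m = \big[op/idx]_(m < minn N M) F m.
Proof.
elim: N => [|N IH]; first by rewrite min0n !big_ord0.
have [NM|NM] := ltnP N M.
  rewrite (minn_idPl (ltnW NM)) in IH; rewrite (minn_idPl NM).
  by rewrite [LHS]big_mkcond [LHS]big_ord_recr big_ord_recr /= NM -big_mkcond IH.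
rewrite (minn_idPr NM) in IH; rewrite (minn_idPr (leqW NM)).
by rewrite [LHS]big_mkcond [LHS]big_ord_recr /= ltnNge NM /= Monoid.mulm1 -big_mkcond IH.
Qed.

Lemma fine_step (w : R) (b : nat -> R) N : 0 < w -> (forall m, 0 < b m) ->
  exists K0, forall K, (K0 <= K)%N -> forall m, (m < N)%N -> w / K%:R <= b m.
Proof.
move=> w0 b0; pose S := \sum_(m < N) w / b m.
exists (Num.truncn S).+1 => K KK m mN.
have K0 : 0 < K%:R :> R by rewrite ltr0n; exact: leq_trans KK.
rewrite ler_pdivrMr // mulrC -ler_pdivrMr //.
apply: (@le_trans _ _ S).
  rewrite /S (bigD1 (Ordinal mN)) //= lerDl; apply: sumr_ge0 => i _.
  by rewrite divr_ge0 // ltW.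
by apply: le_trans (ltW (truncnS_gt S)) _; rewrite ler_nat.
Qed.

Variables (lam : nat -> R[i]) (mu : nat -> nat) (c0 : R).
Local Notation L m := (nc (lam m)).
Hypotheses (c00 : 0 < c0) (c01 : c0 <= 1) (lam0 : forall m, lam m != 0)
  (lam_inj : injective lam) (mu0 : forall m, (0 < mu m)%N)
  (sec : forall m, c0 * L m <= Re (lam m))
  (cvgA : cvgn (series (fun n => (mu n)%:R / L n)))
  (cps : forall eps : R, 0 < eps -> exists C : R, forall n N,
     close_prod lam mu n N <= C * expR (eps * L n)).

(* [eta m] is the half-width of the kernel attached to [lam m]: proportional to [1 / L m], with a
   large factor from some rank on, so that the kernel absorbs the growth of the killer of [lam m]. *)
Lemma kernel_widths (th : R) : 0 < th -> exists (M0 : nat) (sig : R) (eta : nat -> R),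
  [/\ 0 < sig, forall m, 0 < eta m, forall m, sig <= eta m * L m,
     forall m, (M0 <= m)%N -> 3 <= c0 * (eta m * L m) &
     forall N, \sum_(m < N) (mu m)%:R * eta m <= 2 * th].
Proof.
move=> th0; have Lp m : 0 < L m by rewrite nc_gt0.
have [M0 HM] := density_tail cvgA (divr_gt0 (mulr_gt0 th0 c00) (ltr0n R 3)).
pose A := \sum_(m < M0) (mu m)%:R / L m.
have A0 : 0 <= A by apply: sumr_ge0 => m _; rewrite divr_ge0 // ltW.
pose sig := Num.min (th / (A + 1)) 1.
have sig0 : 0 < sig by rewrite lt_min ltr01 divr_gt0 // ltr_wpDl.
(* The finite head uses a width [sig] small enough for its total to stay below [th]; the constant 3
   / c0 in the tail makes 8 / (c0 kp)^2 = 8/9 at most 1. *)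
pose kp m := if (m < M0)%N then sig else 3 / c0.
have kp0 m : 0 < kp m by rewrite /kp; case: ifP => // _; rewrite divr_gt0.
exists M0, sig, (fun m => kp m / L m); split => //.
- by move=> m; rewrite divr_gt0.
- move=> m; rewrite divfK ?gt_eqF // /kp; case: ifP => // _.
  rewrite ge_min; apply/orP; right; rewrite ler_pdivlMr // mul1r.
  by apply: le_trans c01 _; rewrite ler1n.
- by move=> m Mm; rewrite divfK ?gt_eqF // /kp ltnNge Mm /= mulrC divfK ?gt_eqF.
move=> N; rewrite (bigID (fun m : 'I_N => (m < M0)%N)) /= mulr_natl mulr2n; apply: lerD.
  apply: (@le_trans _ _ (sig * A)); last first.
    apply: (@le_trans _ _ (th / (A + 1) * A)); first by rewrite ler_wpM2r // ge_min lexx.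
    rewrite mulrAC ler_pdivrMr ?ltr_wpDl // mulrDr mulr1 lerDl ltW //.
  rewrite (eq_bigr (fun m : 'I_N => sig * ((mu m)%:R / L m))); last first.
    by move=> m mM; rewrite /kp mM; ring.
  rewrite -mulr_sumr ler_wpM2l ?(ltW sig0) // (@big_ord_lt _ _ _ (fun m => (mu m)%:R / L m)).
  have E k j : \sum_(m < k) (mu m)%:R / L m <= \sum_(m < k + j) (mu m)%:R / L m.
    by rewrite big_split_ord /= lerDl sumr_ge0 // => m _; rewrite divr_ge0 // ltW.
  by have := E (minn N M0) (M0 - minn N M0)%N; rewrite subnKC ?geq_minr.
rewrite (eq_bigr (fun m : 'I_N => 3 / c0 * ((mu m)%:R / L m))); last first.
  by move=> m mM; rewrite /kp (negbTE mM); ring.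
rewrite -mulr_sumr (eq_bigl (fun m : 'I_N => (M0 <= m)%N)); last by move=> m; rewrite -leqNgt.
apply: le_trans (ler_wpM2l _ (HM N)) _; first by rewrite divr_ge0 // ltW.
by apply: eq_ler; field; rewrite gt_eqF.
Qed.

(** C is fixed before n, N and the coefficients; only the threshold [K0] for the fineness of the
    grid depends on them. *)
Lemma discrete_bound (w x1 eps : R) : 0 < w -> 0 < eps -> exists C : R, 0 < C /\
  forall n N (c : nat -> nat -> R[i]) k, (n < N)%N -> (k < mu n)%N ->
  exists K0, forall K, (K0 <= K)%N ->
    nc (c n k) <= C * expR (eps * L n) * expR (- (x1 * Re (lam n))) *
      (w / K%:R * \sum_(s < K) nc (expoly lam mu N c (x1 + w / K%:R * s%:R))).
Proof.
move=> w0 eps0; have Lp m : 0 < L m by rewrite nc_gt0.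
pose C2 := 128 * (12 / c0) ^+ 2 / c0 * (12 / c0) + 24 / c0.
pose C3 := 72 / c0.
have C30 : 0 < C3 by rewrite divr_gt0.
have ic : 0 < c0^-1 by rewrite invr_gt0.
have C20 : 0 < C2.
  by rewrite addr_gt0 ?mulr_gt0 ?exprn_gt0 ?mulr_gt0.
(* The degree of the test polynomial times the step is at most 8 th + 24 th <= w / 2, so it fits in
   the window; the second bound keeps the box exponent 24 C3 th below eps / 6. *)
pose th := Num.min (w / 64) (eps / (144 * C3)).
have th0 : 0 < th by rewrite lt_min !divr_gt0 // mulr_gt0.
have thw : th <= w / 64 by rewrite ge_min lexx.
have the : 24 * C3 * th <= eps / 6.
  have : th <= eps / (144 * C3) by rewrite ge_min lexx orbT.
  rewrite ler_pdivlMr ?mulr_gt0 //; lra.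
clearbody th.
have [M0 [sig [eta [sig0 eta0 etas etaM etaS]]]] := kernel_widths th0.
(* The loss eps is shared by six sources: close nodes, killers, boxes, separation, Newton sum and
   constants to the power mu_n. *)
have e6 : 0 < eps / 6 by rewrite divr_gt0.
have [Cp HCp] := cps e6.
have [Cd HCd] := density_sum cvgA (divr_gt0 e6 C20).
have [Cs [Cs0 HCs]] := separation lam0 cvgA lam_inj mu0 cps e6.
pose W := 1 + `|x1| + w.
have W0 : 0 < W by rewrite /W ltr_wpDl // addr_ge0.
pose rho := Num.max 1 (sig ^- 2).
have rho1 : 1 <= rho by rewrite le_max lexx.
have rho0 : 0 < rho by exact: lt_le_trans rho1.
(* The argument of the exponential sum is at most 4 rho W |lam_n|, so this r reduces its exponent to
   eps / 6 times |lam_n|; [q] then collects all bases with exponent mu_n. *)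
pose r := Num.min 1 (eps / 6 / (4 * rho * W)).
have r0 : 0 < r by rewrite lt_min ltr01 divr_gt0 // !mulr_gt0.
have r1 : r <= 1 by rewrite ge_min lexx.
pose q := 64 * rho / c0 * (2 / r).
have q0 : 0 < q by rewrite !mulr_gt0 ?invr_gt0.
have [Ce [Ce0 HCe]] := expn_mu_subexp lam0 cvgA e6 (ltW q0).
pose g := Num.max 1 (8 / (c0 * sig) ^+ 2).
have g1 : 1 <= g by rewrite le_max lexx.
pose Gc := \prod_(m < M0) g ^+ mu m.
have Gc1 : 0 < Gc by apply: prodr_gt0 => m _; rewrite exprn_gt0 // (lt_le_trans ltr01).
pose Cp' := Num.max Cp 1.
have Cp'0 : 0 < Cp' by rewrite lt_max ltr01 orbT.
exists (Gc / (2 * th) * (Cp' * expR (C2 * Cd)) * Cs * Ce); split.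
  by rewrite !mulr_gt0 ?invr_gt0 ?mulr_gt0 ?expR_gt0.
move=> n N c k nN kmu.
have [B [B1 sepB HB]] := HCs n.
(* Upper bounds on the step: small de |lam_m|, and kernels at least one step wide, so that rounding
   the widths up to multiples of the step at most doubles them. *)
pose b m := Num.min (8^-1 / L m) (Num.min (eta m) th).
have b0 m : 0 < b m by rewrite !lt_min divr_gt0 // eta0 th0.
have [K0 HK0] := @fine_step w b N w0 b0.
exists (maxn K0 1) => K; rewrite geq_max => /andP[KK K1].
have Kp : 0 < K%:R :> R by rewrite ltr0n.
set de := w / K%:R; have de0 : 0 < de by rewrite divr_gt0.
have deb m : (m < N)%N -> [/\ de * L m <= 8^-1, de <= eta m & de <= th].
  move=> /(HK0 K KK); rewrite -/de !le_min => /and3P[h1 h2 h3]; split => //.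
  by rewrite -ler_pdivlMr.
pose h m := (Num.truncn (eta m / de)).+1.
pose hs := (Num.truncn (th / de)).+1.
have h_ge m : eta m <= (h m)%:R * de.
  by rewrite -ler_pdivrMr // ltW // truncnS_gt.
have h_le m : (m < N)%N -> (h m)%:R * de <= 2 * eta m.
  move=> /deb[_ h2 _]; rewrite /h -natr1 mulrDl mul1r.
  have : (Num.truncn (eta m / de))%:R <= eta m / de by rewrite truncn_le divr_ge0 // ltW.
  by rewrite ler_pdivlMr //; lra.
have hs_ge : th <= hs%:R * de by rewrite -ler_pdivrMr // ltW // truncnS_gt.
have hs_le : hs%:R * de <= 2 * th.
  have [_ _ h3] := deb n nN; rewrite /hs -natr1 mulrDl mul1r.
  have : (Num.truncn (th / de))%:R <= th / de by rewrite truncn_le divr_ge0 // ltW.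
  by rewrite ler_pdivlMr //; lra.
have sumh : de * \sum_(m < N) (mu m)%:R * (h m)%:R <= 4 * th.
  rewrite mulr_sumr; apply: (@le_trans _ _ (2 * \sum_(m < N) (mu m)%:R * eta m)); last first.
    by have := etaS N; lra.
  rewrite mulr_sumr; apply: ler_sum => m _.
  have := ler_wpM2l (ler0n R (mu m)) (h_le m (ltn_ord m)); lra.
have KU : (4 * hs + \sum_(m < N) 6 * (mu m * h m) < K)%N.
  rewrite -(ltr_nat R) -(ltr_pM2l de0) /de divfK ?gt_eqF // -/de natrD natrM natr_sum.
  under eq_bigr do rewrite natrM natrM.
  rewrite -mulr_sumr; move: sumh hs_le thw.
  by set S := \sum_(m < N) _; lra.
have hp m : (0 < h m)%N by [].
have small m : (m < N)%N -> de * L m <= 8^-1 by move=> /deb[].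
have HW l : (l < mu n)%N -> 1 + nc (x1%:C + de%:C * l%:R) <= W.
  move=> lmu; rewrite /W -addrA lerD2l; apply: le_trans (ler_ncD _ _) _; rewrite ncR lerD2l.
  rewrite ncM ncR gtr0_norm // nc_nat.
  (* mu_n is below the degree bound and hence below K, so the Newton nodes x1 + de l remain in the
     window. *)
  have lK : (l <= K)%N.
    apply: ltnW; apply: ltn_trans lmu _; apply: leq_ltn_trans KU.
    rewrite (bigD1 (Ordinal nN)) //=; apply: (@leq_trans (6 * (mu n * h n))).
      by rewrite mulnCA leq_pmulr // muln_gt0 hp.
    exact: leq_trans (leq_addr _ _) (leq_addl _ _).
  by apply: (@le_trans _ _ (de * K%:R)); rewrite ?ler_wpM2l ?(ltW de0) ?ler_nat // /de divfK ?gt_eqF.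
have := @sample_bound R lam mu c0 de c00 c01 de0 lam0 sec N n h hs B small nN hp isT B1 sepB
  x1 c K KU k W kmu HW.
set Sg := \sum_(s < K) nc _; set X := expR (- _).
have Sg0 : 0 <= Sg by apply: sumr_ge0 => s _; exact: nc_ge0.
set cG := circG _ _ _ _ _ _ _; set cT := circT _ _ _ _; set tE := testE _ _ _ _ _ _ _ _.
move=> main; apply: le_trans main _.
have cGb : cG <= Gc.
  apply: (@le_trans _ _ (\prod_(m < N | (m < M0)%N) g ^+ mu m)); last first.
    rewrite (@big_ord_lt _ _ _ (fun m => g ^+ mu m)).
    have E i j : \prod_(m < i) g ^+ mu m <= \prod_(m < i + j) g ^+ mu m.
      rewrite big_split_ord /= ler_peMr //.
        by apply: prodr_ge0 => m _; rewrite exprn_ge0 // (le_trans ler01).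
      apply: (big_ind (fun x => 1 <= x)) => // [x y x1' y1|m _]; first by rewrite mulr_ege1.
      by rewrite exprn_ege1.
    by have := E (minn N M0) (M0 - minn N M0)%N; rewrite subnKC ?geq_minr.
  rewrite /cG /circG big_mkcond [leRHS]big_mkcond; apply: ler_prod => m _.
  have hL : sig <= (h m)%:R * de * L m.
    by apply: le_trans (etas m) _; rewrite ler_wpM2r ?(ltW (Lp m)).
  have gm : Num.max 1 (8 / (c0 * ((h m)%:R * de * L m)) ^+ 2) <= g.
    rewrite ge_max g1 /=; apply: (@le_trans _ _ (8 / (c0 * sig) ^+ 2)); last first.
      by rewrite le_max lexx orbT.
    have hLp := lt_le_trans sig0 hL.
    apply: ler_wpM2l => //; rewrite lef_pV2 ?posrE; last 2 first.
    - by rewrite exprn_gt0 // mulr_gt0.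
    - by rewrite exprn_gt0 // mulr_gt0.
    apply: lerXn2r; rewrite ?nnegrE; [exact: mulr_ge0 (ltW c00) (ltW sig0) |
      exact: mulr_ge0 (ltW c00) (ltW hLp) | exact: ler_wpM2l (ltW c00) _ _ hL].
  have mx0 : 0 <= Num.max 1 (8 / (c0 * ((h m)%:R * de * L m)) ^+ 2) by rewrite le_max ler01.
  apply/andP; split; first by case: ifP => // _; rewrite exprn_ge0.
  have [mM|mM] := ltnP m M0.
    case: ifP => _; last by rewrite exprn_ege1.
    by apply: lerXn2r; rewrite ?nnegrE // (le_trans ler01).
  case: ifP => // _; rewrite max_l ?expr1n //.
  have : 3 <= c0 * ((h m)%:R * de * L m).
    apply: le_trans (etaM m mM) _; rewrite ler_wpM2l ?(ltW c00) // ler_wpM2r ?(ltW (Lp m)) //.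
  set u := c0 * _ => u3; rewrite ler_pdivrMr ?mul1r; last by rewrite exprn_gt0 //; lra.
  by nra.
have dLn : 0 < de * L n by rewrite mulr_gt0.
have cTb : cT <= 4 * rho * (de * L n).
  rewrite /cT /circT (_ : 4 * rho * _ = 4 * (de * L n) * rho); last by ring.
  apply: ler_wpM2l.
    by rewrite mulr_ge0 // ltW.
  rewrite ge_max rho1 /= le_max; apply/orP; right.
  have hL : sig <= (h n)%:R * de * L n.
    by apply: le_trans (etas n) _; rewrite ler_wpM2r ?(ltW (Lp n)).
  have hLp := lt_le_trans sig0 hL.
  rewrite lef_pV2 ?posrE ?(exprn_gt0 _ hLp) ?(exprn_gt0 _ sig0) //.
  by apply: lerXn2r; rewrite ?nnegrE ?(ltW hLp) ?(ltW sig0).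
have cT0 : 0 <= cT by exact: circT_ge0.
have Bp : 0 < B by exact: lt_le_trans B1.
have tp := tau_gt0 c00 de0 (lam0 n) B1.
have ratio : (cT / tau c0 de (lam n) B) ^+ mu n <= (64 * rho / c0) ^+ mu n * (Cs * expR (eps / 6 * L n)).
  apply: (@le_trans _ _ ((64 * rho / c0 * B) ^+ mu n)).
    apply: lerXn2r; rewrite ?nnegrE; [by rewrite divr_ge0 // ltW |
      by rewrite !mulr_ge0 ?(ltW rho0) ?(ltW ic) ?(ltW Bp) |].
    rewrite ler_pdivrMr //; apply: le_trans cTb _.
    by apply: eq_ler; rewrite /tau; field; rewrite !gt_eqF.
  rewrite exprMn; apply: ler_wpM2l (HB); by rewrite exprn_ge0 // !mulr_ge0 ?(ltW rho0) ?(ltW ic).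
have sumb : \sum_(i < mu n) (cT * W / de) ^+ i / i`!%:R <= (2 / r) ^+ mu n * expR (eps / 6 * L n).
  apply: (@le_trans _ _ (\sum_(i < mu n) (4 * rho * W * L n) ^+ i / i`!%:R)).
    apply: ler_sum => i _; apply: ler_wpM2r; first by rewrite invr_ge0.
    apply: lerXn2r; rewrite ?nnegrE.
    - exact: divr_ge0 (mulr_ge0 cT0 (ltW W0)) (ltW de0).
    - by rewrite !mulr_ge0 ?(ltW W0) ?(ltW rho0) ?nc_ge0.
    rewrite ler_pdivrMr //; have := ler_wpM2r (ltW W0) cTb => /le_trans; apply.
    by apply: eq_ler; ring.
  apply: le_trans (@exp_sum_le _ r _ _ _) _; rewrite ?r0 ?r1 //.
    by rewrite !mulr_ge0 ?(ltW W0) ?(ltW rho0) ?nc_ge0.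
  rewrite ler_wpM2l ?exprn_ge0 ?divr_ge0 ?(ltW r0) // ler_expR mulrA ler_wpM2r ?nc_ge0 //.
  by rewrite -ler_pdivlMr ?mulr_gt0 // ge_min lexx orbT.
have tEb : tE <= Cp' * expR (C2 * Cd) * expR (eps / 2 * L n).
  rewrite /tE /testE; apply: (@le_trans _ _ (Cp' * expR (eps / 6 * L n) *
     expR (C2 * (eps / 6 / C2 * L n + Cd) + eps / 6 * L n))).
    apply: ler_pM; rewrite ?close_prod_ge0 ?expR_ge0 //.
      apply: le_trans (HCp n N) _; rewrite ler_wpM2r ?expR_ge0 // le_max lexx //.
    rewrite ler_expR; apply: lerD; first by rewrite ler_wpM2l ?(ltW C20) // HCd.
    apply: (@le_trans _ _ (24 * C3 * th * L n)); last by rewrite ler_wpM2r ?nc_ge0.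
    rewrite -/C3; move: sumh hs_le; set S := \sum_(m < N) _ => sumh hs_le.
    rewrite (_ : 4 * C3 * (de * L n) * (hs%:R + S) = (C3 * L n) * (4 * (hs%:R * de + de * S))); last by ring.
    rewrite (_ : 24 * C3 * th * L n = (C3 * L n) * (24 * th)); last by ring.
    by rewrite ler_wpM2l ?mulr_ge0 ?(ltW C30) ?nc_ge0 //; lra.
  rewrite -!mulrA ler_wpM2l ?(ltW Cp'0) // -!expRD ler_expR.
  by apply: eq_ler; field; rewrite gt_eqF.
have hsb : (hs + hs)%:R^-1 <= de / (2 * th).
  have hsp : 0 < hs%:R :> R by rewrite ltr0n.
  rewrite natrD -[leLHS]mul1r ler_pdivrMr ?addr_gt0 // mulrAC ler_pdivlMr ?mulr_gt0 //.
  by lra.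
have X0 : 0 <= X by exact: expR_ge0.
have mulq : (64 * rho / c0) ^+ mu n * (2 / r) ^+ mu n <= Ce * expR (eps / 6 * L n).
  by rewrite -exprMn; exact: HCe.
apply: (@le_trans _ _ (Gc * (de / (2 * th)) * Sg * X *
   (Cp' * expR (C2 * Cd) * expR (eps / 2 * L n)) *
   ((64 * rho / c0) ^+ mu n * (Cs * expR (eps / 6 * L n))) *
   ((2 / r) ^+ mu n * expR (eps / 6 * L n)))).
  have cG0 : 0 <= cG by exact: circG_ge0.
  have hs0 : 0 <= (hs + hs)%:R^-1 :> R by rewrite invr_ge0.
  have tE0 : 0 <= tE by rewrite mulr_ge0 ?close_prod_ge0 ?expR_ge0.
  have rt0 : 0 <= (cT / tau c0 de (lam n) B) ^+ mu n by rewrite exprn_ge0 // divr_ge0 // ltW.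
  have sm0 : 0 <= \sum_(i < mu n) (cT * W / de) ^+ i / i`!%:R.
    apply: sumr_ge0 => i _; apply: divr_ge0; last exact: ler0n.
    exact: exprn_ge0 (divr_ge0 (mulr_ge0 cT0 (ltW W0)) (ltW de0)).
  have p1 := mulr_ge0 (mulr_ge0 (mulr_ge0 cG0 hs0) Sg0) X0.
  have p2 := mulr_ge0 p1 tE0; have p3 := mulr_ge0 p2 rt0.
  apply: ler_pM p3 sm0 _ sumb; apply: ler_pM p2 rt0 _ ratio; apply: ler_pM p1 tE0 _ tEb.
  apply: ler_wpM2r X0 _ _ _; apply: ler_wpM2r Sg0 _ _ _; exact: ler_pM cG0 hs0 cGb hsb.
rewrite (_ : _ * ((2 / r) ^+ mu n * _) = (Gc / (2 * th) * (Cp' * expR (C2 * Cd)) * Cs *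
   (expR (eps / 2 * L n) * expR (eps / 6 * L n) * expR (eps / 6 * L n)) * X * (de * Sg)) *
   ((64 * rho / c0) ^+ mu n * (2 / r) ^+ mu n)); last by ring.
apply: le_trans (ler_wpM2l _ mulq) _.
  have t0 : 0 <= (2 * th)^-1 by rewrite invr_ge0 mulr_ge0 // ltW.
  have ex y : 0 <= expR y :> R by exact: expR_ge0.
  have [g0 p0 s0] := And3 (ltW Gc1) (ltW Cp'0) (ltW Cs0).
  by do ![apply: mulr_ge0] => //; exact: ltW.
have -> : eps * L n = eps / 2 * L n + eps / 6 * L n + eps / 6 * L n + eps / 6 * L n by field.
rewrite !expRD; apply: eq_ler; ring.
Qed.

End UniformEstimate.

(** * From samples to integrals and distances *)

Section Sector.
Variable R : realType.
Local Notation nc := (@Normc.normc R).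

Lemma pi_half_gt0 : 0 < pi / 2 :> R.
Proof. by rewrite divr_gt0 // pi_gt0. Qed.

(** Boundedness makes the supremum of the arguments a genuine upper bound; on an unbounded set [sup]
    is a default value. *)
Lemma carg_bound (z : R[i]) : `|carg z| <= 2 * pi.
Proof.
have p0 := pi_half_gt0; rewrite /carg ler_norml.
have := atan_gtNpi2 (Im z / Re z).
have := atan_ltpi2 (Im z / Re z).
by do ![case: ifP => _]; move=> *; apply/andP; split; lra.
Qed.

Lemma carg_ge_pi_half (z : R[i]) : z != 0 -> Re z <= 0 -> pi / 2 <= `|carg z|.
Proof.
have p0 := pi_half_gt0; case: z => a b /= z0 a0; rewrite /carg /= ltNge a0 /=.
have := atan_gtNpi2 (b / a); have := atan_ltpi2 (b / a); move=> u1 u2.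
have [a1|a1] := ltP a 0.
  case: ifP => _; first by apply: le_trans (ler_norm _); lra.
  by rewrite -normrN; apply: le_trans (ler_norm _); lra.
have [b1|b1] := ltP 0 b; first exact: ler_norm.
have [b2|b2] := ltP b 0; first by rewrite normrN ler_norm.
case/negP: z0; apply/eqP; have -> : a = 0 by apply/eqP; rewrite eq_le a0.
by have -> : b = 0 by apply/eqP; rewrite eq_le b1.
Qed.

(** With th the supremum of the arguments, |z| <= |Re z| + |Im z| <= (1 + tan th) Re z, so c0 = 1 /
    (1 + tan th). *)
Lemma sector_bound (lam : nat -> R[i]) : (forall n, lam n != 0) ->
  sup [set `|carg (lam n)| | n in [set: nat]] < pi / 2 ->
  exists c0 : R, [/\ 0 < c0, c0 <= 1 & forall n, c0 * nc (lam n) <= Re (lam n)].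
Proof.
move=> lam0; set th := sup _ => th_lt; have p0 := pi_half_gt0.
have th_ge n : `|carg (lam n)| <= th.
  apply: ub_le_sup; last by exists n.
  by exists (2 * pi) => _ [m _ <-]; exact: carg_bound.
have th0 : 0 <= th by apply: le_trans (th_ge 0%N).
have thI : th \in `](- (pi / 2)), (pi / 2)[ by rewrite in_itv /= th_lt andbT; lra.
have t0 : 0 <= tan th.
  rewrite -tan0; move: th0; rewrite le_eqVlt => /orP[/eqP<-//|th0].
  by rewrite ltW // ltr_tan // in_itv /=; apply/andP; split; lra.
have t1 : 0 < 1 + tan th by rewrite ltr_pwDl.
exists (1 + tan th)^-1; split; first by rewrite invr_gt0.
  by rewrite invf_le1 // lerDl.
move=> n; rewrite mulrC ler_pdivrMr //.
have [a0|a0] := leP (Re (lam n)) 0.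
  by have := le_trans (carg_ge_pi_half (lam0 n) a0) (th_ge n); rewrite leNgt th_lt.
apply: le_trans (nc_le_ReIm _) _; rewrite gtr0_norm // mulrDr mulr1 lerD2l.
have := th_ge n; rewrite /carg a0; set a := Re _ in a0 *; set b := Im _.
rewrite ler_norml => /andP[h1 h2].
have mono (x y : R) : x \in `](- (pi / 2)), (pi / 2)[ -> y \in `](- (pi / 2)), (pi / 2)[ ->
    x <= y -> tan x <= tan y.
  move=> xI yI; rewrite le_eqVlt => /orP[/eqP->//|xy].
  by rewrite ltW // ltr_tan.
have atI : atan (b / a) \in `](- (pi / 2)), (pi / 2)[.
  by rewrite in_itv /= atan_gtNpi2 atan_ltpi2.
have thNI : - th \in `](- (pi / 2)), (pi / 2)[ by rewrite in_itv /=; apply/andP; split; lra.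
have := mono _ _ atI thI h2; have := mono _ _ thNI atI h1.
rewrite tanN atanK ler_pdivlMr // ler_pdivrMr // => q1 q2.
by rewrite ler_norml; apply/andP; split; lra.
Qed.

End Sector.

(** * Riemann sums *)

Section RiemannSum.
Variable R : realType.

Lemma uniform_continuity (f : R -> R) (a b e : R) : continuous f -> 0 < e ->
  exists2 d : R, 0 < d & forall x h, a <= x <= b -> `|h| < d -> `|f (x + h) - f x| <= e.
Proof.
move=> cf e0; have e2 : 0 < e / 2 by rewrite divr_gt0.
have /compact_near_coveringP H := @segment_compact R a b.
pose P (d x : R) := forall h, `|h| < d -> `|f (x + h) - f x| <= e.
have : \forall d \near (0 : R)^'+, `[a, b] `<=` P d.
  apply: H => x _; have /cvgrPdist_lt/(_ _ e2) := cf x.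
  move=> /nbhs_ballP[r /= r0 Hr].
  have r2 : 0 < r / 2 by rewrite divr_gt0.
  exists (ball x (r / 2), [set d | d < r / 2]) => /=.
    by split; [exact: nbhsx_ballx | exact: nbhs_right_lt].
  move=> [y d] /= [xy dr] h hd.
  have q1 : `|f x - f y| < e / 2 by apply: Hr; apply: le_ball xy; lra.
  have q2 : `|f x - f (y + h)| < e / 2.
    apply: Hr; rewrite /ball /= (_ : x - (y + h) = (x - y) - h); last by ring.
    by apply: le_lt_trans (ler_normB _ _) _; move: xy; rewrite /ball /=; lra.
  rewrite (_ : _ - _ = (f x - f y) - (f x - f (y + h))); last by ring.
  by apply: le_trans (ler_normB _ _) _; lra.
move=> Hn; have [d [d0 Hd]] := filter_ex (filterI (@nbhs_right_gt R 0) Hn).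
by exists d => // x h xab; apply: Hd => /=; rewrite in_itv.
Qed.

(** On each cell the mean value theorem writes the increment of a primitive as the step times a
    value of f, which uniform continuity compares with the value at the left end; the increments
    telescope. *)
Lemma riemann_sum_le (f : R -> R) (a w e : R) : continuous f -> 0 < w -> 0 < e ->
  exists K0, forall K, (K0 <= K)%N -> ((w / K%:R * \sum_(s < K) f (a + w / K%:R * s%:R))%:E <=
    \int[lebesgue_measure]_(x in `[a, (a + w)%R]) (f x)%:E + e%:E)%E.
Proof.
move=> cf w0 e0; have [U HU] := real_primitive cf.
have dU x : derivable U x 1 by have [] := HU x.
have cU : continuous U by move=> x; apply: differentiable_continuous; apply/derivable1_diffP.
have -> : (\int[lebesgue_measure]_(x in `[a, (a + w)%R]) (f x)%:E = (U (a + w) - U a)%:E)%E.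
  rewrite (@continuous_FTC2 _ f U) //; first by rewrite ltrDl.
  - exact: continuous_subspaceT.
  - split => [x _||]; first exact: dU.
    + by apply: cvg_at_right_filter; exact: cU.
    + by apply: cvg_at_left_filter; exact: cU.
  - by move=> x _; have [] := HU x.
have [d d0 Hd] := @uniform_continuity f a (a + w) (e / w) cf (divr_gt0 e0 w0).
have d20 : 0 < d / 2 by rewrite divr_gt0.
have [K0 HK] := @fine_step R w (fun=> d / 2) 1 w0 (fun=> d20).
exists (maxn K0 1) => K; rewrite geq_max => /andP[KK K1].
have Kp : 0 < K%:R :> R by rewrite ltr0n.
have := HK K KK 0%N isT; set de := w / K%:R => ded.
have de0 : 0 < de by rewrite divr_gt0.
have step s : (s < K)%N -> de * f (a + de * s%:R) <=
    U (a + de * s.+1%:R) - U (a + de * s%:R) + de * (e / w).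
  move=> sK; set y := a + de * s%:R.
  have yE : a + de * s.+1%:R = y + de by rewrite /y -natr1; ring.
  have [|||x] := @MVT R U f y (y + de).
  - by rewrite ltrDl.
  - by move=> x _; have [dx <-] := HU x; rewrite derive1E; apply: DeriveDef.
  - exact: continuous_subspaceT.
  rewrite in_itv /= yE => /andP[x1 x2] ->.
  rewrite (_ : y + de - y = de); last by ring.
  rewrite [leLHS]mulrC [de * (e / w)]mulrC -mulrDl ler_wpM2r ?(ltW de0) //.
  have yI : a <= y <= a + w.
    rewrite /y lerDl mulr_ge0 ?(ltW de0) // lerD2l.
    apply: (@le_trans _ _ (de * K%:R)); last by rewrite /de divfK ?gt_eqF.
    by rewrite ler_wpM2l ?(ltW de0) // ler_nat ltnW.
  have := Hd y (x - y) yI; rewrite (_ : y + (x - y) = x) => [H|]; last by ring.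
  have : `|f x - f y| <= e / w by apply: H; rewrite ger0_norm; lra.
  by rewrite ler_norml => /andP[]; lra.
rewrite -EFinD lee_fin mulr_sumr.
apply: (@le_trans _ _ (\sum_(s < K) (U (a + de * s.+1%:R) - U (a + de * s%:R) + de * (e / w)))).
  by apply: ler_sum => s _; exact: step.
rewrite big_split /= sumr_const card_ord -(big_mkord xpredT
  (fun s => U (a + de * s.+1%:R) - U (a + de * s%:R))).
rewrite (@telescope_sumr _ 0 K (fun s => U (a + de * s%:R))) // mulr0 addr0.
have -> : de * K%:R = w by rewrite /de divfK ?gt_eqF.
rewrite lerD2l -[leLHS]mulr_natr mulrAC (_ : de * K%:R = w); last by rewrite /de divfK ?gt_eqF.
by rewrite mulrC divfK ?gt_eqF.
Qed.

End RiemannSum.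

(** * Comparison of L^1 and L^p, uniformly in p *)

Section LpEstimate.
Variable R : realType.
Local Notation nc := (@Normc.normc R).
Local Notation leb := (@lebesgue_measure R).

(** The convex function x^p lies above its tangent at x = 1. *)
Lemma powR_tangent (x p : R) : 0 <= x -> 1 <= p -> p * x <= x `^ p + (p - 1).
Proof.
move=> x0 p1; have [->|xn] := eqVneq x 0.
  by rewrite powR0 ?mulr0 ?add0r ?subr_ge0 // gt_eqF // (lt_le_trans ltr01).
have xp : 0 < x by rewrite lt_neqAle eq_sym xn.
have := expR_ge1Dx ((p - 1) * ln x); have := expR_ge1Dx (- ln x).
set s := ln x => h1 h2.
have -> : x `^ p = x * expR ((p - 1) * s).
  rewrite /powR (negbTE xn) -/s; have -> : x = expR s by rewrite lnK.
  by rewrite -expRD; congr expR; ring.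
have e1 : x * expR (- s) = 1 by rewrite expRN lnK // divff.
have p10 : 0 <= p - 1 by rewrite subr_ge0.
have k1 := ler_wpM2l x0 h2; have := ler_wpM2l (mulr_ge0 p10 x0) h1.
by rewrite -[_ * expR (- s)]mulrA e1; lra.
Qed.

Lemma measurable_normc (D : set R) (f : R -> R[i]) : measurable D ->
  measurable_fun D (fun x => Re (f x)) -> measurable_fun D (fun x => Im (f x)) ->
  measurable_fun D (fun x => nc (f x)).
Proof.
move=> mD mr mi.
apply: (@eq_measurable_fun _ _ _ _ D
  (Num.sqrt \o (fun x => Re (f x) ^+ 2 + Im (f x) ^+ 2))).
  by move=> x _; rewrite /= ncE.
apply: measurableT_comp; first exact: continuous_measurable_fun (@sqrt_continuous R).
by apply: measurable_funD; exact: measurable_funX.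
Qed.

(** The tangent inequality for |f| / t is integrated: (p/t) times the L^1 norm is at most 1 + (p -
    1)(bet - gam) <= p max (1, bet - gam). Dividing by p leaves a constant free of p. *)
Lemma L1_le_Lp (gam bet p t : R) (f : R -> R[i]) : gam < bet -> 1 <= p -> 0 < t ->
  measurable_fun `]gam, bet[ (fun x => Re (f x)) ->
  measurable_fun `]gam, bet[ (fun x => Im (f x)) ->
  (Lpnorm gam bet p f < t%:E)%E ->
  (\int[leb]_(x in `]gam, bet[) (nc (f x))%:E <= (Num.max 1 (bet - gam) * t)%:E)%E.
Proof.
move=> gb p1 t0 mr mi; have p0 : 0 < p := lt_le_trans ltr01 p1.
have mD : measurable (`]gam, bet[ : set R) by exact: measurable_itv.
have mf := measurable_normc mD mr mi.
have mfp : measurable_fun `]gam, bet[ (fun x => nc (f x) `^ p).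
  exact: (measurableT_comp (measurable_powR p) mf).
rewrite /Lpnorm; set X := (\int[leb]_(x in _) _)%E => Xt.
have X0 : (0 <= X)%E by apply: integral_ge0 => x _; rewrite lee_fin powR_ge0.
have Xtp : (X <= (t `^ p)%:E)%E.
  have -> : X = ((X `^ p^-1) `^ p)%E by rewrite -poweRrM mulVf ?gt_eqF // poweRe1.
  rewrite -poweR_EFin; apply: gt0_ler_poweR; rewrite ?(ltW p0) //.
  - by rewrite in_itv /= poweR_ge0 leey.
  - by rewrite in_itv /= lee_fin (ltW t0) leey.
  - exact: ltW.
set I := (\int[leb]_(x in _) _)%E.
have tp0 : 0 < t `^ p by rewrite powR_gt0.
have : ((p / t)%:E * I <= (t `^ p)^-1%:E * X + ((p - 1) * (bet - gam))%:E)%E.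
  have -> : ((p - 1) * (bet - gam))%:E = (\int[leb]_(x in `]gam, bet[) (p - 1)%:E)%E.
    by rewrite integral_cst //= lebesgue_measure_itv /= lte_fin gb -EFinB -EFinM.
  have -> : ((p / t)%:E * I = \int[leb]_(x in `]gam, bet[) ((p / t)%:E * (nc (f x))%:E))%E.
    rewrite ge0_integralZl_EFin //=; last by rewrite divr_ge0 // ltW.
    - by move=> x _; rewrite lee_fin nc_ge0.
    - exact/measurable_EFinP.
  have -> : ((t `^ p)^-1%:E * X =
      \int[leb]_(x in `]gam, bet[) ((t `^ p)^-1%:E * (nc (f x) `^ p)%:E))%E.
    rewrite ge0_integralZl_EFin //=; last by rewrite invr_ge0 ltW.
    - by move=> x _; rewrite lee_fin powR_ge0.
    - exact/measurable_EFinP.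
  have <- : (\int[leb]_(x in `]gam, bet[) ((t `^ p)^-1%:E * (nc (f x) `^ p)%:E + (p - 1)%:E) =
      \int[leb]_(x in `]gam, bet[) ((t `^ p)^-1%:E * (nc (f x) `^ p)%:E) +
      \int[leb]_(x in `]gam, bet[) (p - 1)%:E)%E.
    rewrite ge0_integralD //=.
    - by move=> x _; rewrite -EFinM lee_fin mulr_ge0 ?powR_ge0 // invr_ge0 ltW.
    - by apply/measurable_EFinP; apply: measurable_funM.
    - by move=> x _; rewrite lee_fin subr_ge0.
  apply: ge0_le_integral => //=.
  - by move=> x _; rewrite -EFinM lee_fin mulr_ge0 ?nc_ge0 // divr_ge0 // ltW.
  - by apply/measurable_EFinP; apply: measurable_funM.
  - by apply/measurable_EFinP; apply: measurable_funD => //; apply: measurable_funM.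
  move=> x _; rewrite -!EFinM -EFinD lee_fin.
  have tV : t^-1 `^ p = (t `^ p)^-1.
    by rewrite -powR_inv1 ?(ltW t0) // -powRrM mulN1r powRN.
  have := powR_tangent (divr_ge0 (nc_ge0 (f x)) (ltW t0)) p1.
  rewrite powRM ?nc_ge0 ?invr_ge0 ?(ltW t0) // tV [(t `^ p)^-1 * _]mulrC => /(le_trans _); apply.
  by rewrite mulrAC mulrA.
have Xf : ((t `^ p)^-1%:E * X <= 1)%E.
  have -> : (1 = (t `^ p)^-1%:E * (t `^ p)%:E :> \bar R)%E by rewrite -EFinM mulVf ?gt_eqF.
  by rewrite lee_wpmul2l // lee_fin invr_ge0 ltW.
move=> H; have {H} : ((p / t)%:E * I <= (1 + (p - 1) * (bet - gam))%:E)%E.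
  by apply: le_trans H _; rewrite EFinD leeD.
have I0 : (0 <= I)%E by apply: integral_ge0 => x _; rewrite lee_fin nc_ge0.
case: I I0 => [r| |] // r0; last by rewrite gt0_muley ?lte_fin ?divr_gt0.
rewrite -EFinM !lee_fin mulrAC ler_pdivrMr // => H.
set M := Num.max _ _; have M1 : 1 <= M by rewrite le_max lexx.
have Ml : bet - gam <= M by rewrite le_max lexx orbT.
have : p * r <= p * (M * t).
  apply: le_trans H _; rewrite mulrA ler_wpM2r ?(ltW t0) //.
  have : (p - 1) * (bet - gam) <= (p - 1) * M by rewrite ler_wpM2l // subr_ge0.
  lra.
by rewrite ler_pM2l.
Qed.

End LpEstimate.

(** * Regularity of exponential polynomials *)

Section ExponentialSpan.
Variable R : realType.
Local Notation nc := (@Normc.normc R).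
Local Notation leb := (@lebesgue_measure R).

Lemma centire_sum (F : nat -> R[i] -> R[i]) n : (forall i, centire (F i)) ->
  centire (fun z => \sum_(i < n) F i z).
Proof.
move=> HF z; elim: n => [|n [l IH]].
  by exists 0; apply: cdiff_ext (@cdiff_cst R 0 z) => w; rewrite big_ord0.
have [m Hm] := HF n z; exists (l + m).
by apply: cdiff_ext (cdiffD IH Hm) => w; rewrite big_ord_recr.
Qed.

Lemma centire_expo (a : R[i]) j : centire (fun z => z ^+ j * cexp (a * z)).
Proof.
move=> z; have He := cdiff_comp (@cdiff_cexp R (a * z)) (cdiffZ a (@cdiff_id R z)).
case: j => [|j]; last by eexists; exact: cdiffM (@cdiffX R j z) He.
by eexists; apply: cdiff_ext He => w; rewrite expr0 mul1r.
Qed.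

Lemma rcont_expoly (lam : nat -> R[i]) mu N c x : rcont (expoly lam mu N c) x.
Proof.
pose F z : R[i] := \sum_(m < N) \sum_(j < mu m) c m j * (z ^+ j * cexp (lam m * z)).
have HF : centire F.
  apply: (@centire_sum (fun m z => \sum_(j < mu m) c m j * (z ^+ j * cexp (lam m * z)))) => m.
  apply: (@centire_sum (fun j z => c m j * (z ^+ j * cexp (lam m * z)))) => j z.
  by have [l Hl] := @centire_expo (lam m) j z; exists (c m j * l); exact: cdiffZ.
have [l /cdiff_cont Hl] := HF (0 + x%:C * 1).
have := ccont_line Hl; rewrite (_ : (fun s : R => F (0 + s%:C * 1)) = expoly lam mu N c) //.
by apply/funext => s; rewrite add0r mulr1.
Qed.

Lemma rcont_normc (V : R -> R[i]) x : rcont V x -> {for x, continuous (fun t => nc (V t) : R)}.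
Proof.
move=> H; apply/cvgrPdist_le => e e0; have [d d0 Hd] := H _ e0.
apply/nbhs_ballP; exists d => //= y; rewrite /ball /= distrC => /Hd.
rewrite (_ : x + (y - x) = y); last by ring.
move=> h; rewrite ler_norml; have := lerB_nc (V x) (V y); have := lerB_nc (V y) (V x).
by rewrite (ncB (V x)) => *; apply/andP; split; lra.
Qed.

Lemma measurable_expoly (lam : nat -> R[i]) mu N c (D : set R) : measurable D ->
  measurable_fun D (fun x => Re (expoly lam mu N c x)) /\
  measurable_fun D (fun x => Im (expoly lam mu N c x)).
Proof.
move=> mD; split; apply: (@measurable_funS _ _ _ _ setT) => //; apply: continuous_measurable_fun => x.
  exact: rcont_Re (@rcont_expoly _ _ _ _ x).
exact: rcont_Im (@rcont_expoly _ _ _ _ x).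
Qed.

(** The range is enlarged to contain n, and coefficients beyond the length of h are set to 0; since
    h omits (n,k), the coefficient there is exactly 1. *)
Lemma expo_sub_span (lam : nat -> R[i]) mu n k h : (k < mu n)%N -> span_minus lam mu n k h ->
  exists N c, [/\ (n < N)%N, c n k = 1 & (fun x => expo lam n k x - h x) = expoly lam mu N c].
Proof.
move=> kmu [N [c ->]]; exists (maxn N n.+1), (fun m j =>
  if (m, j) == (n, k) then 1 else if (m < N)%N then - c m j else 0).
rewrite leq_max leqnn orbT eqxx; split => //; apply/funext => x; rewrite /expoly.
have nN : (n < maxn N n.+1)%N by rewrite leq_max leqnn orbT.
rewrite (big_ord_widen (maxn N n.+1) (fun m => \sum_(j < mu m | (m, j : nat) != (n, k))
  c m j * expo lam m j x)) ?leq_maxl //.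
have {1}-> : expo lam n k x = \sum_(m < maxn N n.+1) \sum_(j < mu m)
    (if (m : nat, j : nat) == (n, k) then expo lam m j x else 0).
  rewrite (bigD1 (Ordinal nN)) //= (bigD1 (Ordinal kmu)) //= eqxx !big1 ?addr0 //.
    move=> m mn; rewrite big1 // => j _; case: eqP => // -[e _].
    by case/eqP: mn; apply: val_inj.
  move=> j jk; case: eqP => // -[e]; by case/eqP: jk; apply: val_inj.
rewrite [in X in _ - X]big_mkcond -sumrB; apply: eq_bigr => m _.
rewrite [in X in _ - X](big_mkcond (fun j => _ != _)).
have -> (b : bool) (y : R[i]) : (if b then y else 0) = y *+ b by case: b.
rewrite -sumrMnl -sumrB; apply: eq_bigr => j _.
case: eqP => _ /=; first by rewrite mul0rn subr0 mul1r.
by case: ltnP => _; rewrite ?mulr1n ?mulr0n ?mul0r ?mulNr sub0r ?oppr0.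
Qed.

End ExponentialSpan.

(** * The lower bound for exponential polynomials *)

Section LowerBound.
Variable R : realType.
Local Notation nc := (@Normc.normc R).
Local Notation leb := (@lebesgue_measure R).
Variables (lam : nat -> R[i]) (mu : nat -> nat) (gam bet : R).
Hypotheses (hms : multiplicity_seq lam mu) (habc : class_ABC lam mu) (hgb : gam < bet).

(** Half of eps pays for the distance 2w from x1 to bet, the other half for the subexponential loss:
    (eps/2) c0 |lam_n| <= (eps/2) Re lam_n by the sector condition. *)
Lemma expoly_L1_lower_bound (eps : R) : 0 < eps -> exists u : R, 0 < u /\
  forall n k N c, (n < N)%N -> (k < mu n)%N -> c n k = 1 ->
  ((u * expR ((bet - eps) * Re (lam n)))%:E <=
    \int[leb]_(x in `]gam, bet[) (nc (expoly lam mu N c x))%:E)%E.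
Proof.
move=> eps0; have [lam_inj [lam0 [_ [_ mu0]]]] := hms; have [cvgA [hB IV]] := habc.
have [c0 [c00 c01 sec]] := sector_bound lam0 hB.
have cps := close_prod_subexp hms IV.
(* The window [bet - 2w, bet - w] lies inside the open interval because 3w <= bet - gam. *)
pose w := Num.min ((bet - gam) / 3) (eps / 4); pose x1 := bet - 2 * w.
have w0 : 0 < w by rewrite lt_min !divr_gt0 // subr_gt0.
have w1 : w <= (bet - gam) / 3 by rewrite ge_min lexx.
have w2 : w <= eps / 4 by rewrite ge_min lexx orbT.
clearbody w; have e0 : 0 < eps / 2 * c0 by rewrite mulr_gt0 // divr_gt0.
have [C [C0 HC]] := discrete_bound c00 c01 lam0 lam_inj mu0 sec cvgA cps x1 w0 e0.
exists C^-1; split; first by rewrite invr_gt0.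
move=> n k N c nN kmu cnk; set P := expoly lam mu N c.
have Re0 : 0 <= Re (lam n) by apply: le_trans (sec n); rewrite mulr_ge0 ?nc_ge0 // ltW.
have cP : continuous (fun x => nc (P x)) by move=> x; exact: (rcont_normc (@rcont_expoly R lam mu N c x)).
have mD : measurable (`]gam, bet[ : set R) by exact: measurable_itv.
apply: (@le_trans _ _ (\int[leb]_(x in `[x1, (x1 + w)%R]) (nc (P x))%:E)%E); last first.
  apply: ge0_subset_integral => //.
  - apply/measurable_EFinP; apply: (@measurable_funS _ _ _ _ setT) => //.
    exact: continuous_measurable_fun.
  - by move=> x _; rewrite lee_fin nc_ge0.
  - by move=> x /=; rewrite !in_itv /= /x1 => /andP[? ?]; apply/andP; split; lra.
have [K0 HK0] := HC n N c k nN kmu.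
set A := C * _ * _ in HK0.
have A0 : 0 < A by rewrite !mulr_gt0 ?expR_gt0.
apply: (@le_trans _ _ A^-1%:E).
  rewrite lee_fin /A -mulrA invfM ler_wpM2l ?invr_ge0 ?(ltW C0) //.
  rewrite -expRD -expRN ler_expR.
  have := ler_wpM2l (_ : 0 <= eps / 2) (sec n).
  have := ler_wpM2r Re0 (_ : 2 * w <= eps / 2).
  rewrite /x1 => h1 h2; have {}h1 := h1 ltac:(lra); have {}h2 := h2 ltac:(lra).
  move: h1 h2; set a := Re (lam n); set b := nc (lam n); nra.
(* The limit delta -> 0 is taken here: for every d, one K beyond both thresholds satisfies the
   discrete bound and approximates the integral up to d. *)
apply/lee_addgt0Pr => d d0.
have [K1 HK1] := riemann_sum_le x1 cP w0 d0.
apply: le_trans (HK1 (maxn K0 K1) (leq_maxr _ _)).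
rewrite lee_fin -[leLHS]mul1r ler_pdivrMr // mulrC.
by have := HK0 (maxn K0 K1) (leq_maxl _ _); rewrite cnk nc1.
Qed.

End LowerBound.

Section ComplexMeasurability.
Variable R : realType.

Lemma measurable_ReImB (D : set R) (f g : R -> R[i]) :
  measurable_fun D (fun x => Re (f x)) /\ measurable_fun D (fun x => Im (f x)) ->
  measurable_fun D (fun x => Re (g x)) /\ measurable_fun D (fun x => Im (g x)) ->
  measurable_fun D (fun x => Re (f x - g x)) /\
  measurable_fun D (fun x => Im (f x - g x)).
Proof.
move=> [fr fi] [gr gi]; split.
  rewrite (_ : (fun x => _) = (fun x => Re (f x) - Re (g x))).
    exact: measurable_funB.
  by apply/funext => x; rewrite ReD ReN.
rewrite (_ : (fun x => _) = (fun x => Im (f x) - Im (g x))).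
  exact: measurable_funB.
by apply/funext => x; rewrite ImD ImN.
Qed.

Lemma measurable_expo (lam : nat -> R[i]) mu n k (D : set R) : (k < mu n)%N -> measurable D ->
  measurable_fun D (fun x => Re (expo lam n k x)) /\
  measurable_fun D (fun x => Im (expo lam n k x)).
Proof.
move=> kmu mD; have [|N [c [_ _ E]]] := @expo_sub_span R lam mu n k (fun=> 0) kmu.
  by exists 0%N, (fun _ _ => 0); apply/funext => x; rewrite big_ord0.
have <- : expoly lam mu N c = expo lam n k by rewrite -E; apply/funext => x; rewrite subr0.
exact: measurable_expoly.
Qed.

End ComplexMeasurability.

(** If g is too close to e_{n,k}, approximate it in turn by some h of the span. Both errors are
    first converted to L^1, with a constant free of p, and only then added; e_{n,k} - h contradicts
    the lower bound for exponential polynomials. *)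
Theorem theorem1p1 (R : realType) (lam : nat -> R[i]) (mu : nat -> nat)
  (hms : multiplicity_seq lam mu) (habc : class_ABC lam mu)
  (gam bet : R) (hgb : gam < bet) :
  forall eps : R, 0 < eps ->
  exists u : R, 0 < u /\
    forall (p : R), 1 <= p -> forall (n k : nat), (k < mu n)%N ->
      ((u * expR ((bet - eps) * complex.Re (lam n)))%:E
         <= Ddist lam mu gam bet p n k)%E.
Proof.
move=> eps eps0; have [u [u0 Hu]] := expoly_L1_lower_bound hms habc hgb eps0.
set M := Num.max 1 (bet - gam); have M0 : 0 < M by rewrite lt_max ltr01.
(* Each of the two L^1 errors is at most M t = u E / 4, so their sum u E / 2 stays below u E. *)
have v0 : 0 < u / (4 * M) by rewrite divr_gt0 // mulr_gt0.
exists (u / (4 * M)); split => // p p1 n k kmu.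
set E := expR _; have E0 : 0 < E by exact: expR_gt0.
set t := _ * E; have t0 : 0 < t by exact: mulr_gt0.
apply/ereal_infP => _ [g [[gr [gi _]] Hg] <-]; rewrite leNgt; apply/negP => eg_lt.
have [h [hspan gh_lt]] := Hg t t0.
have [N [c [nN cnk ehE]]] := expo_sub_span kmu hspan.
have mD : measurable (`]gam, bet[%classic : set R) by exact: measurable_itv.
have me := @measurable_expo R lam mu n k _ kmu mD.
have meh := @measurable_expoly R lam mu N c _ mD.
have meg := measurable_ReImB me (conj gr gi).
pose gh x := g x - h x.
have mgh : measurable_fun `]gam, bet[%classic (fun x => Re (gh x)) /\
    measurable_fun `]gam, bet[%classic (fun x => Im (gh x)).
  have -> : gh = (fun x => expoly lam mu N c x - (expo lam n k x - g x)).
    by apply/funext => x; rewrite -ehE /gh; ring.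
  exact: measurable_ReImB.
have Ieg := L1_le_Lp hgb p1 t0 meg.1 meg.2 eg_lt.
have Igh := L1_le_Lp hgb p1 t0 mgh.1 mgh.2 gh_lt.
have := Hu n k N c nN kmu cnk; rewrite leNgt => /negP; apply.
apply: (@le_lt_trans _ _ ((M * t)%:E + (M * t)%:E)%E).
  apply: le_trans (leeD Ieg Igh); rewrite -ge0_integralD //=.
  - apply: ge0_le_integral => //=.
    + by move=> x _; rewrite lee_fin nc_ge0.
    + by apply/measurable_EFinP; exact: measurable_normc mD meh.1 meh.2.
    + apply/measurable_EFinP/measurable_funD.
        exact: measurable_normc mD meg.1 meg.2.
      exact: measurable_normc mD mgh.1 mgh.2.
    + by move=> x _; rewrite lee_fin -ehE ler_ncD3.
  - by move=> x _; rewrite lee_fin nc_ge0.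
  - by apply/measurable_EFinP; exact: measurable_normc mD meg.1 meg.2.
  - by move=> x _; rewrite lee_fin nc_ge0.
  - by apply/measurable_EFinP; exact: measurable_normc mD mgh.1 mgh.2.
rewrite -EFinD lte_fin -/E (_ : M * t + M * t = u * E / 2); last by rewrite /t; field; rewrite gt_eqF.
by have := mulr_gt0 u0 E0; lra.
Qed.
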